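(* Let $u,v\in\mathcal U(d)$ and let $c>0$. If $u\prec cv$ and $v\prec cu$, then $\mathrm{d}_{\mathrm{HR}}(u,v)\leq 28\sqrt{1-c^{-2}}$. Consequently, for all $u,v\in\mathcal U(d)$, $$\mathrm{d}_{\mathrm{HR}}(u,v)\leq 56\, \mathrm{d}_{\mathrm{D}}(u,v)^{1/2}.$$
   Context: Fix $d\in\mathbb N$. All unitary tuples act on separable Hilbert spaces. For $d$-tuples of unitaries $u=(u_1,\dots,u_d)$, $v=(v_1,\dots,v_d)$ write $u\sim v$ if there is a $*$-isomorphism $\pi\colon C^*(u)\to C^*(v)$ with $\pi(u_i)=v_i$ for all $i$ (here $C^*(u)$ is the C*-algebra generated by $u_1,\dots,u_d$). $\mathcal U(d)$ is the set of $\sim$-equivalence classes of $d$-tuples of unitaries; tuples are identified with their classes. For $X=(X_1,\dots,X_d)\in B(H)^d$, $\|X\|:=\max_i\|X_i\|$. For unitary tuples $u,v$ and $c>0$, write $u\prec cv$ if there exist Hilbert spaces $H\subseteq K$ and tuples $U\in B(H)^d$, $V\in B(K)^d$ with $U\sim u$, $V\sim v$ and $U_i=P_H\,cV_i|_H$ for all $i$, where $P_H$ is the orthogonal projection of $K$ onto $H$. Put $c(u,v)=\inf\{c: u\prec cv\}$ (with $\inf\emptyset=+\infty$). Define $$\mathrm d_{\mathrm{HR}}(u,v)=\inf\{\|u'-v'\| : u',v'\in B(H)^d \text{ for some } H,\ u'\sim u,\ v'\sim v\},$$ $$\mathrm d_{\mathrm D}(u,v)=\log\max\{c(u,v),c(v,u)\}.$$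 *)

(* Defs.v *)
From HB Require Import structures.
From mathcomp Require Import all_boot all_order all_algebra.
From mathcomp Require Import sesquilinear.
From mathcomp Require Import complex.
From mathcomp Require Import all_classical all_reals all_analysis.

Set Implicit Arguments.
Unset Strict Implicit.
Unset Printing Implicit Defensive.

Import Order.TTheory GRing.Theory Num.Theory.
Import numFieldNormedType.Exports.

Local Open Scope classical_set_scope.
Local Open Scope ring_scope.
Local Open Scope complex_scope.

(* The norm of a normedModType over R[i] takes its values in R[i] (they are
   nonnegative reals).  The inner product is linear in its first argument. *)
HB.mixin Record isHilbert (R : realType) V & CompleteNormedModule R[i] V := {
  hdot : {dot V for @Num.conj R[i]};
  sqr_hnorm : forall x : V, `|x| ^+ 2 = hdot x x
}.

#[short(type="hilbertType")]
HB.structure Definition Hilbert (R : realType) :=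
  {V of isHilbert R V & CompleteNormedModule R[i] V}.

Definition separable (T : topologicalType) : Prop :=
  exists2 A : set T, countable A & dense A.

Section Operators.
Context {R : realType} {H : hilbertType R}.
Implicit Types (A B : H -> H) (S : set (H -> H)).

Definition bounded_op A : Prop := linear A /\ continuous A.

Definition opnorm A : R :=
  sup [set complex.Re `|A x| | x in [set x : H | `|x| <= 1]].

(* By the Riesz theorem every bounded A has exactly one adjoint B = A^*. *)
Definition is_adjoint A B : Prop := forall x y, hdot (A x) y = hdot x (B y).

Definition unitary_op A : Prop :=
  bounded_op A /\
  exists B, [/\ bounded_op B, is_adjoint A B, A \o B = id & B \o A = id].

(* C*-subalgebras of B(H), with 1 not required; the algebra generated by a
   nonempty tuple of unitaries contains 1 anyway. *)
Definition cstar_subalgebra S : Prop :=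
  [/\ S `<=` bounded_op,
      S 0 /\ (forall A B, S A -> S B -> S (A + B)),
      (forall (a : R[i]) A, S A -> S (a *: A)) /\
        (forall A B, S A -> S B -> S (A \o B)),
      (forall A B, S A -> bounded_op B -> is_adjoint A B -> S B) &
      (forall A, bounded_op A ->
        (forall e : R, 0 < e -> exists2 B, S B & opnorm (A - B) < e) -> S A)].

Definition cstar_gen d (u : 'I_d -> H -> H) : set (H -> H) :=
  [set A | forall S, cstar_subalgebra S -> (forall i, S (u i)) -> S A].

Definition tuple_norm d (X : 'I_d -> H -> H) : R :=
  \big[Num.max/0]_(i < d) opnorm (X i).

Definition orthogonal_projection (P : H -> H) (E : set H) : Prop :=
  forall y, E (P y) /\ forall h, E h -> hdot (y - P y) h = 0.

(* H is nonzero, so that C*(u) is a nonzero algebra. *)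
Definition unitary_tuple d (u : 'I_d -> H -> H) : Prop :=
  [/\ separable H, exists x : H, x != 0 & forall i, unitary_op (u i)].

End Operators.

Definition star_isomorphism (R : realType) (H K : hilbertType R)
    (S : set (H -> H)) (T : set (K -> K)) (pi : (H -> H) -> K -> K) : Prop :=
  [/\ set_bij S T pi,
      (forall A B, S A -> S B -> pi (A + B) = pi A + pi B),
      (forall (a : R[i]) A, S A -> pi (a *: A) = a *: pi A),
      (forall A B, S A -> S B -> pi (A \o B) = pi A \o pi B) &
      (forall A B, S A -> S B -> is_adjoint A B -> is_adjoint (pi A) (pi B))].

Definition tuple_equiv (R : realType) (d : nat) (H K : hilbertType R)
    (u : 'I_d -> H -> H) (v : 'I_d -> K -> K) : Prop :=
  exists pi, star_isomorphism (cstar_gen u) (cstar_gen v) pi /\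
    forall i, pi (u i) = v i.

(* An element of U(d) is given by any of its representatives: the notions
   below only depend on the classes of their arguments. *)
Record utuple (R : realType) (d : nat) := UTuple {
  uspace : hilbertType R;
  uop :> 'I_d -> uspace -> uspace;
  uopP : unitary_tuple uop
}.

Section Distances.
Context {R : realType} {d : nat}.
Implicit Types (u v : utuple R d) (c : R).

(* u \prec c v.  The inclusion of the space of U in the space of V is an
   isometric linear map J, so U_i = P c V_i | H reads J U_i = P c V_i J. *)
Definition dilates u c v : Prop :=
  exists (U V : utuple R d) (J : uspace U -> uspace V)
         (P : uspace V -> uspace V),
    [/\ tuple_equiv U u /\ tuple_equiv V v,
        linear J,
        (forall x y, hdot (J x) (J y) = hdot x y),
        orthogonal_projection P (range J) &
        forall i x, J (U i x) = P (c%:C *: V i (J x))].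

Definition dil_const u v : \bar R :=
  ereal_inf [set c%:E | c in [set c : R | 0 < c /\ dilates u c v]].

Definition dHR u v : \bar R :=
  ereal_inf [set e | exists (H : hilbertType R) (u' v' : 'I_d -> H -> H),
    [/\ unitary_tuple u', unitary_tuple v',
        tuple_equiv u' u, tuple_equiv v' v &
        e = (tuple_norm (u' - v'))%:E]].

Definition dD u v : \bar R := lne (maxe (dil_const u v) (dil_const v u)).

End Distances.

(* Main.v *)
(* Two unitary tuples are equivalent iff all *-polynomials have the same norms
   in them.  If [J^* v J = u / c], the same relation can be realized with [u]
   replaced by any equivalent tuple [w]: by complete positivity of
   *-isomorphisms and Hahn-Banach, the sesquilinear data of [w] are a mean of
   those of [u], and averaging the data of [v] over the same mean gives a
   dilation of [w].  Alternating this between [u] and [v] and taking direct sums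
   gives representatives with isometries [J], [J'] in both directions.

   Composing [v_i] with a rotation by an angle of cosine [1/c] in suitable planes
   gives a unitary [z_i] at distance at most [2 sqrt(1 - c^-2)] from [v_i] with
   [z_i J = J u_i].  As [z] commutes with [J J^*], a Hilbert hotel argument shows
   that infinitely many copies of [z] are unitarily equivalent to infinitely many
   copies of [z] and of [u].  Hence [v] has a representative within
   [4 sqrt(1 - c^-2)] of infinitely many copies of [v] and of [u], and by symmetry
   so has [u].  The second claim follows from [1 - c^-2 <= 2 ln c]. *)

Require Import Defs.
From HB Require Import structures.
From mathcomp Require Import all_boot all_order all_algebra.
From mathcomp Require Import sesquilinear complex.
From mathcomp Require Import all_classical all_reals all_analysis.
From mathcomp Require Import ring lra.
Set Implicit Arguments.
Unset Strict Implicit.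
Unset Printing Implicit Defensive.
Import Order.TTheory GRing.Theory Num.Theory.
Import numFieldNormedType.Exports.
Local Open Scope classical_set_scope.
Local Open Scope ring_scope.
Local Open Scope complex_scope.

(** * Bounded operators on Hilbert spaces *)

(** The isomorphisms behind the equivalence of tuples come without continuity, so contractivity and
    complete positivity are derived from inversion: a coercive selfadjoint element has its inverse
    in the algebra by a Neumann series, hence positivity survives a star homomorphism, and Schur
    complements carry this to matrices. The mean lives on the unit ball of l^2(H) because one
    functional has to reproduce all pairings of a total sequence of the new space at once; complete
    positivity says that evaluation at such a sequence is dominated by the supremum over the ball.
    Separability supplies the sequence. Alternation is forced because adapting one dilation to a
    given representative replaces the other tuple; the chain of replacements, once summed, closes up
    under a shift of the index. Infinitely many copies of both tuples serve as a common reference,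
    near which each tuple gets its own representative. The two errors add up to 8 sqrt(1 - c^-2),
    within the constant 28, and to 8 sqrt(2 ln r) <= 16 sqrt(ln r), within 56. The hypothesis 0 < d
    ensures that the generated algebra contains the identity. *)

Section HilbertBasics.
Context {R : realType}.
Local Notation C := R[i].

Definition cabs (a : C) : R := complex.Re `|a|.

Lemma cabsE (a : C) : `|a| = (cabs a)%:C.
Proof. by []. Qed.

Lemma cabs_ge0 (a : C) : 0 <= cabs a.
Proof. by rewrite -ler0c -cabsE. Qed.

Lemma cabs_real (r : R) : cabs r%:C = `|r|.
Proof. by rewrite /cabs normc_def /= expr0n /= addr0 sqrtr_sqr. Qed.

Lemma cabsi : cabs ('i : C) = 1.
Proof. by rewrite /cabs normc_def /= expr0n /= add0r expr1n sqrtr1. Qed.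

Lemma cabsM (a b : C) : cabs (a * b) = cabs a * cabs b.
Proof. by apply: complexI; rewrite -cabsE normrM rmorphM. Qed.

Lemma cabsD (a b : C) : cabs (a + b) <= cabs a + cabs b.
Proof. by rewrite -lecR rmorphD /= -!cabsE ler_normD. Qed.

(** Norms take values in [R[i]], where the order is partial; the real part moves every estimate into
    the ordered field [R]. *)
Definition nrm {H : normedModType C} (x : H) : R := complex.Re `|x|.

Section Norm.
Context {H : normedModType C}.
Implicit Types x y z : H.

Lemma nrmE x : `|x| = (nrm x)%:C.
Proof.
rewrite /nrm; have := normr_ge0 x; case: (`|x|) => a b.
by rewrite lecE /= => /andP[/eqP -> _].
Qed.

Lemma nrm_ge0 x : 0 <= nrm x.
Proof. by rewrite -ler0c -nrmE. Qed.

Lemma nrm0 : nrm (0 : H) = 0.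
Proof. by rewrite /nrm normr0. Qed.

Lemma nrm0_eq0 x : nrm x = 0 -> x = 0.
Proof. by move=> e; apply/normr0_eq0; rewrite nrmE e. Qed.

Lemma nrm_gt0 x : (0 < nrm x) = (x != 0).
Proof. by rewrite -normr_gt0 nrmE ltcR. Qed.

Lemma nrmD x y : nrm (x + y) <= nrm x + nrm y.
Proof. by rewrite -lecR rmorphD /= -!nrmE ler_normD. Qed.

Lemma nrmZ (a : C) x : nrm (a *: x) = cabs a * nrm x.
Proof. by apply: complexI; rewrite -nrmE normrZ rmorphM /= -nrmE. Qed.

Lemma nrmZr (r : R) x : nrm (r%:C *: x) = `|r| * nrm x.
Proof. by rewrite nrmZ cabs_real. Qed.

Lemma nrmN x : nrm (- x) = nrm x.
Proof. by rewrite /nrm normrN. Qed.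

Lemma nrmB x y : nrm (x - y) = nrm (y - x).
Proof. by rewrite -nrmN opprB. Qed.

Lemma nrm_dist x y z : nrm (x - z) <= nrm (x - y) + nrm (y - z).
Proof. by apply: le_trans (nrmD _ _); rewrite addrA subrK. Qed.

Lemma nrm_ltB x y : nrm x <= nrm y + nrm (x - y).
Proof. by apply: le_trans (nrmD _ _); rewrite addrC subrK. Qed.

Lemma nrm_small x : (forall e : R, 0 < e -> nrm x <= e) -> x = 0.
Proof.
move=> h; apply: nrm0_eq0; apply/eqP; rewrite eq_le nrm_ge0 andbT.
by apply/ler_addgt0Pl => e /h; rewrite addr0.
Qed.

End Norm.

Section Dot.
Context {H : hilbertType R}.
Implicit Types x y z : H.

(** Real identities suffice: [hdotE] recovers the whole inner product from this real part, the
    imaginary part being read off at ['i *: y]. *)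
Definition rdot x y : R := complex.Re (hdot x y).

Lemma hdotZl (a : C) x y : hdot (a *: x) y = a * hdot x y.
Proof. by rewrite linearZl_LR. Qed.
Lemma hdotZr (a : C) x y : hdot x (a *: y) = a^*%C * hdot x y.
Proof. by rewrite linearZr_LR. Qed.
Lemma hdotDl x y z : hdot (x + y) z = hdot x z + hdot y z.
Proof. by rewrite linearDl. Qed.
Lemma hdotDr x y z : hdot z (x + y) = hdot z x + hdot z y.
Proof. by rewrite linearDr. Qed.
Lemma hdotC x y : hdot x y = (hdot y x)^*%C.
Proof. by rewrite hermC expr0 mul1r. Qed.

Lemma hdotxx x : hdot x x = (nrm x ^+ 2)%:C.
Proof. by rewrite -sqr_hnorm nrmE rmorphXn. Qed.

Lemma rdotxx x : rdot x x = nrm x ^+ 2.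
Proof. by rewrite /rdot hdotxx. Qed.

Lemma rdotDl x y z : rdot (x + y) z = rdot x z + rdot y z.
Proof. by rewrite /rdot hdotDl; case: (hdot x z) (hdot y z) => ? ? []. Qed.
Lemma rdotDr x y z : rdot z (x + y) = rdot z x + rdot z y.
Proof. by rewrite /rdot hdotDr; case: (hdot z x) (hdot z y) => ? ? []. Qed.
Lemma rdotC x y : rdot x y = rdot y x.
Proof. by rewrite /rdot hdotC; case: (hdot y x). Qed.
Lemma rdotZl (r : R) x y : rdot (r%:C *: x) y = r * rdot x y.
Proof.
by rewrite /rdot hdotZl; case: (hdot x y) => a b /=; rewrite mul0r subr0.
Qed.
Lemma rdotZr (r : R) x y : rdot x (r%:C *: y) = r * rdot x y.
Proof. by rewrite rdotC rdotZl rdotC. Qed.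
Lemma rdot0l x : rdot 0 x = 0.
Proof. by rewrite /rdot linear0l. Qed.
Lemma rdot0r x : rdot x 0 = 0.
Proof. by rewrite rdotC rdot0l. Qed.
Lemma rdotNl x y : rdot (- x) y = - rdot x y.
Proof. by apply/eqP; rewrite -addr_eq0 -rdotDl addNr rdot0l. Qed.
Lemma rdotNr x y : rdot x (- y) = - rdot x y.
Proof. by rewrite rdotC rdotNl rdotC. Qed.
Lemma rdotBl x y z : rdot (x - y) z = rdot x z - rdot y z.
Proof. by rewrite rdotDl rdotNl. Qed.
Lemma rdotBr x y z : rdot z (x - y) = rdot z x - rdot z y.
Proof. by rewrite rdotDr rdotNr. Qed.

Lemma rdot_suml (I : Type) (s : seq I) (F : I -> H) y :
  rdot (\sum_(i <- s) F i) y = \sum_(i <- s) rdot (F i) y.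
Proof.
elim: s => [|i s IH]; first by rewrite !big_nil rdot0l.
by rewrite !big_cons rdotDl IH.
Qed.

Lemma rdot_il x y : rdot ('i *: x) y = - rdot x ('i *: y).
Proof.
rewrite /rdot hdotZl hdotZr; case: (hdot x y) => a b /=.
by rewrite !(mul0r, mul1r, sub0r, mulN1r) !opprK.
Qed.

Lemma rdot_ir x y : rdot x ('i *: y) = - rdot ('i *: x) y.
Proof. by rewrite rdot_il opprK. Qed.

Lemma hdotE x y : hdot x y = rdot x y +i* rdot x ('i *: y).
Proof.
rewrite /rdot hdotZr; case: (hdot x y) => a b /=.
by rewrite !(mul0r, mulN1r, sub0r, opprK).
Qed.

Lemma nrm_sqD x y : nrm (x + y) ^+ 2 = nrm x ^+ 2 + 2 * rdot x y + nrm y ^+ 2.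
Proof. by rewrite -!rdotxx rdotDl !rdotDr (rdotC y x); ring. Qed.

Lemma nrm_sqB x y : nrm (x - y) ^+ 2 = nrm x ^+ 2 - 2 * rdot x y + nrm y ^+ 2.
Proof. by rewrite nrm_sqD rdotNr nrmN; ring. Qed.

Lemma nrm_sqrtP x (r : R) : 0 <= r -> (nrm x <= r) = (nrm x ^+ 2 <= r ^+ 2).
Proof. by move=> r0; rewrite ler_pXn2r// nnegrE// nrm_ge0. Qed.

(** Expand the squared norm of [|y| x - |x| y]: it equals [2 |x| |y| (|x| |y| - rdot x y)]. *)
Lemma rdot_le x y : rdot x y <= nrm x * nrm y.
Proof.
have [->|y0] := eqVneq y 0; first by rewrite rdot0r nrm0 mulr0.
have ny : 0 < nrm y by rewrite nrm_gt0.
have := sqr_ge0 (nrm ((nrm y)%:C *: x - (nrm x)%:C *: y)).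
rewrite nrm_sqB !nrmZr !ger0_norm ?nrm_ge0// rdotZl rdotZr.
have nx := nrm_ge0 x.
have -> : (nrm y * nrm x) ^+ 2 - 2 * (nrm y * (nrm x * rdot x y)) +
  (nrm x * nrm y) ^+ 2 = 2 * nrm y * nrm x * (nrm x * nrm y - rdot x y) by ring.
have [x0|x0] := eqVneq x 0; first by rewrite x0 rdot0l nrm0 mul0r.
by rewrite pmulr_rge0 ?subr_ge0// !mulr_gt0// nrm_gt0.
Qed.

Lemma rdot_abs x y : `|rdot x y| <= nrm x * nrm y.
Proof. by rewrite ler_norml rdot_le andbT lerNl -rdotNl -(nrmN x) rdot_le. Qed.

Lemma rdot_eq0 x : (forall y, rdot x y = 0) -> x = 0.
Proof.
by move=> /(_ x); rewrite rdotxx => /eqP; rewrite sqrf_eq0 => /eqP/nrm0_eq0.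
Qed.

Lemma rdot_inj x y : (forall z, rdot x z = rdot y z) -> x = y.
Proof.
by move=> h; apply/eqP; rewrite -subr_eq0; apply/eqP/rdot_eq0 => z;
  rewrite rdotBl h subrr.
Qed.

End Dot.
End HilbertBasics.

(** * Convergence of sequences in norm *)

Section Sequences.
Context {R : realType}.
Local Notation C := R[i].

Definition tends {H : normedModType C} (s : nat -> H) (l : H) : Prop :=
  forall e : R, 0 < e -> exists N, forall n, (N <= n)%N -> nrm (s n - l) <= e.

Definition cauchys {H : normedModType C} (s : nat -> H) : Prop :=
  forall e : R, 0 < e ->
    exists N, forall m n, (N <= m)%N -> (N <= n)%N -> nrm (s m - s n) <= e.

Lemma cauchys_tends (H : completeNormedModType C) (s : nat -> H) :
  cauchys s -> exists l, tends s l.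
Proof.
move=> sC.
have sE : cauchy (s @ \oo).
  apply: cauchy_exP => -[e e'] /=; rewrite ltcE /= => /andP[/eqP -> e0].
  have [N hN] := sC _ (divr_gt0 e0 (ltr0Sn _ 1)).
  exists (s N), N => // n /= Nn; rewrite -ball_normE /= nrmE ltcR.
  apply: le_lt_trans (hN _ _ (leqnn N) Nn) _.
  by rewrite gtr_pMr// invf_lt1// ltr1n.
have [l hl] := (cvg_ex _).1 (cauchy_cvg _ sE).
exists l => e e0.
have e0' : (0 : C) < e%:C by rewrite ltcR.
have [N _ hN] := (cvgrPdist_lt s l).1 hl _ e0'.
exists N => n Nn; have := hN _ Nn => /=.
by rewrite nrmE ltcR nrmB => /ltW.
Qed.

Lemma tends_unique (H : normedModType C) (s : nat -> H) (l l' : H) :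
  tends s l -> tends s l' -> l = l'.
Proof.
move=> hl hl'; apply/eqP; rewrite -subr_eq0; apply/eqP/nrm_small => e e0.
have e20 : 0 < e / 2 by rewrite divr_gt0.
have [N hN] := hl _ e20; have [N' hN'] := hl' _ e20.
apply: le_trans (nrm_dist _ (s (maxn N N')) _) _.
rewrite (splitr e) lerD//; first by rewrite nrmB hN// leq_maxl.
by rewrite hN'// leq_maxr.
Qed.

Lemma invS_small (e : R) : 0 < e -> exists N, forall n, (N <= n)%N -> n.+1%:R^-1 <= e.
Proof.
move=> e0; exists (Num.truncn e^-1) => n Nn.
rewrite -(invrK e) lef_pV2 ?posrE ?invr_gt0//.
by apply: (le_trans (ltW (truncnS_gt _))); rewrite ler_nat.
Qed.

End Sequences.

(** * Isometries, operator norm, Riesz representation, adjoints *)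

Section Operators.
Context {R : realType}.
Local Notation C := R[i].

Definition bop {H K : normedModType C} (A : H -> K) : Prop :=
  linear A /\ exists M : R, forall x, nrm (A x) <= M * nrm x.

Section Linear.
Context {H K : lmodType C} (A : H -> K).
Hypothesis lA : linear A.

Lemma linP0 : A 0 = 0.
Proof.
by have := lA (-1) 0 0; rewrite scaler0 addr0 scaleN1r addNr.
Qed.
Lemma linPD x y : A (x + y) = A x + A y.
Proof. by have := lA 1 x y; rewrite !scale1r. Qed.
Lemma linPZ a x : A (a *: x) = a *: A x.
Proof. by have := lA a x 0; rewrite !addr0 linP0 addr0. Qed.
Lemma linPN x : A (- x) = - A x.
Proof. by rewrite -scaleN1r linPZ scaleN1r. Qed.
Lemma linPB x y : A (x - y) = A x - A y.
Proof. by rewrite linPD linPN. Qed.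
Lemma linP_sum (I : Type) (s : seq I) (F : I -> H) :
  A (\sum_(i <- s) F i) = \sum_(i <- s) A (F i).
Proof.
elim: s => [|i s IH]; first by rewrite !big_nil linP0.
by rewrite !big_cons linPD IH.
Qed.

End Linear.

Section Bounded.
Context {H K : normedModType C}.
Implicit Types A B : H -> K.

Lemma bop_bound A : bop A ->
  exists2 M : R, 0 < M & forall x, nrm (A x) <= M * nrm x.
Proof.
move=> [_ [M hM]]; exists (`|M| + 1); first by rewrite ltr_wpDl.
move=> x; apply: le_trans (hM x) _; rewrite ler_wpM2r ?nrm_ge0//.
by rewrite (le_trans (ler_norm M))// lerDl.
Qed.

Lemma bop_tends A s l : bop A -> tends s l -> tends (A \o s) (A l).
Proof.
move=> bA sl e e0; have [M M0 hM] := bop_bound bA.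
have [N hN] := sl _ (divr_gt0 e0 M0); exists N => n Nn /=.
rewrite -(linPB bA.1) (le_trans (hM _))//.
by rewrite mulrC -ler_pdivlMr// hN.
Qed.

Lemma bop0 : bop (0 : H -> K).
Proof.
split=> [a x y|]; first by rewrite scaler0 addr0.
by exists 0 => x; rewrite nrm0 mul0r.
Qed.

Lemma bopD A B : bop A -> bop B -> bop (A + B).
Proof.
move=> [lA [M hM]] [lB [N hN]]; split.
  by move=> a x y /=; rewrite !fctE lA lB scalerDr addrACA.
exists (M + N) => x; rewrite fctE mulrDl.
by apply: le_trans (nrmD _ _) _; rewrite lerD.
Qed.

Lemma bopZ (c : C) A : bop A -> bop (c *: A).
Proof.
move=> [lA [M hM]]; split.
  by move=> a x y /=; rewrite !fctE lA scalerDr !scalerA mulrC.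
by exists (cabs c * M) => x; rewrite fctE nrmZ -mulrA ler_wpM2l ?cabs_ge0.
Qed.

Lemma bopN A : bop A -> bop (- A).
Proof.
move=> bA; suff -> : - A = (-1 : C) *: A by exact: bopZ.
by apply/funext => x; rewrite !fctE scaleN1r.
Qed.

Lemma bopB A B : bop A -> bop B -> bop (A - B).
Proof. by move=> bA bB; apply/bopD/bopN. Qed.

End Bounded.

Lemma bop_id (H : normedModType C) : bop (@id H).
Proof. by split=> //; exists 1 => x; rewrite mul1r. Qed.

Lemma bop_comp (H K L : normedModType C) (A : K -> L) (B : H -> K) :
  bop A -> bop B -> bop (A \o B).
Proof.
move=> bA bB; have [M M0 hM] := bop_bound bA; have [N N0 hN] := bop_bound bB.
split; first by move=> a x y /=; rewrite bB.1 bA.1.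
exists (M * N) => x /=; apply: le_trans (hM _) _.
by rewrite -mulrA ler_wpM2l// ltW.
Qed.

Definition isom {H K : hilbertType R} (A : H -> K) : Prop :=
  linear A /\ forall x, nrm (A x) = nrm x.

Lemma isom_bop (H K : hilbertType R) (A : H -> K) : isom A -> bop A.
Proof. by move=> [lA iA]; split => //; exists 1 => x; rewrite iA mul1r. Qed.

Lemma isom_rdot (H K : hilbertType R) (A : H -> K) x y :
  isom A -> rdot (A x) (A y) = rdot x y.
Proof.
move=> [lA iA]; apply: (@mulfI _ 2) => //.
have := nrm_sqD (A x) (A y); rewrite -(linPD lA) !iA nrm_sqD => h.
lra.
Qed.

Lemma isom_comp (H K L : hilbertType R) (A : K -> L) (B : H -> K) :
  isom A -> isom B -> isom (A \o B).
Proof.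
move=> [lA iA] [lB iB]; split; last by move=> x /=; rewrite iA.
by move=> a x y /=; rewrite lB lA.
Qed.

Lemma bounded_opE (H : hilbertType R) (A : H -> H) : bounded_op A <-> bop A.
Proof.
split=> [[lA cA]|[lA [M hM]]]; split=> //.
- pose f := HB.pack A (GRing.isLinear.Build _ _ _ _ A lA) : {linear H -> H}.
  have /linear_boundedP bf := @continuous_linear_bounded _ _ _ 0 f (cA 0).
  have [r r0 hr] := pinfty_ex_gt (real0 _) bf.
  exists (complex.Re r) => x; have := hr x.
  move: r0; rewrite ltcE /= => /andP[/eqP r0 _].
  have -> : r = (complex.Re r)%:C by move: r0; case: r {hr} => a b /= ->.
  by rewrite [`|_|]nrmE [`|x|]nrmE -rmorphM lecR.
- pose f := HB.pack A (GRing.isLinear.Build _ _ _ _ A lA) : {linear H -> H}.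
  apply: (@bounded_linear_continuous _ _ _ f); apply/linear_boundedP.
  exists (M%:C); split; first by apply/complex_realP; exists M.
  move=> r Mr x; rewrite [`|_|]nrmE [`|x|]nrmE.
  have -> : r = (complex.Re r)%:C.
    by move: Mr; rewrite ltcE /= => /andP[/eqP + _]; case: r => a b /= ->.
  rewrite -rmorphM lecR (le_trans (hM x))// ler_wpM2r ?nrm_ge0//.
  by move: Mr; rewrite ltcE /= => /andP[_ /ltW].
Qed.

Section Opnorm.
Context {H : hilbertType R}.
Implicit Types A B : H -> H.

Let S A := [set complex.Re `|A x| | x in [set x : H | `|x| <= 1]].

Let S0 A : S A !=set0.
Proof. by exists (complex.Re `|A 0|), 0 => //=; rewrite normr0. Qed.

Let S_ub A M : (forall x, nrm (A x) <= M * nrm x) -> 0 <= M -> ubound (S A) M.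
Proof.
move=> hM M0 _ [x /= x1 <-]; apply: le_trans (hM x) _.
by move: x1; rewrite nrmE lecR => /(ler_wpM2l M0); rewrite mulr1.
Qed.

Lemma opnorm_le A M :
  0 <= M -> (forall x, nrm (A x) <= M * nrm x) -> opnorm A <= M.
Proof. by move=> M0 hM; apply: ge_sup (S0 A) _; apply: S_ub. Qed.

Lemma opnorm_bound A x : bop A -> nrm (A x) <= opnorm A * nrm x.
Proof.
move=> bA; have [M M0 hM] := bop_bound bA.
have [->|x0] := eqVneq x 0; first by rewrite (linP0 bA.1) nrm0 mulr0.
have nx : 0 < nrm x by rewrite nrm_gt0.
rewrite -ler_pdivrMr// mulrC -[(nrm x)^-1]ger0_norm ?invr_ge0 ?nrm_ge0//.
rewrite -nrmZr -(linPZ bA.1); apply: sup_ubound.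
  by exists M; apply: S_ub => //; exact: ltW.
exists (((nrm x)^-1)%:C *: x) => //=.
by rewrite nrmE nrmZr ger0_norm ?invr_ge0 ?nrm_ge0// mulVf ?gt_eqF.
Qed.

End Opnorm.

(** Only real parts are compared; for linear [A] this already gives the complex relation
    ([adj2_is_adjoint]), since multiplying [x] by ['i] recovers the imaginary part. *)
Definition adj2 {H K : hilbertType R} (A : H -> K) (B : K -> H) : Prop :=
  forall x y, rdot (A x) y = rdot x (B y).

Lemma adj2_sym (H K : hilbertType R) (A : H -> K) B : adj2 A B -> adj2 B A.
Proof. by move=> h x y; rewrite rdotC -h rdotC. Qed.

Lemma adj2_unique (H K : hilbertType R) (A : H -> K) B B' :
  adj2 A B -> adj2 A B' -> B = B'.
Proof.
by move=> h h'; apply/funext => y; apply: rdot_inj => z; rewrite rdotC -h h' rdotC.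
Qed.

Lemma adj2_is_adjoint (H : hilbertType R) (A B : H -> H) :
  linear A -> adj2 A B <-> is_adjoint A B.
Proof.
move=> lA; split=> h x y; last by rewrite /rdot h.
by rewrite !hdotE h rdot_ir -(linPZ lA) h -rdot_ir.
Qed.

Lemma adj2_linear (H K : hilbertType R) (A : H -> K) B :
  linear A -> adj2 A B -> linear B.
Proof.
move=> lA h a x y; apply: rdot_inj => z; rewrite rdotC -h.
rewrite rdotDr rdotDl [rdot (B y) z]rdotC -h [rdot _ z]rdotC.
have hh u v : hdot (A u) v = hdot u (B v).
  by rewrite !hdotE h rdot_ir -(linPZ lA) h -rdot_ir.
by rewrite /rdot !hdotZr hh.
Qed.

Lemma adj2_bop (H K : hilbertType R) (A : H -> K) B :
  bop A -> adj2 A B -> bop B.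
Proof.
move=> bA h; split; first exact: adj2_linear bA.1 h.
have [M M0 hM] := bop_bound bA; exists M => y.
have [->|y0] := eqVneq (B y) 0.
  by rewrite nrm0 mulr_ge0 ?nrm_ge0// ltW.
have nB : 0 < nrm (B y) by rewrite nrm_gt0.
rewrite -(ler_pM2r nB) -expr2 -rdotxx -h.
apply: le_trans (rdot_le _ _) _.
by rewrite mulrAC ler_wpM2r ?nrm_ge0.
Qed.

Lemma adj2_le (H K : hilbertType R) (A : H -> K) B (M : R) :
  0 <= M -> (forall x, nrm (A x) <= M * nrm x) -> adj2 A B ->
  forall y, nrm (B y) <= M * nrm y.
Proof.
move=> M0 hM h y.
have [->|y0] := eqVneq (B y) 0; first by rewrite nrm0 mulr_ge0 ?nrm_ge0.
have nB : 0 < nrm (B y) by rewrite nrm_gt0.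
rewrite -(ler_pM2r nB) -expr2 -rdotxx -h.
apply: le_trans (rdot_le _ _) _.
by rewrite mulrAC ler_wpM2r ?nrm_ge0.
Qed.

Lemma riesz (H : hilbertType R) (g : H -> R) (M : R) :
  (forall x y, g (x + y) = g x + g y) ->
  (forall (r : R) x, g (r%:C *: x) = r * g x) ->
  (forall x, `|g x| <= M * nrm x) -> exists z, forall x, g x = rdot x z.
Proof.
move=> gD gZ gM.
(* A representing vector minimizes the quadratic functional [Phi]. *)
pose Phi x := nrm x ^+ 2 - 2 * g x.
have Phi_lb x : - M ^+ 2 <= Phi x.
  have h1 : g x <= M * nrm x by apply: le_trans (gM x); exact: ler_norm.
  have := sqr_ge0 (nrm x - M); rewrite /Phi sqrrB => h2.
  lra.
pose m := inf (range Phi).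
have mP : has_inf (range Phi).
  by split; [exists (Phi 0), 0|exists (- M ^+ 2) => _ [x _ <-]].
have m_le x : m <= Phi x by apply: ge_inf; [exact: mP.2|exists x].
have gN x : g (- x) = - g x.
  by rewrite -scaleN1r -[-1](rmorphN1 (real_complex R)) gZ mulN1r.
have near e : 0 < e -> exists x, Phi x < m + e.
  by move=> e0; have [_ [x _ <-] h] := inf_adherent e0 mP; exists x.
(* Parallelogram law: the midpoint has value at least [m], so near-minimizers are close to each
   other. *)
have par x y : nrm (x - y) ^+ 2 <= 2 * (Phi x - m) + 2 * (Phi y - m).
  have := m_le ((2^-1)%:C *: (x + y)).
  rewrite /Phi nrmZr gZ gD exprMn nrm_sqD nrm_sqB real_normK ?num_real// => h.
  lra.
have /choice[s sP] n : exists x, Phi x < m + (n.+1%:R)^-1.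
  by apply: near; rewrite invr_gt0.
have sC : cauchys s.
  move=> e e0; have e40 : 0 < e ^+ 2 / 4 by rewrite divr_gt0// exprn_gt0.
  have [N hN] := invS_small e40; exists N => p q Np Nq.
  rewrite (nrm_sqrtP _ (ltW e0)) (le_trans (par _ _))//.
  have := hN _ Np; have := hN _ Nq; have := sP p; have := sP q.
  by move: (p.+1%:R^-1) (q.+1%:R^-1) => a b; lra.
have [z zP] := cauchys_tends sC.
have g_tends : forall e : R, 0 < e -> exists N, forall n, (N <= n)%N ->
    `|g (s n) - g z| <= e.
  move=> e e0; have M0 : 0 < `|M| + 1 by rewrite ltr_wpDl.
  have [N hN] := zP _ (divr_gt0 e0 M0); exists N => n Nn.
  rewrite -gN -gD; apply: le_trans (gM _) _.
  have := hN _ Nn; rewrite ler_pdivlMr// mulrC => h.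
  apply: le_trans h; rewrite ler_wpM2r ?nrm_ge0//.
  by rewrite (le_trans (ler_norm M))// lerDl.
have z_min : Phi z <= m.
  apply/ler_addgt0Pl => e e0.
  have e1 : 0 < e / 2 by rewrite divr_gt0.
  (* [d * (2 * nrm z + 1)] will bound the change of the squared norm, and [2 * d] the change of
     [2 * g]. *)
  pose K := 2 * nrm z + 1 + 2.
  have K0 : 0 < K by rewrite /K; have := nrm_ge0 z; lra.
  have d0 : 0 < Num.min 1 (e / 2 / K) by rewrite lt_min ltr01 divr_gt0.
  have [N1 h1] := zP _ d0; have [N2 h2] := g_tends _ d0.
  have [N3 h3] := invS_small e1.
  pose n := maxn N1 (maxn N2 N3).
  have {h1} := h1 n (leq_maxl _ _); rewrite nrmB.
  set d := Num.min _ _ in d0 h2 * => h1.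
  have {}h2 : `|g (s n) - g z| <= d by rewrite h2// /n maxnCA leq_maxl.
  have {}h3 := h3 n (leq_trans (leq_maxr _ _) (leq_maxr _ _)).
  have h4 := sP n.
  have hz : nrm z <= nrm (s n) + d by have := nrm_ltB z (s n); lra.
  have hs : nrm (s n) <= nrm z + d by have := nrm_ltB (s n) z; rewrite nrmB; lra.
  have d1 : d <= 1 by rewrite /d ge_min lexx.
  have dK : d * K <= e / 2 by rewrite -ler_pdivlMr// /d ge_min lexx orbT.
  move: h2; rewrite ler_norml => /andP[_ h2].
  have nz := nrm_ge0 z; have ns := nrm_ge0 (s n).
  have hz2 : nrm z ^+ 2 - nrm (s n) ^+ 2 <= d * (2 * nrm z + 1).
    rewrite subr_sqr.
    apply: (@le_trans _ _ (d * (nrm z + nrm (s n)))).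
      by apply: ler_wpM2r; lra.
    by apply: ler_wpM2l; lra.
  rewrite /K in dK; rewrite /Phi in h4 *.
  by move: (n.+1%:R^-1) h3 h4 => a h3 h4; lra.
exists z => h; apply/eqP; rewrite eq_sym -subr_eq0; apply/eqP.
(* First variation of [Phi] at its minimum [z] in the direction [h]; the linear coefficient has to
   vanish. *)
have var (t : R) : 0 <= t ^+ 2 * nrm h ^+ 2 + 2 * t * (rdot z h - g h).
  have := le_trans z_min (m_le (z + t%:C *: h)).
  rewrite /Phi nrm_sqD nrmZr exprMn real_normK ?num_real// rdotZr gD gZ => v.
  lra.
rewrite rdotC; set b := _ - g h in var *.
have [h0|h0] := eqVneq (nrm h ^+ 2) 0.
  have := var (- b); rewrite h0 mulr0 add0r => v.
  have : b ^+ 2 <= 0 by lra.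
  by rewrite le_eqVlt sqrf_eq0 ltNge sqr_ge0 orbF => /eqP.
have hp : 0 < nrm h ^+ 2 by rewrite lt_neqAle eq_sym h0 sqr_ge0.
have := var (- b / nrm h ^+ 2).
have -> : (- b / nrm h ^+ 2) ^+ 2 * nrm h ^+ 2 + 2 * (- b / nrm h ^+ 2) * b =
  - (b ^+ 2 / nrm h ^+ 2).
  by move: (nrm h ^+ 2) h0 => q q0; field.
rewrite oppr_ge0 pmulr_lle0 ?invr_gt0// => v.
by move: v; rewrite le_eqVlt sqrf_eq0 ltNge sqr_ge0 orbF => /eqP.
Qed.

Lemma adj2_exists (H K : hilbertType R) (A : H -> K) :
  bop A -> exists B, adj2 A B.
Proof.
move=> bA; have [M M0 hM] := bop_bound bA.
have /choice[B hB] y : exists z, forall x, rdot (A x) y = rdot x z.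
  apply: (@riesz _ (fun x => rdot (A x) y) (M * nrm y)).
  - by move=> x x'; rewrite (linPD bA.1) rdotDl.
  - by move=> r x; rewrite (linPZ bA.1) rdotZl.
  - move=> x; apply: le_trans (rdot_abs _ _) _.
    by rewrite mulrAC ler_wpM2r ?nrm_ge0.
by exists B => x y; exact: hB.
Qed.

Definition adj {H K : hilbertType R} (A : H -> K) : K -> H :=
  xget 0 [set B | adj2 A B].

Lemma adjP (H K : hilbertType R) (A : H -> K) : bop A -> adj2 A (adj A).
Proof. by move=> /adj2_exists[B hB]; rewrite /adj; case: xgetP => [? -> //|/(_ B)]. Qed.

Lemma bop_adj (H K : hilbertType R) (A : H -> K) : bop A -> bop (adj A).
Proof. by move=> bA; exact: adj2_bop bA (adjP bA). Qed.

Lemma adj_eq (H K : hilbertType R) (A : H -> K) B : bop A -> adj2 A B -> adj A = B.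
Proof. by move=> bA; apply: adj2_unique; exact: adjP. Qed.

End Operators.

(** * The Hilbert space of a positive semidefinite kernel *)

Section Kolmogorov.
Context {R : realType}.
Local Notation C := R[i].

Section Forms.
Context {X : Type}.
Implicit Types (s t : seq (C * X)) (f g : X -> C).

Definition scl (a : C) s := [seq (a * p.1, p.2) | p <- s].

(** With [f x] read as the inner product of [f] with a kernel vector at [x], this is the real inner
    product of [f] with the combination of kernel vectors coded by [t]. *)
Definition pf f t : R := complex.Re (\sum_(q <- t) (q.1^*%C * f q.2)).

Lemma pf_nil f : pf f [::] = 0.
Proof. by rewrite /pf big_nil. Qed.

Lemma pf_cat f s t : pf f (s ++ t) = pf f s + pf f t.
Proof. by rewrite /pf big_cat; case: (\sum_(_ <- s) _) (\sum_(_ <- t) _) => ? ? []. Qed.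

Lemma pf_cons f q t : pf f (q :: t) = complex.Re (q.1^*%C * f q.2) + pf f t.
Proof.
rewrite /pf big_cons; move: (_ * f _) (\sum_(_ <- t) _) => z w.
by case: z w => ? ? [].
Qed.

Lemma pfD f g t : pf (f + g) t = pf f t + pf g t.
Proof.
elim: t => [|q t IH]; first by rewrite !pf_nil addr0.
rewrite !pf_cons IH fctE mulrDr.
by move: (_ * f _) (_ * g _) => [? ?] [? ?] /=; ring.
Qed.

Lemma pfZ (a : R) f t : pf (a%:C *: f) t = a * pf f t.
Proof.
elim: t => [|q t IH]; first by rewrite !pf_nil mulr0.
rewrite !pf_cons IH fctE -[_ *: _]/(_ * _) mulrCA.
by move: (_ * f _) => [? ?] /=; ring.
Qed.

Lemma pfN f t : pf (- f) t = - pf f t.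
Proof. by rewrite -scaleN1r -[-1](rmorphN1 (real_complex R)) pfZ mulN1r. Qed.

Lemma pf_scl f (a : R) t : pf f (scl a%:C t) = a * pf f t.
Proof.
elim: t => [|q t IH]; first by rewrite /= !pf_nil mulr0.
rewrite /= !pf_cons /= IH mulrDr; congr (_ + _).
by case: q => [[? ?] x] /=; case: (f x) => ? ? /=; ring.
Qed.

Lemma pf_scl_adj f (a : C) t : pf (a *: f) t = pf f (scl a^*%C t).
Proof.
elim: t => [|q t IH]; first by rewrite /= !pf_nil.
rewrite /= !pf_cons /= IH fctE -[_ *: _]/(_ * _); congr (_ + _).
rewrite rmorphM /= conjcK; congr (complex.Re _); ring.
Qed.

Lemma scl_scl (a b : C) s : scl a (scl b s) = scl (a * b) s.
Proof. by rewrite /scl -map_comp; apply: eq_map => p /=; rewrite mulrA. Qed.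

Lemma scl1 s : scl 1 s = s.
Proof. by rewrite /scl -[RHS]map_id; apply: eq_map => -[a x] /=; rewrite mul1r. Qed.

Lemma pf_eq0 f : (forall t, pf f t = 0) -> f = 0.
Proof.
move=> h; apply/funext => x.
have := h [:: (1, x)]; have := h [:: ('i, x)].
rewrite !pf_cons !pf_nil !addr0 /=; case: (f x) => a b /=.
rewrite oppr0 !(mul0r, mul1r, subr0, sub0r, mulN1r, opprK) => -> ->.
by [].
Qed.

End Forms.

(* [0 <= z] for [z : R[i]] also says that [z] is real. *)
Record psdKernel (X : Type) := PsdKernel {
  kern :> X -> X -> C;
  kern_psd : forall s : seq (C * X),
    0 <= \sum_(p <- s) \sum_(q <- s) p.1 * q.1^*%C * kern p.2 q.2
}.

Section RKHS.
Context {X : Type} (K : psdKernel X).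
Implicit Types (s t : seq (C * X)) (f g : X -> C).

Definition ev s : X -> C := fun x => \sum_(p <- s) p.1 * K p.2 x.

Lemma ev_cat s t : ev (s ++ t) = ev s + ev t.
Proof. by apply/funext => x; rewrite /ev big_cat. Qed.

Lemma ev_scl (a : C) s : ev (scl a s) = a *: ev s.
Proof.
apply/funext => x; rewrite /ev fctE big_map -[_ *: _]/(_ * _) mulr_sumr.
by apply: eq_bigr => p _; rewrite mulrA.
Qed.

Lemma ev_nil : ev [::] = 0.
Proof. by apply/funext => x; rewrite /ev big_nil. Qed.

Definition rB s t := pf (ev s) t.

Let B s t : C := \sum_(p <- s) \sum_(q <- t) p.1 * q.1^*%C * K p.2 q.2.

Let rBE s t : rB s t = complex.Re (B s t).
Proof.
rewrite /rB /pf /B exchange_big /=; congr (complex.Re _).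
apply: eq_bigr => q _; rewrite mulr_sumr; apply: eq_bigr => p _; ring.
Qed.

Lemma rB_ge0 s : 0 <= rB s s.
Proof. by rewrite rBE; have := kern_psd K s; rewrite lecE /= => /andP[]. Qed.

Let B_catl s s' t : B (s ++ s') t = B s t + B s' t.
Proof. by rewrite /B big_cat. Qed.

Let B_catr s t t' : B s (t ++ t') = B s t + B s t'.
Proof. by rewrite /B -big_split /=; apply: eq_bigr => p _; rewrite big_cat. Qed.

Let B_sclr (a : C) s t : B s (scl a t) = a^*%C * B s t.
Proof.
rewrite /B mulr_sumr; apply: eq_bigr => p _; rewrite big_map mulr_sumr.
by apply: eq_bigr => q _; rewrite /= rmorphM; ring.
Qed.

Let B_scll (a : C) s t : B (scl a s) t = a * B s t.
Proof.
rewrite /B mulr_sumr big_map; apply: eq_bigr => p _; rewrite mulr_sumr.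
by apply: eq_bigr => q _ /=; ring.
Qed.

Lemma rBC s t : rB s t = rB t s.
Proof.
(* polarization: [B s s] is real for every [s] *)
have im u : complex.Im (B u u) = 0.
  by have := kern_psd K u; rewrite lecE /= => /andP[/eqP].
have := im (s ++ scl 'i t); rewrite !(B_catl, B_catr, B_scll, B_sclr) !rBE.
have := im s; have := im t.
case: (B s s) (B s t) (B t s) (B t t) => [? ?] [? ?] [? ?] [? ?] /= -> ->.
move=> h; lra.
Qed.

Lemma rB_catl s s' t : rB (s ++ s') t = rB s t + rB s' t.
Proof. by rewrite /rB ev_cat pfD. Qed.

Lemma rB_scll (a : R) s t : rB (scl a%:C s) t = a * rB s t.
Proof. by rewrite /rB ev_scl pfZ. Qed.

Lemma rB_catr s t t' : rB s (t ++ t') = rB s t + rB s t'.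
Proof. by rewrite /rB pf_cat. Qed.

Lemma rB_sclr (a : R) s t : rB s (scl a%:C t) = a * rB s t.
Proof. by rewrite /rB pf_scl. Qed.

Lemma psd_cs (a b c : R) :
  (forall x y : R, 0 <= x ^+ 2 * a + 2 * x * y * b + y ^+ 2 * c) ->
  b ^+ 2 <= a * c.
Proof.
move=> h.
have a0 : 0 <= a by have := h 1 0; lra.
have c0 : 0 <= c by have := h 0 1; lra.
have [c_eq0|cn0] := eqVneq c 0.
  (* With [c = 0] this choice makes the form equal to [- b ^+ 2]. *)
  have := h (- b) ((a + 1) / 2); rewrite c_eq0 !mulr0 addr0.
  have -> : (- b) ^+ 2 * a + 2 * - b * ((a + 1) / 2) * b = - b ^+ 2 by field.
  by rewrite oppr_ge0.
have := h c (- b); have -> : c ^+ 2 * a + 2 * c * - b * b + (- b) ^+ 2 * c =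
  c * (a * c - b ^+ 2) by ring.
by rewrite pmulr_rge0 ?subr_ge0// lt_neqAle eq_sym cn0.
Qed.

Definition nn s := Num.sqrt (rB s s).

Lemma nn_ge0 s : 0 <= nn s. Proof. exact: sqrtr_ge0. Qed.

Lemma rB_cs s t : rB s t <= nn s * nn t.
Proof.
have : rB s t ^+ 2 <= rB s s * rB t t.
  apply: psd_cs => x y.
  have := rB_ge0 (scl x%:C s ++ scl y%:C t).
  rewrite !(rB_catl, rB_catr, rB_scll, rB_sclr) (rBC t s); lra.
rewrite /nn -sqrtrM ?rB_ge0// => /ler_wsqrtr; rewrite sqrtr_sqr.
by apply: le_trans; exact: ler_norm.
Qed.

(** The norm of [f] as a functional on combinations is at most [M]. Measuring by duality turns
    combinations of seminorm zero into the zero function, so functions take the place of classes. *)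
Definition nle f (M : R) := 0 <= M /\ forall t, pf f t <= M * nn t.

Lemma nn_scl (a : R) t : nn (scl a%:C t) = `|a| * nn t.
Proof.
by rewrite /nn rB_scll rB_sclr mulrA -expr2 sqrtrM ?sqr_ge0// sqrtr_sqr.
Qed.

Lemma nn_scli t : nn (scl 'i t) = nn t.
Proof.
have ii : ('i^*%C * 'i = 1 :> C)%R.
  by apply/eqP; rewrite eq_complex /=; apply/andP; split; apply/eqP; ring.
by rewrite /nn /rB ev_scl pf_scl_adj scl_scl ii scl1.
Qed.

Lemma nleD f g M N : nle f M -> nle g N -> nle (f + g) (M + N).
Proof.
by move=> [M0 hM] [N0 hN]; split=> [|t]; [exact: addr_ge0|rewrite pfD mulrDl lerD].
Qed.

Lemma nleZ (a : R) f M : nle f M -> nle (a%:C *: f) (`|a| * M).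
Proof.
move=> [M0 hM]; split=> [|t]; first exact: mulr_ge0.
by rewrite pfZ -pf_scl; apply: le_trans (hM _) _; rewrite nn_scl; lra.
Qed.

Lemma nleN f M : nle f M -> nle (- f) M.
Proof.
move=> /(nleZ (-1)); rewrite normrN1 mul1r rmorphN1 scaleN1r; exact.
Qed.

Lemma nleB f g M N : nle f M -> nle g N -> nle (f - g) (M + N).
Proof. by move=> hf hg; apply: nleD => //; exact: nleN. Qed.

Lemma nle_i f M : nle f M -> nle ('i *: f) M.
Proof.
move=> [M0 hM]; split=> // t; rewrite pf_scl_adj; apply: le_trans (hM _) _.
have -> : 'i^*%C = (-1)%:C * 'i :> C.
  by apply/eqP; rewrite eq_complex /=; apply/andP; split; apply/eqP; ring.
by rewrite -scl_scl nn_scl normrN1 mul1r nn_scli.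
Qed.

Lemma nle_ev s M : nle (ev s) M -> nn s <= M.
Proof.
move=> [M0 /(_ s)]; have := nn_ge0 s; rewrite le_eqVlt => /predU1P[<-//|n0].
by rewrite -[X in X <= _]sqr_sqrtr ?rB_ge0// -/(nn s) expr2 ler_pM2r.
Qed.

Lemma nle_evn s : nle (ev s) (nn s).
Proof. by split=> [|t]; [exact: nn_ge0|exact: rB_cs]. Qed.

Lemma nle_abs f M t : nle f M -> `|pf f t| <= M * nn t.
Proof.
move=> hf; rewrite ler_norml hf.2 andbT lerNl -pfN; exact: (nleN hf).2.
Qed.

Lemma nle_le f M N : nle f M -> M <= N -> nle f N.
Proof.
move=> [M0 hM] MN; split=> [|t]; first exact: le_trans MN.
by apply: le_trans (hM t) _; rewrite ler_wpM2r ?nn_ge0.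
Qed.

(** Closure of the kernel functions [ev s] inside the space of all functions: the completion
    consists of genuine functions on [X]. *)
Definition rkhs_mem f := forall e : R, 0 < e -> exists s, nle (f - ev s) e.

Lemma rkhs_mem_bound f : rkhs_mem f -> exists M, nle f M.
Proof.
move=> /(_ 1 ltr01)[s h]; exists (1 + nn s).
by rewrite -[f](subrK (ev s)); apply: nleD => //; exact: nle_evn.
Qed.

Lemma rkhs_memD f g : rkhs_mem f -> rkhs_mem g -> rkhs_mem (f + g).
Proof.
move=> hf hg e e0; have e2 : 0 < e / 2 by rewrite divr_gt0.
have [s hs] := hf _ e2; have [t ht] := hg _ e2; exists (s ++ t).
by rewrite ev_cat opprD addrACA (splitr e); exact: nleD.
Qed.

Lemma rkhs_memZr (a : R) f : rkhs_mem f -> rkhs_mem (a%:C *: f).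
Proof.
move=> hf e e0; have a0 : 0 < `|a| + 1 by rewrite ltr_wpDl.
have [s hs] := hf _ (divr_gt0 e0 a0); exists (scl a%:C s).
rewrite ev_scl -scalerBr; apply: nle_le (nleZ _ hs) _.
by rewrite mulrCA ger_pMr// ler_pdivrMr// mul1r lerDl.
Qed.

Lemma rkhs_mem_i f : rkhs_mem f -> rkhs_mem ('i *: f).
Proof.
move=> hf e e0; have [s hs] := hf _ e0; exists (scl 'i s).
by rewrite ev_scl -scalerBr; exact: nle_i.
Qed.

Lemma complex_scale (V : lmodType C) (a : C) (f : V) :
  a *: f = (complex.Re a)%:C *: f + (complex.Im a)%:C *: ('i *: f).
Proof. by rewrite scalerA -scalerDl mulrC -complexE. Qed.

Lemma rkhs_memZ (a : C) f : rkhs_mem f -> rkhs_mem (a *: f).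
Proof.
move=> hf; rewrite complex_scale; apply: rkhs_memD; apply: rkhs_memZr => //.
exact: rkhs_mem_i.
Qed.

Lemma rkhs_mem_ev s : rkhs_mem (ev s).
Proof.
move=> e e0; exists s; split=> [|t]; first exact: ltW.
by rewrite pfD pfN subrr mulr_ge0 ?nn_ge0// ltW.
Qed.

Lemma rkhs_mem0 : rkhs_mem 0.
Proof. by rewrite -ev_nil; exact: rkhs_mem_ev. Qed.

Definition rkhs_pred : {pred X -> C} := fun f => `[< rkhs_mem f >].

Lemma rkhs_submod : submod_closed rkhs_pred.
Proof.
split; first by apply/asboolP; exact: rkhs_mem0.
move=> a f g /asboolP hf /asboolP hg; apply/asboolP.
by apply: rkhs_memD => //; exact: rkhs_memZ.
Qed.

HB.instance Definition _ := GRing.isSubmodClosed.Build C (X -> C) rkhs_pred rkhs_submod.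

Record rkhs := Rkhs { rfun : X -> C; rkhsP : rfun \in rkhs_pred }.
HB.instance Definition _ := [isSub for rfun].
HB.instance Definition _ := [Choice of rkhs by <:].
HB.instance Definition _ := [SubChoice_isSubZmodule of rkhs by <:].

Lemma rkhs_scaleP (a : C) (f : rkhs) : (fun x => a * rfun f x) \in rkhs_pred.
Proof.
by apply/asboolP; apply: (@rkhs_memZ a (rfun f)); apply/asboolP; exact: rkhsP.
Qed.

Definition rkhs_scale (a : C) (f : rkhs) : rkhs := Rkhs (rkhs_scaleP a f).

Lemma rfunD (f g : rkhs) : rfun (f + g) = rfun f + rfun g.
Proof. exact: (raddfD (\val : rkhs -> (X -> C))). Qed.
Lemma rfunB (f g : rkhs) : rfun (f - g) = rfun f - rfun g.
Proof. exact: (raddfB (\val : rkhs -> (X -> C))). Qed.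

Lemma rkhs_scaleA a b (f : rkhs) : rkhs_scale a (rkhs_scale b f) = rkhs_scale (a * b) f.
Proof. by apply: val_inj; apply/funext => x /=; rewrite mulrA. Qed.
Lemma rkhs_scale1 : left_id 1 rkhs_scale.
Proof. by move=> f; apply: val_inj; apply/funext => x /=; rewrite mul1r. Qed.
Lemma rkhs_scaleDr : right_distributive rkhs_scale +%R.
Proof.
move=> a f g; apply: val_inj; apply/funext => x.
rewrite -[LHS]/(a * rfun (f + g) x).
by rewrite -[RHS]/(rfun (rkhs_scale a f + rkhs_scale a g) x) !rfunD mulrDr.
Qed.
Lemma rkhs_scaleDl (f : rkhs) : {morph rkhs_scale^~ f : a b / a + b}.
Proof.
move=> a b; apply: val_inj; apply/funext => x.
rewrite -[LHS]/((a + b) * rfun f x).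
by rewrite -[RHS]/(rfun (rkhs_scale a f + rkhs_scale b f) x) !rfunD mulrDl.
Qed.

HB.instance Definition _ := GRing.Zmodule_isLmodule.Build C rkhs
  rkhs_scaleA rkhs_scale1 rkhs_scaleDr rkhs_scaleDl.

Lemma rfunZ (a : C) (f : rkhs) : rfun (a *: f) = a *: rfun f.
Proof. by []. Qed.

End RKHS.
End Kolmogorov.

(** * Inner product on the completed kernel space *)

Section RKHSInner.
Context {R : realType}.
Local Notation C := R[i].

(** The restriction [e <= 1] lets terms quadratic in [e] be absorbed into the linear bound, as in
    [ripC]. *)
Lemma small_eq (x y c : R) : 0 <= c ->
  (forall e : R, 0 < e -> e <= 1 -> `|x - y| <= c * e) -> x = y.
Proof.
move=> c0 h; apply/eqP; rewrite -subr_eq0 -normr_le0; apply/ler_addgt0Pl => e e0.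
have c1 : 0 < c + 1 by rewrite ltr_wpDl.
have d0 : 0 < Num.min 1 (e / (c + 1)) by rewrite lt_min ltr01 divr_gt0.
rewrite addr0; apply: le_trans (h _ d0 _) _; first by rewrite ge_min lexx.
apply: (@le_trans _ _ ((c + 1) * (e / (c + 1)))).
  by apply: ler_pM => //; [exact: ltW|rewrite lerDl|rewrite ge_min lexx orbT].
by rewrite mulrCA divff ?mulr1// gt_eqF.
Qed.

Context {X : Type} (K : @psdKernel R X).
Implicit Types (s t : seq (C * X)) (f g : X -> C).
Local Notation nle := (nle K).
Local Notation nn := (nn K).
Local Notation ev := (ev K).
Local Notation mem := (rkhs_mem K).

(** An approximation of [g] within [e] by [ev t] confines the inner product to distance [M * e] from
    [pf f t]. The value is the supremum of all lower ends, and [rip_core] shows that these stay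
    below all upper ends. *)
Definition rip f g : R :=
  sup [set r | exists M t e, [/\ nle f M, nle (g - ev t) e & r = pf f t - M * e]].

Lemma rip_core f g M M' t t' e e' : nle f M -> nle f M' ->
  nle (g - ev t) e -> nle (g - ev t') e' -> pf f t - M * e <= pf f t' + M' * e'.
Proof.
move=> hM hM' he he'.
have hd : nn (t ++ scl (-1)%:C t') <= e + e'.
  apply: nle_ev; rewrite ev_cat ev_scl rmorphN1 scaleN1r addrC.
  have -> : - ev t' + ev t = (g - ev t') - (g - ev t).
    by apply/funext => x; rewrite !fctE; ring.
  by rewrite addrC; apply: nleD => //; exact: nleN.
have pd : pf f (t ++ scl (-1)%:C t') = pf f t - pf f t'.
  by rewrite pf_cat pf_scl mulN1r.
have h1 := hM.2 (t ++ scl (-1)%:C t'); have h2 := hM'.2 (t ++ scl (-1)%:C t').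
rewrite pd in h1 h2; have [M0 _] := hM; have [M0' _] := hM'.
have [e0 _] := he; have [e0' _] := he'.
have [MM|MM] := leP M M'.
  have := ler_wpM2l M0 hd; have := ler_wpM2r e0' MM; lra.
have := ler_wpM2l M0' hd; have := ler_wpM2r e0 (ltW MM); lra.
Qed.

Lemma ripP f g M t e : nle f M -> nle (g - ev t) e -> `|rip f g - pf f t| <= M * e.
Proof.
move=> hM he; rewrite ler_distl; apply/andP; split.
- apply: sup_ubound; last by exists M, t, e.
  exists (pf f t + M * e) => _ [M' [t' [e' [h1 h2 ->]]]].
  exact: (rip_core h1 hM h2 he).
- apply: ge_sup; first by exists (pf f t - M * e), M, t, e.
  move=> _ [M' [t' [e' [h1 h2 ->]]]].
  exact: (rip_core h1 hM h2 he).
Qed.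

Lemma rip_ev f t : mem f -> rip f (ev t) = pf f t.
Proof.
move=> /rkhs_mem_bound[M hM]; apply/eqP; rewrite -subr_eq0 -normr_le0.
rewrite -[0](mulr0 M); apply: ripP => //; rewrite subrr -(ev_nil K).
by split=> // u; rewrite -/(rB K _ _) rBC /rB pf_nil mul0r.
Qed.

Lemma ripDl f f' g : mem f -> mem f' -> mem g -> rip (f + f') g = rip f g + rip f' g.
Proof.
move=> /rkhs_mem_bound[M hM] /rkhs_mem_bound[M' hM'] hg.
have [M0 _] := hM; have [M0' _] := hM'.
apply: (@small_eq _ _ (2 * (M + M'))); first by lra.
move=> e e0 _; have [t ht] := hg _ e0.
have := ripP hM ht; have := ripP hM' ht; have := ripP (nleD hM hM') ht.
rewrite pfD !ler_norml => /andP[? ?] /andP[? ?] /andP[? ?].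
by apply/andP; split; lra.
Qed.

Lemma ripZl (a : R) f g : mem f -> mem g -> rip (a%:C *: f) g = a * rip f g.
Proof.
move=> /rkhs_mem_bound[M hM] hg; have [M0 _] := hM.
have aM : 0 <= `|a| * M by rewrite mulr_ge0.
apply: (@small_eq _ _ (2 * (`|a| * M))); first by lra.
move=> e e0 _; have [t ht] := hg _ e0.
have := ripP (nleZ a hM) ht; have := ripP hM ht.
rewrite pfZ => /(ler_wpM2l (normr_ge0 a)); rewrite -normrM mulrBr.
rewrite !ler_norml => /andP[? ?] /andP[? ?].
by apply/andP; split; lra.
Qed.

Lemma rip_ii f g : mem f -> mem g -> rip ('i *: f) ('i *: g) = rip f g.
Proof.
move=> /rkhs_mem_bound[M hM] hg; have [M0 _] := hM.
apply: (@small_eq _ _ (2 * M)); first by lra.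
move=> e e0 _; have [t ht] := hg _ e0.
have ht' : nle ('i *: g - ev (scl 'i t)) e.
  by rewrite ev_scl -scalerBr; exact: nle_i.
have := ripP (nle_i hM) ht'; have := ripP hM ht.
rewrite pf_scl_adj scl_scl.
have -> : ('i^*%C * 'i = 1 :> C)%R.
  by apply/eqP; rewrite eq_complex /=; apply/andP; split; apply/eqP; ring.
rewrite scl1 !ler_norml => /andP[? ?] /andP[? ?].
by apply/andP; split; lra.
Qed.

Lemma nn_approx f M s e : nle f M -> nle (f - ev s) e -> nn s <= M + e.
Proof.
move=> hM hs; apply: nle_ev.
by have := nleB hM hs; rewrite opprB addrC subrK.
Qed.

Lemma ripC f g : mem f -> mem g -> rip f g = rip g f.
Proof.
move=> hf hg; have [M hM] := rkhs_mem_bound hf; have [N hN] := rkhs_mem_bound hg.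
have [M0 _] := hM; have [N0 _] := hN.
apply: (@small_eq _ _ (M + N + (N + 1) + (M + 1))); first by lra.
move=> e e0 e1; have [t ht] := hg _ e0; have [s hs] := hf _ e0.
have := ripP hM ht; have := ripP hN hs.
have := nle_abs t hs; have := nle_abs s ht.
rewrite !pfD !pfN -!/(rB _ _ _) (rBC K t s).
have n1 : e * nn s <= (M + 1) * e.
  by rewrite mulrC; apply: ler_wpM2r; [exact: ltW|]; have := nn_approx hM hs; lra.
have n2 : e * nn t <= (N + 1) * e.
  by rewrite mulrC; apply: ler_wpM2r; [exact: ltW|]; have := nn_approx hN ht; lra.
rewrite !ler_norml => /andP[? ?] /andP[? ?] /andP[? ?] /andP[? ?].
by apply/andP; split; lra.
Qed.

Lemma rip_nle f M : mem f -> nle f M -> rip f f <= M ^+ 2.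
Proof.
move=> hf hM; have [M0 _] := hM; apply/ler_addgt0Pl => e e0.
have d0 : 0 < Num.min 1 (e / (2 * M + 1)) by rewrite lt_min ltr01 divr_gt0//; lra.
have [s hs] := hf _ d0; set d := Num.min _ _ in d0 hs.
have dK : d * (2 * M + 1) <= e.
  by rewrite -ler_pdivlMr; [rewrite /d ge_min lexx orbT|lra].
have := ripP hM hs; rewrite ler_norml => /andP[_ h1].
have h2 := hM.2 s; have h3 := ler_wpM2l M0 (nn_approx hM hs).
have : 0 <= d by exact: ltW.
by move: dK; move: d {d0 hs} h1 h3 => d h1 h3 *; lra.
Qed.

Lemma rip_ge0 f : mem f -> 0 <= rip f f.
Proof.
move=> hf; have [M hM] := rkhs_mem_bound hf; have [M0 _] := hM.
apply/ler_addgt0Pl => e e0.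
have d0 : 0 < Num.min 1 (e / (2 * M + 1)) by rewrite lt_min ltr01 divr_gt0//; lra.
have [s hs] := hf _ d0; set d := Num.min _ _ in d0 hs.
have dK : d * (2 * M + 1) <= e.
  by rewrite -ler_pdivlMr; [rewrite /d ge_min lexx orbT|lra].
have d1 : d <= 1 by rewrite /d ge_min lexx.
have := ripP hM hs; rewrite ler_norml => /andP[h1 _].
have := nle_abs s hs; rewrite pfD pfN -/(rB K s s) ler_norml => /andP[h2 _].
have h3 := ler_wpM2l (ltW d0) (nn_approx hM hs); have h4 := rB_ge0 K s.
have h5 := ler_wpM2l (ltW d0) d1.
by move: d {hs} dK d0 d1 h1 h2 h3 h5 => d *; lra.
Qed.

Lemma rip_cs f g : mem f -> mem g -> rip f g <= Num.sqrt (rip f f) * Num.sqrt (rip g g).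
Proof.
move=> hf hg.
have : rip f g ^+ 2 <= rip f f * rip g g.
  apply: psd_cs => x y.
  have mx := rkhs_memZr x hf; have my := rkhs_memZr y hg.
  have := rip_ge0 (rkhs_memD mx my).
  rewrite ripDl//; last exact: rkhs_memD.
  rewrite ![rip _ (_ + _)]ripC//; try exact: rkhs_memD.
  rewrite !ripDl// !ripZl// ![rip _ (_ *: _)]ripC// !ripZl// (ripC hg hf); lra.
rewrite -sqrtrM ?rip_ge0// => /ler_wsqrtr; rewrite sqrtr_sqr.
by apply: le_trans; exact: ler_norm.
Qed.

Lemma rip_ev_ev s t : rip (ev s) (ev t) = rB K s t.
Proof. by rewrite rip_ev//; exact: rkhs_mem_ev. Qed.

Lemma nle_rip f : mem f -> nle f (Num.sqrt (rip f f)).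
Proof.
move=> hf; split=> [|t]; first exact: sqrtr_ge0.
by rewrite -rip_ev// /nn -rip_ev_ev; apply: rip_cs => //; exact: rkhs_mem_ev.
Qed.

Lemma rip_eq0 f : mem f -> rip f f = 0 -> f = 0.
Proof.
move=> hf f0; apply: pf_eq0 => t.
have := nle_abs t (nle_rip hf); rewrite f0 sqrtr0 mul0r.
by rewrite normr_le0 => /eqP.
Qed.

(** Multiplication by ['i] preserves [rip] and squares to -1, so the symmetric value
    [rip f ('i *: f)] equals its own opposite. *)
Lemma rip_i f : mem f -> rip f ('i *: f) = 0.
Proof.
move=> hf; have hi := rkhs_mem_i hf.
have := rip_ii hf hi; rewrite scalerA -expr2 sqr_i scaleN1r.
rewrite -scaleN1r -[-1](rmorphN1 (real_complex R)) (ripC hi)//; last exact: rkhs_memZr.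
rewrite ripZl// mulN1r => h; lra.
Qed.

End RKHSInner.

(** A Cauchy filter contains balls of radius [1/(n+1)]; their centres form a Cauchy sequence, whose
    limit is a limit of the filter. *)
Lemma complete_from_sequences (R : realType) (V : normedModType R[i]) :
  (forall s : nat -> V, cauchys s -> exists l, tends s l) ->
  forall F : set_system V, ProperFilter F -> cauchy F -> cvg F.
Proof.
move=> seqc F FF cF.
have /choice[x xP] n : exists x : V, F (ball x (n.+1%:R^-1 : R)%:C).
  move/cauchyP: cF; apply.
  by rewrite ltcR invr_gt0.
have ballE (y z : V) (e : R) : ball y e%:C z = (nrm (y - z) < e) :> Prop.
  by rewrite -ball_normE /= nrmE ltcR.
have sC : cauchys x.
  move=> e e0; have e20 : 0 < e / 2 by rewrite divr_gt0.
  have [N hN] := invS_small e20; exists N => m n Nm Nn.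
  have [y []] := filter_ex (filterI (xP m) (xP n)); rewrite !ballE => h1 h2.
  apply: le_trans (nrm_dist _ y _) _; rewrite [nrm (y - _)]nrmB (splitr e).
  by apply: lerD; apply: ltW; [apply: lt_le_trans h1 _|apply: lt_le_trans h2 _]; exact: hN.
have [l lP] := seqc _ sC; apply/cvg_ex; exists l.
apply/cvg_ballP => -[e e'] /=; rewrite ltcE /= => /andP[/eqP -> e0].
have e20 : 0 < e / 2 by rewrite divr_gt0.
have [N hN] := invS_small e20; have [N' hN'] := lP _ e20.
have := xP (maxn N N'); apply: filterS => y; rewrite -[e +i* 0]/(e%:C) !ballE => h.
apply: le_lt_trans (nrm_dist _ (x (maxn N N')) _) _; rewrite (splitr e).
rewrite nrmB; apply: ler_ltD; first by apply: hN'; exact: leq_maxr.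
by apply: lt_le_trans h _; apply: hN; exact: leq_maxl.
Qed.

Lemma real_cauchy_cvg (R : realType) (g : nat -> R) :
  (forall e : R, 0 < e ->
    exists N, forall m n, (N <= m)%N -> (N <= n)%N -> `|g m - g n| <= e) ->
  exists l, forall e : R, 0 < e -> exists N, forall n, (N <= n)%N -> `|g n - l| <= e.
Proof.
move=> gC.
have gE : cauchy (g @ \oo).
  apply: cauchy_exP => e e0.
  have [N hN] := gC _ (divr_gt0 e0 (ltr0Sn _ 1)).
  exists (g N), N => // n /= Nn; rewrite -ball_normE /=.
  apply: le_lt_trans (hN _ _ (leqnn N) Nn) _.
  by rewrite gtr_pMr// invf_lt1// ltr1n.
have [l hl] := (cvg_ex _).1 (cauchy_cvg _ gE).
exists l => e e0; have [N _ hN] := (cvgrPdist_lt g l).1 hl _ e0.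
by exists N => n Nn; rewrite distrC; apply: ltW; exact: hN.
Qed.

Lemma weighted_le (R : realDomainType) (u v a b e : R) :
  0 <= u -> 0 <= v -> 0 <= a -> 0 <= b ->
  a * (u + v + 1) <= e -> b * (u + v + 1) <= e -> u * a + v * b <= e.
Proof. by move=> *; have [|/ltW] := leP a b => *; nra. Qed.

Section RKHSHilbert.
Context {R : realType} {X : Type} (K : @psdKernel R X).
Local Notation C := R[i].
Local Notation V := (rkhs K).
Implicit Types f g : V.

Lemma rfun_mem f : rkhs_mem K (rfun f).
Proof. by apply/asboolP; exact: rkhsP. Qed.
Hint Resolve rfun_mem : core.

Definition rin f g : R := rip K (rfun f) (rfun g).

Lemma rinC f g : rin f g = rin g f. Proof. exact: ripC. Qed.
Lemma rinDl f f' g : rin (f + f') g = rin f g + rin f' g.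
Proof. by rewrite /rin rfunD ripDl. Qed.
Lemma rinZl (a : R) f g : rin (a%:C *: f) g = a * rin f g.
Proof. by rewrite /rin rfunZ ripZl. Qed.
Lemma rin_ii f g : rin ('i *: f) ('i *: g) = rin f g.
Proof. by rewrite /rin !rfunZ rip_ii. Qed.
Lemma rin_i f : rin f ('i *: f) = 0.
Proof. by rewrite /rin rfunZ rip_i. Qed.
Lemma rin_ge0 f : 0 <= rin f f. Proof. exact: rip_ge0. Qed.
Lemma rin_eq0 f : rin f f = 0 -> f = 0.
Proof. by move=> /(rip_eq0 (rfun_mem f)) f0; apply: val_inj. Qed.
Lemma rinDr f f' g : rin g (f + f') = rin g f + rin g f'.
Proof. by rewrite rinC rinDl ![rin _ g]rinC. Qed.
Lemma rinZr (a : R) f g : rin f (a%:C *: g) = a * rin f g.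
Proof. by rewrite rinC rinZl rinC. Qed.
Lemma rin_cs f g : rin f g <= Num.sqrt (rin f f) * Num.sqrt (rin g g).
Proof. exact: rip_cs. Qed.
Lemma rin_il f g : rin ('i *: f) g = - rin f ('i *: g).
Proof.
have := rin_ii f ('i *: g); rewrite scalerA -expr2 sqr_i => <-.
by rewrite -[-1](rmorphN1 (real_complex R)) rinZr mulN1r opprK.
Qed.

Let norm f : C := (Num.sqrt (rin f f))%:C.

Lemma rkhs_normD f g : norm (f + g) <= norm f + norm g.
Proof.
rewrite /norm -rmorphD lecR -ler_sqr ?nnegrE ?addr_ge0 ?sqrtr_ge0//.
rewrite sqrrD !sqr_sqrtr ?rin_ge0// !(rinDl, rinDr) (rinC g f).
have := rin_cs f g; lra.
Qed.

Lemma rkhs_normZ (a : C) f : norm (a *: f) = `|a| * norm f.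
Proof.
rewrite /norm complex_scale !(rinDl, rinDr, rinZl, rinZr).
rewrite (rinC ('i *: f) f) rin_i rin_ii.
rewrite normc_def -rmorphM -sqrtrM ?addr_ge0 ?sqr_ge0//.
by congr (Num.sqrt _)%:C; ring.
Qed.

Lemma rkhs_norm0 f : norm f = 0 -> f = 0.
Proof.
move=> /complexI /eqP; rewrite sqrtr_eq0 => f0; apply: rin_eq0.
by apply/eqP; rewrite eq_le f0 rin_ge0.
Qed.

HB.instance Definition _ := Lmodule_isNormed.Build C V rkhs_normD rkhs_normZ rkhs_norm0.

Lemma rkhs_nrm f : nrm f = Num.sqrt (rin f f).
Proof. by []. Qed.

Lemma rkhs_nle f : nle K (rfun f) (nrm f).
Proof. exact: nle_rip. Qed.

Lemma rkhs_nrm_le f M : nle K (rfun f) M -> nrm f <= M.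
Proof.
move=> h; have [M0 _] := h; rewrite rkhs_nrm -[M in _ <= M](ger0_norm M0) -sqrtr_sqr.
by apply: ler_wsqrtr; exact: rip_nle.
Qed.

(** The limit is found pointwise. Closeness in dual norm follows because the bound for [s n - s m]
    against a fixed [t] survives letting [m] grow, with a rank for [n] that does not depend on
    [t]. *)
Lemma rkhs_seq_complete (s : nat -> V) : cauchys s -> exists l, tends s l.
Proof.
move=> sC.
have cauch (g : nat -> R) (c : R) : 0 <= c ->
    (forall m n, `|g m - g n| <= nrm (s m - s n) * c) ->
    exists l, forall e : R, 0 < e -> exists N, forall n, (N <= n)%N -> `|g n - l| <= e.
  move=> c0 hg.
  apply: real_cauchy_cvg => e e0; have c1 : 0 < c + 1 by rewrite ltr_wpDl.
  have [N hN] := sC _ (divr_gt0 e0 c1); exists N => m n Nm Nn.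
  apply: le_trans (hg m n) _; have := hN m n Nm Nn; rewrite ler_pdivlMr//.
  by move=> h; apply: le_trans h; rewrite ler_wpM2l ?nrm_ge0// lerDl.
have dist t m n : `|pf (rfun (s m)) t - pf (rfun (s n)) t| <= nrm (s m - s n) * nn K t.
  have := nle_abs t (rkhs_nle (s m - s n)).
  by rewrite rfunB pfD pfN.
(* Pairing with the point mass at [x] of coefficient 1 or ['i] extracts the real or imaginary part
   of the value at [x]. *)
pose d1 x : seq (C * X) := [:: (1, x)].
pose di x : seq (C * X) := [:: ('i, x)].
have re (f : X -> C) x : pf f (d1 x) = complex.Re (f x).
  by rewrite pf_cons pf_nil /=; case: (f x) => a b /=; ring.
have im (f : X -> C) x : pf f (di x) = complex.Im (f x).
  by rewrite pf_cons pf_nil /=; case: (f x) => a b /=; ring.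
have /choice[lr lrP] x := cauch _ _ (nn_ge0 K (d1 x)) (dist (d1 x)).
have /choice[li liP] x := cauch _ _ (nn_ge0 K (di x)) (dist (di x)).
pose l x : C := lr x +i* li x.
have pf_lim t (e : R) : 0 < e -> exists N, forall n, (N <= n)%N ->
    `|pf (rfun (s n)) t - pf l t| <= e.
  elim: t e => [|[c x] t IH] e e0.
    by exists 0 => n _; rewrite !pf_nil subrr normr0 ltW.
  have e2 : 0 < e / 2 by rewrite divr_gt0.
  have c1 : 0 < `|complex.Re c| + `|complex.Im c| + 1.
    by rewrite ltr_wpDl// addr_ge0.
  have e3 := divr_gt0 e2 c1.
  have [N1 h1] := IH _ e2; have [N2 h2] := lrP x _ e3; have [N3 h3] := liP x _ e3.
  exists (maxn N1 (maxn N2 N3)) => n; rewrite !geq_max => /and3P[n1 n2 n3].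
  rewrite !pf_cons /=.
  have {h1} := h1 n n1; have {h2} := h2 n n2; have {h3} := h3 n n3.
  rewrite re im; case: (rfun (s n) x) => a b /=.
  case: c c1 {e3} => u v /= c1 h3 h2 h1.
  have -> : u * a - - v * b + pf (rfun (s n)) t - (u * lr x - - v * li x + pf l t)
    = u * (a - lr x) + v * (b - li x) + (pf (rfun (s n)) t - pf l t) by ring.
  apply: le_trans (ler_normD _ _) _; rewrite (splitr e) lerD//.
  apply: le_trans (ler_normD _ _) _; rewrite !normrM.
  by apply: weighted_le; rewrite // -ler_pdivlMr.
have near (e : R) : 0 < e -> exists N, forall n, (N <= n)%N -> nle K (rfun (s n) - l) e.
  move=> e0; have [N hN] := sC _ e0; exists N => n Nn.
  split=> [|t]; first exact: ltW.
  apply/ler_addgt0Pl => d d0; have [N' hN'] := pf_lim t _ d0.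
  pose m := maxn N N'; have := hN' m (leq_maxr _ _); have := dist t n m.
  have := ler_wpM2r (nn_ge0 K t) (hN n m Nn (leq_maxl _ _)).
  rewrite pfD pfN !ler_norml => h1 /andP[_ h2] /andP[_ h3].
  by lra.
have lmem : rkhs_mem K l.
  move=> e e0; have e2 : 0 < e / 2 by rewrite divr_gt0.
  have [N hN] := near _ e2; have [t ht] := rfun_mem (s N) e2.
  exists t; rewrite (splitr e).
  have -> : l - ev K t = - (rfun (s N) - l) + (rfun (s N) - ev K t).
    by apply/funext => x; rewrite !fctE; ring.
  by apply: nleD => //; apply: nleN; exact: hN.
have lP : l \in rkhs_pred K by apply/asboolP.
exists (Rkhs lP) => e /near[N hN]; exists N => n Nn.
by apply: rkhs_nrm_le; rewrite rfunB; exact: hN.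
Qed.

HB.instance Definition _ := Uniform_isComplete.Build V
  (@complete_from_sequences _ _ rkhs_seq_complete).

(** The same recovery of a complex inner product from its real part as in [hdotE]. *)
Definition rhdot f g : C := rin f g +i* rin f ('i *: g).

Lemma rhdot_bilinear : bilinear_for *%R (@Num.conj C \; *%R) rhdot.
Proof.
have addr f f' g : rhdot (f + f') g = rhdot f g + rhdot f' g.
  by rewrite /rhdot !rinDl.
have addl f f' g : rhdot g (f + f') = rhdot g f + rhdot g f'.
  by rewrite /rhdot scalerDr !rinDr.
split=> u a f g /=; rewrite ?addr ?addl; congr (_ + _).
- rewrite /rhdot [a *: f]complex_scale !(rinDl, rinZl) !rin_il.
  rewrite scalerA -expr2 sqr_i -[-1](rmorphN1 (real_complex R)) rinZr.
  by case: a => a b /=; congr (_ +i* _); ring.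
- rewrite /rhdot scalerA mulrC -scalerA.
  rewrite !(complex_scale a) !(rinDr, rinZr).
  rewrite scalerA -expr2 sqr_i -[-1](rmorphN1 (real_complex R)) rinZr.
  by case: a => a b /=; congr (_ +i* _); ring.
Qed.

HB.instance Definition _ :=
  bilinear_isBilinear.Build C V V C *%R (@Num.conj C \; *%R) rhdot rhdot_bilinear.

Lemma rhdot_hermitian f g : rhdot f g = (-1) ^+ false * Num.conj (rhdot g f).
Proof.
rewrite expr0 mul1r /rhdot /= (rinC g f); congr (_ +i* _).
by rewrite rinC rin_il.
Qed.

HB.instance Definition _ :=
  isHermitianSesquilinear.Build C V false (@Num.conj C) rhdot rhdot_hermitian.

Lemma rhdot_gt0 f : f != 0 -> 0 < rhdot f f.
Proof.
move=> f0; rewrite /rhdot rin_i ltcR lt_neqAle rin_ge0 andbT eq_sym.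
by apply: contra f0 => /eqP/rin_eq0/eqP.
Qed.

HB.instance Definition _ := isDotProduct.Build C V rhdot rhdot_gt0.

Lemma rhdot_norm f : `|f| ^+ 2 = rhdot f f.
Proof. by rewrite nrmE rkhs_nrm -rmorphXn /= sqr_sqrtr ?rin_ge0// /rhdot rin_i. Qed.

HB.instance Definition _ := isHilbert.Build R V rhdot_norm.

End RKHSHilbert.

(** * Total families and extension by density *)

Section Total.
Context {R : realType}.
Local Notation C := R[i].

Definition lcomb {X : Type} {H : hilbertType R} (k : X -> H) (s : seq (C * X)) : H :=
  \sum_(p <- s) p.1 *: k p.2.

Definition total_family {X : Type} {H : hilbertType R} (k : X -> H) : Prop :=
  forall y (e : R), 0 < e -> exists s, nrm (y - lcomb k s) <= e.

Section Lcomb.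
Context {X : Type} {H : hilbertType R} (k : X -> H).

Lemma lcomb_nil : lcomb k [::] = 0.
Proof. exact: big_nil. Qed.
Lemma lcomb_cons p s : lcomb k (p :: s) = p.1 *: k p.2 + lcomb k s.
Proof. exact: big_cons. Qed.
Lemma lcomb1 x : lcomb k [:: (1, x)] = k x.
Proof. by rewrite lcomb_cons lcomb_nil addr0 scale1r. Qed.
Lemma lcomb_cat s t : lcomb k (s ++ t) = lcomb k s + lcomb k t.
Proof. exact: big_cat. Qed.
Lemma lcomb_scl a s : lcomb k (scl a s) = a *: lcomb k s.
Proof.
by rewrite /lcomb big_map scaler_sumr; apply: eq_bigr => p _; rewrite scalerA.
Qed.
Lemma lcombB s t : lcomb k s - lcomb k t = lcomb k (s ++ scl (-1) t).
Proof. by rewrite lcomb_cat lcomb_scl scaleN1r. Qed.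

Lemma lcomb_map (Y : Type) (g : Y -> X) s :
  lcomb k [seq (p.1, g p.2) | p <- s] = lcomb (k \o g) s.
Proof. exact: big_map. Qed.

End Lcomb.

Lemma lin_lcomb (X : Type) (H K : hilbertType R) (A : H -> K) (k : X -> H) s :
  linear A -> A (lcomb k s) = lcomb (A \o k) s.
Proof.
by move=> lA; rewrite /lcomb linP_sum//; apply: eq_bigr => p _; rewrite linPZ.
Qed.

Lemma hdot_suml (H : hilbertType R) (I : Type) (s : seq I) (F : I -> H) y :
  hdot (\sum_(i <- s) F i) y = \sum_(i <- s) hdot (F i) y.
Proof.
elim: s => [|i s IH]; first by rewrite !big_nil linear0l.
by rewrite !big_cons hdotDl IH.
Qed.

Lemma hdot_sumr (H : hilbertType R) (I : Type) (s : seq I) (F : I -> H) y :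
  hdot y (\sum_(i <- s) F i) = \sum_(i <- s) hdot y (F i).
Proof.
elim: s => [|i s IH]; first by rewrite !big_nil linear0r.
by rewrite !big_cons hdotDr IH.
Qed.

Lemma hdot_lcomb (X : Type) (H : hilbertType R) (k : X -> H) s t :
  hdot (lcomb k s) (lcomb k t) =
  \sum_(p <- s) \sum_(q <- t) p.1 * q.1^*%C * hdot (k p.2) (k q.2).
Proof.
rewrite /lcomb hdot_suml; apply: eq_bigr => p _.
rewrite hdot_sumr; apply: eq_bigr => q _.
by rewrite hdotZl hdotZr mulrA.
Qed.

(** The source of all new Hilbert spaces: direct sums ([dsum_exists]) and averaged spaces
    ([mean_kolmogorov]) only have to exhibit a positive kernel. *)
Theorem kolmogorov (X : Type) (K : X -> X -> C) :
  (forall s : seq (C * X), 0 <= \sum_(p <- s) \sum_(q <- s) p.1 * q.1^*%C * K p.2 q.2) ->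
  exists (H : hilbertType R) (k : X -> H),
    (forall x y, hdot (k x) (k y) = K x y) /\ total_family k.
Proof.
move=> psd; pose KK := PsdKernel psd.
have mem s : ev KK s \in rkhs_pred KK by apply/asboolP; exact: rkhs_mem_ev.
pose V : hilbertType R := rkhs KK.
pose k x : V := Rkhs (mem [:: (1, x)]).
have evE s : rfun (lcomb k s) = ev KK s.
  elim: s => [|[a x] s IH]; first by rewrite lcomb_nil ev_nil.
  rewrite lcomb_cons rfunD IH rfunZ -[k x in LHS]/(Rkhs _) /=.
  rewrite -[(a, x) :: s]cat1s ev_cat; congr (_ + _).
  by apply/funext => y; rewrite fctE /ev !big_cons !big_nil /= !addr0 mul1r.
exists V, k; split=> [x y|y e e0]; last first.
  have [s hs] := rfun_mem y e0; exists s.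
  by apply: rkhs_nrm_le; rewrite rfunB evE.
rewrite -[hdot _ _]/(rhdot (k x) (k y)) /rhdot.
have h (a : C) : rin (k x) (a *: k y) = complex.Re (a^*%C * K x y).
  have -> : a *: k y = lcomb k [:: (a, y)] by rewrite lcomb_cons lcomb_nil addr0.
  rewrite /rin evE rip_ev; last exact: rkhs_mem_ev.
  by rewrite pf_cons pf_nil addr0 /= /ev big_cons big_nil addr0 mul1r.
have h1 : rin (k x) (k y) = complex.Re (K x y).
  by have := h 1; rewrite scale1r conjc1 mul1r.
rewrite h h1; case: (K x y) => a b /=.
by congr (_ +i* _); ring.
Qed.

Lemma total_tends (X : Type) (H : hilbertType R) (k : X -> H) y :
  total_family k -> exists s : nat -> seq (C * X), tends (fun n => lcomb k (s n)) y.
Proof.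
move=> tk; have /choice[s hs] n : exists s, nrm (y - lcomb k s) <= n.+1%:R^-1.
  by apply: tk; rewrite invr_gt0.
exists s => e e0; have [N hN] := invS_small e0; exists N => n Nn.
by rewrite nrmB (le_trans (hs n))// hN.
Qed.

Lemma bop_ext (X : Type) (H K : hilbertType R) (k : X -> H) (A B : H -> K) :
  total_family k -> bop A -> bop B -> (forall x, A (k x) = B (k x)) -> A = B.
Proof.
move=> tk bA bB AB; apply/funext => y; have [s hs] := total_tends y tk.
apply: tends_unique (bop_tends bA hs) _.
suff -> : (A \o fun n => lcomb k (s n)) = (B \o fun n => lcomb k (s n)).
  exact: bop_tends.
apply/funext => n /=; rewrite !lin_lcomb; [|exact: bB.1|exact: bA.1].
by apply: eq_bigr => p _; rewrite /= AB.
Qed.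

Lemma hdot_ext (X : Type) (H : hilbertType R) (k : X -> H) y z :
  total_family k -> (forall x, hdot (k x) y = hdot (k x) z) -> y = z.
Proof.
move=> tk h; apply/eqP; rewrite -subr_eq0; apply/eqP/nrm_small => e e0.
have [s hs] := tk (y - z) _ e0.
have o : rdot (lcomb k s) (y - z) = 0.
  rewrite rdotBr /rdot /lcomb !hdot_suml.
  suff -> : \sum_(i <- s) hdot (i.1 *: k i.2) z = \sum_(i <- s) hdot (i.1 *: k i.2) y.
    by rewrite subrr.
  by apply: eq_bigr => p _; rewrite !hdotZl h.
have [->|n0] := eqVneq (y - z) 0; first by rewrite nrm0 ltW.
rewrite -(@ler_pM2r _ (nrm (y - z))) ?nrm_gt0//.
rewrite -expr2 -rdotxx -[X in rdot X _](subrK (lcomb k s)) rdotDl o addr0.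
apply: le_trans (rdot_le _ _) _.
by rewrite ler_wpM2r ?nrm_ge0.
Qed.

Lemma adj2_hdot (H K : hilbertType R) (A : H -> K) B x y :
  linear A -> adj2 A B -> hdot (A x) y = hdot x (B y).
Proof. by move=> lA h; rewrite !hdotE h rdot_ir -(linPZ lA) h -rdot_ir. Qed.

Lemma adj2_of_hdot (H K : hilbertType R) (A : H -> K) B :
  (forall x y, hdot (A x) y = hdot x (B y)) -> adj2 A B.
Proof. by move=> h x y; rewrite /rdot h. Qed.

Lemma extension (X : Type) (H Y : hilbertType R) (k : X -> H) (f : X -> Y) (M : R) :
  total_family k -> 0 <= M ->
  (forall s, nrm (lcomb f s) <= M * nrm (lcomb k s)) ->
  exists T : H -> Y, [/\ linear T, forall x, nrm (T x) <= M * nrm x &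
                         forall x, T (k x) = f x].
Proof.
move=> tk M0 hM.
(* [P] is the closure of the graph of [lcomb k s |-> lcomb f s]; the bound [P_le] makes it
   single-valued, completeness of [Y] makes it total. *)
pose P y z := forall e : R, 0 < e ->
  exists2 s, nrm (y - lcomb k s) <= e & nrm (z - lcomb f s) <= e.
have P_le y z : P y z -> nrm z <= M * nrm y.
  move=> h; apply/ler_addgt0Pl => e e0.
  have M1 : 0 < M + 1 by rewrite ltr_wpDl.
  have [s h1 h2] := h _ (divr_gt0 e0 M1).
  have h3 := nrm_ltB z (lcomb f s); have h4 := nrm_ltB (lcomb k s) y.
  rewrite nrmB in h4; have h5 := hM s.
  have h6 := ler_wpM2l M0 h4.
  rewrite ler_pdivlMr// in h1; rewrite ler_pdivlMr// in h2.
  by nra.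
have P_lin a y z y' z' : P y z -> P y' z' -> P (a *: y + y') (a *: z + z').
  move=> h h' e e0.
  have a1 : 0 < cabs a + 1 by rewrite ltr_wpDl// cabs_ge0.
  have [s h1 h2] := h _ (divr_gt0 e0 (mulr_gt0 (ltr0Sn _ 1) a1)).
  have [s' h1' h2'] := h' _ (divr_gt0 e0 (ltr0Sn _ 1)).
  have aux (V : hilbertType R) (x u x' u' : V) :
      nrm (x - u) <= e / (2 * (cabs a + 1)) -> nrm (x' - u') <= e / 2 ->
      nrm (a *: x + x' - (a *: u + u')) <= e.
    rewrite opprD addrACA -scalerBr => g g'.
    apply: le_trans (nrmD _ _) _; rewrite nrmZ [e in _ <= e]splitr lerD//.
    move: g; rewrite ler_pdivlMr ?mulr_gt0// ler_pdivlMr//.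
    by have := nrm_ge0 (x - u); have := cabs_ge0 a; nra.
  by exists (scl a s ++ s'); rewrite lcomb_cat lcomb_scl; exact: aux.
have P_ex y : exists z, P y z.
  have [s hs] := total_tends y tk.
  have sC : cauchys (fun n => lcomb f (s n)).
    move=> e e0; have M1 : 0 < 2 * (M + 1) by rewrite mulr_gt0// ltr_wpDl.
    have [N hN] := hs _ (divr_gt0 e0 M1); exists N => m n Nm Nn.
    rewrite lcombB; apply: le_trans (hM _) _; rewrite -lcombB.
    have h1 := nrm_dist (lcomb k (s m)) y (lcomb k (s n)).
    rewrite [nrm (y - _)]nrmB in h1.
    have := hN m Nm; have := hN n Nn; rewrite !ler_pdivlMr// => h2 h3.
    by have := ler_wpM2l M0 h1; have := nrm_ge0 (lcomb k (s m) - y);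
      have := nrm_ge0 (lcomb k (s n) - y); nra.
  have [z hz] := cauchys_tends sC; exists z => e e0.
  have [N hN] := hs _ e0; have [N' hN'] := hz _ e0.
  exists (s (maxn N N')); first by rewrite nrmB hN// leq_maxl.
  by rewrite nrmB hN'// leq_maxr.
have P_uniq y z z' : P y z -> P y z' -> z = z'.
  move=> h h'; apply/eqP; rewrite -subr_eq0 addrC -scaleN1r; apply/eqP/nrm0_eq0.
  apply/eqP; rewrite eq_le nrm_ge0 andbT.
  by have := P_le _ _ (P_lin (-1) _ _ _ _ h' h); rewrite (scaleN1r y) addNr nrm0 mulr0.
have /choice[T hT] := P_ex; exists T; split.
- by move=> a x y; apply: (P_uniq (a *: x + y)) => //; exact: P_lin.
- by move=> x; exact: P_le.
- move=> x; apply: (P_uniq (k x)) => // e e0; exists [:: (1, x)];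
    by rewrite lcomb1 subrr nrm0 ltW.
Qed.

Lemma isom_extension (X : Type) (H Y : hilbertType R) (k : X -> H) (f : X -> Y) :
  total_family k -> (forall x y, hdot (f x) (f y) = hdot (k x) (k y)) ->
  exists T : H -> Y, isom T /\ forall x, T (k x) = f x.
Proof.
move=> tk h.
have hs s : nrm (lcomb f s) = nrm (lcomb k s).
  apply/eqP; rewrite -(@eqrXn2 _ 2) ?nrm_ge0//; apply/eqP/complexI.
  rewrite -!hdotxx !hdot_lcomb.
  by apply: eq_bigr => p _; apply: eq_bigr => q _; rewrite h.
have [|T [lT nT Tk]] := @extension _ _ _ k f 1 tk ler01.
  by move=> s; rewrite hs mul1r.
exists T; split=> //; split=> // y.
have bT : bop T by split=> //; exists 1.
apply/eqP; rewrite eq_le; apply/andP; split; first by rewrite -[leRHS]mul1r.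
apply/ler_addgt0Pl => e e0; have [s h1] := tk y _ (divr_gt0 e0 (ltr0Sn _ 1)).
have h2 := nT (y - lcomb k s); rewrite (linPB lT) lin_lcomb// in h2.
have h3 : lcomb (T \o k) s = lcomb f s by apply: eq_bigr => p _; rewrite /= Tk.
rewrite h3 mul1r in h2.
have h4 := nrm_ltB y (lcomb k s); have h5 := nrm_ltB (lcomb f s) (T y).
rewrite nrmB in h5; have h6 := hs s; lra.
Qed.

Lemma isom_adjK (H K : hilbertType R) (T : H -> K) : isom T -> adj T \o T = id.
Proof.
move=> iT; apply/funext => x; apply: rdot_inj => z /=.
by rewrite rdotC -(adjP (isom_bop iT)) isom_rdot// rdotC.
Qed.

End Total.

(** * Direct sums *)

Section DirectSum.
Context {R : realType}.
Local Notation C := R[i].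

Lemma isom_hdot (H K : hilbertType R) (A : H -> K) x y :
  isom A -> hdot (A x) (A y) = hdot x y.
Proof. by move=> iA; rewrite !hdotE -(linPZ iA.1) !(isom_rdot _ _ iA). Qed.

Section Defs.
Context {I : eqType}.

(** Reads [p] as a vector of the direct sum supported at the index [tag p]; the cast transports its
    value along the decided equality of indices. *)
Definition dcomp {H : I -> hilbertType R} (i : I) (p : {j & H j}) : H i :=
  match tag p =P i with
  | ReflectT e => ecast j (H j) e (tagged p)
  | ReflectF _ => 0
  end.

Lemma dcomp_id (H : I -> hilbertType R) (p : {j & H j}) : dcomp (tag p) p = tagged p.
Proof. by rewrite /dcomp; case: eqP => // e; rewrite eq_axiomK. Qed.

Lemma dcomp_neq (H : I -> hilbertType R) i (p : {j & H j}) : tag p != i -> dcomp i p = 0.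
Proof. by rewrite /dcomp; case: eqP. Qed.

(** An internal description, so that one and the same space can be decomposed in several ways, as in
    [alternating_swap]. *)
Definition is_dsum (H : I -> hilbertType R) (Y : hilbertType R)
    (iota : forall i, H i -> Y) : Prop :=
  [/\ forall i, isom (@iota i),
      forall i j x y, i != j -> hdot (@iota i x) (@iota j y) = 0 &
      total_family (fun p : {i & H i} => iota (tag p) (tagged p))].

End Defs.

(** The kernel vanishes between different summands; over the finite set [T] of indices that occur it
    is a sum of Gram matrices, hence positive. *)
Lemma dsum_exists (I : eqType) (H : I -> hilbertType R) :
  exists (Y : hilbertType R) (iota : forall i, H i -> Y), is_dsum iota.
Proof.
pose K (p q : {i & H i}) : C := hdot (dcomp (tag q) p) (tagged q).
have K_sum (T : seq I) p q : uniq T -> tag q \in T ->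
    K p q = \sum_(i <- T) hdot (dcomp i p) (dcomp i q).
  move=> uT qT; rewrite (bigD1_seq (tag q))//= big1; first by rewrite addr0 dcomp_id.
  by move=> i iq; rewrite (@dcomp_neq _ _ i q) 1?eq_sym// linear0r.
have psd (s : seq (C * {i & H i})) :
    0 <= \sum_(p <- s) \sum_(q <- s) p.1 * q.1^*%C * K p.2 q.2.
  pose T := undup [seq tag p.2 | p <- s].
  have -> : \sum_(p <- s) \sum_(q <- s) p.1 * q.1^*%C * K p.2 q.2 =
      \sum_(p <- s) \sum_(q <- s) \sum_(i <- T)
        p.1 * q.1^*%C * hdot (dcomp i p.2) (dcomp i q.2).
    apply: eq_bigr => p _; rewrite big_seq [RHS]big_seq; apply: eq_bigr => q qs.
    rewrite (K_sum T) ?undup_uniq ?mulr_sumr// mem_undup.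
    exact: (map_f (fun p : C * {i & H i} => tag p.2)).
  under eq_bigr do rewrite exchange_big.
  rewrite exchange_big; apply: sumr_ge0 => i _ /=.
  rewrite -(hdot_lcomb (dcomp i)) hdotxx ler0c; exact: sqr_ge0.
have [Y [k [kK tk]]] := kolmogorov psd.
pose iota i (x : H i) := k (Tagged H x).
have io i (x y : H i) : hdot (iota i x) (iota i y) = hdot x y.
  by rewrite kK /K /= (dcomp_id (Tagged H x)).
have oo i j (x : H i) (y : H j) : i != j -> hdot (iota i x) (iota j y) = 0.
  by move=> ij; rewrite kK /K dcomp_neq ?linear0l.
have tt : total_family (fun p : {i & H i} => iota (tag p) (tagged p)).
  suff -> : (fun p : {i & H i} => iota (tag p) (tagged p)) = k by [].
  by apply/funext => -[i x].
exists Y, iota; split=> //.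
move=> i; split.
  move=> a x y; apply: (hdot_ext tt) => -[j z] /=.
  rewrite hdotDr hdotZr; have [ji|ji] := eqVneq j i.
    by move: z; rewrite ji => z; rewrite !io hdotDr hdotZr.
  by rewrite !oo// mulr0 addr0.
move=> x; apply/eqP; rewrite -(@eqrXn2 _ 2) ?nrm_ge0//; apply/eqP/complexI.
by rewrite -!hdotxx io.
Qed.

Section Theory.
Context {I : eqType} {H : I -> hilbertType R} {Y : hilbertType R}.
Context {iota : forall i, H i -> Y}.
Arguments iota : clear implicits.
Hypothesis dY : is_dsum iota.

Lemma dsum_isom i : isom (iota i). Proof. by case: dY. Qed.
Lemma dsum_lin i : linear (iota i). Proof. by have [] := dsum_isom i. Qed.
Lemma dsum_bop i : bop (iota i). Proof. exact/isom_bop/dsum_isom. Qed.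
Lemma dsum_nrm i x : nrm (iota i x) = nrm x. Proof. by have [_ ->] := dsum_isom i. Qed.
Lemma dsum_total : total_family (fun p : {i & H i} => iota (tag p) (tagged p)).
Proof. by case: dY. Qed.
Lemma dsum_ortho i j x y : i != j -> hdot (iota i x) (iota j y) = 0.
Proof. by case: dY => _ + _; exact. Qed.
Lemma dsum_hdot i x y : hdot (iota i x) (iota i y) = hdot x y.
Proof. exact/isom_hdot/dsum_isom. Qed.

Lemma dsum_pyth (T : seq I) (z : forall i, H i) : uniq T ->
  nrm (\sum_(i <- T) iota i (z i)) ^+ 2 = \sum_(i <- T) nrm (z i) ^+ 2.
Proof.
elim: T => [|i T IH] /=; first by rewrite !big_nil nrm0 expr0n.
move=> /andP[iT uT]; rewrite !big_cons nrm_sqD IH// dsum_nrm rdotC rdot_suml.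
rewrite [X in 2 * X]big_seq [X in 2 * X]big1 ?mulr0 ?addr0// => j jT; rewrite /rdot dsum_ortho//.
by apply: contraNneq iT => <-.
Qed.

Definition dpart i (s : seq (C * {i & H i})) : H i := lcomb (dcomp i) s.

End Theory.

Arguments dsum_lin {I H Y iota} dY i : rename.
Arguments dsum_isom {I H Y iota} dY i : rename.
Arguments dsum_bop {I H Y iota} dY i : rename.

(** Grouping a finite combination by index puts it in the form to which [dsum_pyth] applies. *)
Lemma dsum_lcomb (I : eqType) (H K : I -> hilbertType R) (Y : hilbertType R)
    (kappa : forall i, K i -> Y) (A : forall i, H i -> K i) (s : seq (C * {i & H i}))
    (T : seq I) :
  is_dsum kappa -> (forall i, linear (A i)) -> uniq T ->
  {subset [seq tag p.2 | p <- s] <= T} ->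
  lcomb (fun p : {i & H i} => kappa (tag p) (A (tag p) (tagged p))) s =
  \sum_(i <- T) kappa i (A i (dpart i s)).
Proof.
move=> dY lA uT; elim: s => [|[c p] s IH] sT.
  rewrite lcomb_nil big1// => i _.
  by rewrite /dpart lcomb_nil (linP0 (lA i)) (linP0 (dsum_lin dY i)).
rewrite lcomb_cons IH; last by move=> i si; apply: sT; rewrite inE si orbT.
have pT : tag p \in T by apply: sT; rewrite /= inE eqxx.
have -> : c *: kappa (tag p) (A (tag p) (tagged p)) =
    \sum_(i <- T) c *: kappa i (A i (dcomp i p)).
  rewrite (bigD1_seq (tag p))//= big1; first by rewrite addr0 dcomp_id.
  move=> i ip; rewrite dcomp_neq 1?eq_sym//.
  by rewrite (linP0 (lA i)) (linP0 (dsum_lin dY i)) scaler0.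
rewrite -big_split /=; apply: eq_bigr => i _.
by rewrite /dpart lcomb_cons lA (dsum_lin dY i).
Qed.

Lemma dsum_map (I : eqType) (H K : I -> hilbertType R) (Y Z : hilbertType R)
    (iota : forall i, H i -> Y) (kappa : forall i, K i -> Z)
    (A : forall i, H i -> K i) (M : R) :
  is_dsum iota -> is_dsum kappa -> 0 <= M ->
  (forall i, linear (A i)) -> (forall i x, nrm (A i x) <= M * nrm x) ->
  exists T : Y -> Z, [/\ linear T, forall x, nrm (T x) <= M * nrm x &
                         forall i x, T (iota i x) = kappa i (A i x)].
Proof.
move=> dY dZ M0 lA nA.
have [s|T [lT nT TE]] := extension (f := fun p : {i & H i} => kappa (tag p) (A (tag p) (tagged p)))
  (dsum_total dY) M0; last first.
  by exists T; split=> // i x; have := TE (Tagged H x).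
pose T := undup [seq tag p.2 | p <- s].
have sT : {subset [seq tag p.2 | p <- s] <= T} by move=> i; rewrite mem_undup.
rewrite (dsum_lcomb dZ lA (undup_uniq _) sT).
rewrite (@dsum_lcomb _ _ _ _ _ (fun i => id) _ _ dY _ (undup_uniq _) sT)//.
have M1 x : 0 <= M * nrm (x : Y) by rewrite mulr_ge0 ?nrm_ge0.
rewrite nrm_sqrtP// exprMn !(dsum_pyth _ _ (undup_uniq _))//.
rewrite mulr_sumr; apply: ler_sum => i _.
by rewrite -exprMn ler_pXn2r ?nnegrE ?mulr_ge0 ?nrm_ge0.
Qed.

Lemma dsum_isom_map (I : eqType) (H K : I -> hilbertType R) (Y Z : hilbertType R)
    (iota : forall i, H i -> Y) (kappa : forall i, K i -> Z)
    (A : forall i, H i -> K i) :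
  is_dsum iota -> is_dsum kappa -> (forall i, isom (A i)) ->
  exists T : Y -> Z, isom T /\ forall i x, T (iota i x) = kappa i (A i x).
Proof.
move=> dY dZ iA.
have [[i x] [j y]|T [iT TE]] := isom_extension
  (f := fun p : {i & H i} => kappa (tag p) (A (tag p) (tagged p))) (dsum_total dY); last first.
  by exists T; split=> // i x; have := TE (Tagged H x).
have [ij|ij] := eqVneq i j; last by rewrite (dsum_ortho dZ) ?(dsum_ortho dY).
move: y; rewrite -ij /= => y; rewrite (dsum_hdot dZ) (dsum_hdot dY).
exact: isom_hdot.
Qed.

End DirectSum.

Arguments dsum_lin {R I H Y iota} dY i : rename.
Arguments dsum_isom {R I H Y iota} dY i : rename.
Arguments dsum_bop {R I H Y iota} dY i : rename.

(** * Noncommutative polynomials and equivalence of unitary tuples *)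

Section Approx.
Context {R : realType}.
Local Notation C := R[i].

Definition apx {H K : hilbertType R} (A B : H -> K) (e : R) : Prop :=
  forall x, nrm (A x - B x) <= e * nrm x.

Section Apx.
Context {H K : hilbertType R}.
Implicit Types A B : H -> K.

Lemma apx_refl A : apx A A 0.
Proof. by move=> x; rewrite subrr nrm0 mul0r. Qed.

Lemma apx_sym A B e : apx A B e -> apx B A e.
Proof. by move=> h x; rewrite nrmB. Qed.

Lemma apx_trans A B D e e' : apx A B e -> apx B D e' -> apx A D (e + e').
Proof.
by move=> h h' x; apply: le_trans (nrm_dist _ (B x) _) _; rewrite mulrDl lerD.
Qed.

Lemma apx_le A B e e' : e <= e' -> apx A B e -> apx A B e'.
Proof. by move=> ee h x; apply: le_trans (h x) _; rewrite ler_wpM2r ?nrm_ge0. Qed.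

Lemma apxD A A' B B' e e' : apx A B e -> apx A' B' e' -> apx (A + A') (B + B') (e + e').
Proof.
move=> h h' x; rewrite !fctE opprD addrACA mulrDl.
by apply: le_trans (nrmD _ _) _; rewrite lerD.
Qed.

Lemma apxZ (a : C) A B e : apx A B e -> apx (a *: A) (a *: B) (cabs a * e).
Proof.
by move=> h x; rewrite !fctE -scalerBr nrmZ -mulrA ler_wpM2l ?cabs_ge0.
Qed.

Lemma apx_eq A B : (forall e : R, 0 < e -> apx A B e) -> A = B.
Proof.
move=> h; apply/funext => x; apply/eqP; rewrite -subr_eq0; apply/eqP/nrm_small => e e0.
have n1 : 0 < nrm x + 1 by rewrite ltr_wpDl ?nrm_ge0.
apply: le_trans (h _ (divr_gt0 e0 n1) x) _.
by rewrite mulrAC ler_pdivrMr// ler_wpM2l ?lerDl// ltW.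
Qed.

Lemma apx_adj A B (A' B' : K -> H) (e : R) :
  0 <= e -> adj2 A A' -> adj2 B B' -> apx A B e -> apx A' B' e.
Proof.
move=> e0 hA hB h; have -> : A' = B' + (A' - B') by rewrite addrC subrK.
have h2 : adj2 (A - B) (A' - B').
  by move=> x y; rewrite !fctE rdotBl rdotBr hA hB.
move=> y; have := adj2_le e0 h h2 y.
by rewrite !fctE [B' y + _]addrC addrK.
Qed.

Lemma apx_bound A B e M : apx A B e -> (forall x, nrm (A x) <= M * nrm x) ->
  forall x, nrm (B x) <= (M + e) * nrm x.
Proof.
move=> h hM x; apply: le_trans (nrm_ltB _ (A x)) _.
by rewrite nrmB mulrDl lerD.
Qed.

End Apx.

Lemma apx_comp (H K L : hilbertType R) (A P : K -> L) (B Q : H -> K) (e e' M N : R) :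
  linear A -> 0 <= M -> 0 <= e ->
  (forall x, nrm (A x) <= M * nrm x) -> (forall x, nrm (B x) <= N * nrm x) ->
  apx A P e -> apx B Q e' -> apx (A \o B) (P \o Q) (M * e' + e * (N + e')).
Proof.
move=> lA M0 e0 hA hB h h' x /=.
apply: le_trans (nrm_dist _ (A (Q x)) _) _; rewrite mulrDl lerD//.
  by rewrite -(linPB lA); apply: le_trans (hA _) _; rewrite -mulrA ler_wpM2l.
apply: le_trans (h _) _; rewrite -mulrA ler_wpM2l//.
exact: (apx_bound h').
Qed.

Lemma op_limit (H K : hilbertType R) (A : nat -> H -> K) :
  (forall n, bop (A n)) ->
  (forall e : R, 0 < e -> exists N, forall m n, (N <= m)%N -> (N <= n)%N -> apx (A m) (A n) e) ->
  exists2 B, bop B & forall e, 0 < e -> exists N, forall n, (N <= n)%N -> apx B (A n) e.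
Proof.
move=> bA cA.
have /choice[B hB] x : exists y, tends (fun n => A n x) y.
  apply: cauchys_tends => e e0; have n1 : 0 < nrm x + 1 by rewrite ltr_wpDl ?nrm_ge0.
  have [N hN] := cA _ (divr_gt0 e0 n1); exists N => m n Nm Nn.
  apply: le_trans (hN m n Nm Nn x) _.
  by rewrite mulrAC ler_pdivrMr// ler_wpM2l ?lerDl// ltW.
have BA (e : R) : 0 < e -> exists N, forall n, (N <= n)%N -> apx B (A n) e.
  move=> e0; have [N hN] := cA _ e0; exists N => n Nn x.
  apply/ler_addgt0Pl => d d0; have [N' hN'] := hB x _ d0.
  apply: le_trans (nrm_dist _ (A (maxn N N') x) _) _; rewrite lerD//.
    by rewrite nrmB hN'// leq_maxr.
  by apply: hN => //; exact: leq_maxl.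
exists B => //; split; last first.
  have [N hN] := BA _ ltr01; have [M M0 hM] := bop_bound (bA N).
  by exists (M + 1); apply: apx_bound hM; apply/apx_sym/hN.
move=> a x y; apply: tends_unique (hB _) _ => e e0.
have a1 : 0 < cabs a + 1 by rewrite ltr_wpDl ?cabs_ge0.
have [N hN] := hB x _ (divr_gt0 e0 (mulr_gt0 (ltr0Sn _ 1) a1)).
have [N' hN'] := hB y _ (divr_gt0 e0 (ltr0Sn _ 1)).
exists (maxn N N') => n; rewrite geq_max => /andP[n1 n2].
rewrite (bA n).1 opprD addrACA -scalerBr; apply: le_trans (nrmD _ _) _.
rewrite (splitr e) lerD ?hN'// nrmZ.
have := hN n n1; rewrite ler_pdivlMr ?mulr_gt0// ler_pdivlMr//.
by have := nrm_ge0 (A n x - B x); have := cabs_ge0 a; nra.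
Qed.

End Approx.

Section Polynomials.
Context {R : realType} {d : nat}.
Local Notation C := R[i].
Local Notation letter := ('I_d * bool)%type.
Local Notation word := (seq letter).
Local Notation poly := (seq (C * word)).

(* The letter [(i, b)] stands for [u_i] if [b = false] and for [u_i^*] if [b = true]. *)
Definition flip (l : letter) : letter := (l.1, ~~ l.2).
Definition wadj (w : word) : word := rev (map flip w).
Definition padj (p : poly) : poly := [seq (q.1^*%C, wadj q.2) | q <- p].
Definition pmul (p q : poly) : poly := [seq (a.1 * b.1, a.2 ++ b.2) | a <- p, b <- q].

Section Eval.
Context {H : hilbertType R} (u : 'I_d -> H -> H).

Definition ltr (l : letter) : H -> H := if l.2 then adj (u l.1) else u l.1.
Definition wev (w : word) (x : H) : H := foldr ltr x w.
Definition pev (p : poly) (x : H) : H := \sum_(q <- p) q.1 *: wev q.2 x.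

Lemma wev_cat w w' x : wev (w ++ w') x = wev w (wev w' x).
Proof. exact: foldr_cat. Qed.

Lemma pev_nil : pev [::] = 0.
Proof. by apply/funext => x; rewrite /pev big_nil. Qed.

Lemma pev_cons q p : pev (q :: p) = q.1 *: wev q.2 + pev p.
Proof. by apply/funext => x; rewrite /pev big_cons. Qed.

Lemma pev1 w : pev [:: (1, w)] = wev w.
Proof. by rewrite pev_cons pev_nil addr0 scale1r. Qed.

Lemma pev_cat p q : pev (p ++ q) = pev p + pev q.
Proof. by apply/funext => x; rewrite /pev big_cat. Qed.

Lemma pev_scl (a : C) p : pev (scl a p) = a *: pev p.
Proof.
apply/funext => x; rewrite /pev big_map fctE scaler_sumr.
by apply: eq_bigr => q _; rewrite scalerA.
Qed.

Hypothesis bu : forall i, bop (u i).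

Lemma ltr_bop l : bop (ltr l).
Proof. by rewrite /ltr; case: ifP => _ //; exact: bop_adj. Qed.

Lemma wev_bop w : bop (wev w).
Proof.
elim: w => [|l w IH]; first exact: bop_id.
exact: (bop_comp (ltr_bop l) IH).
Qed.

Lemma pev_bop p : bop (pev p).
Proof.
elim: p => [|q p IH]; first by rewrite pev_nil; exact: bop0.
by rewrite pev_cons; apply: bopD => //; apply: bopZ; exact: wev_bop.
Qed.

Lemma pev_mul p q : pev (pmul p q) = pev p \o pev q.
Proof.
apply/funext => x; rewrite /= /pmul /pev big_allpairs_dep /=.
apply: eq_bigr => a _; rewrite linP_sum; last by have [] := wev_bop a.2.
rewrite scaler_sumr; apply: eq_bigr => b _.
by rewrite wev_cat (linPZ (wev_bop a.2).1) scalerA.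
Qed.

Lemma ltr_adj l : adj2 (ltr l) (ltr (flip l)).
Proof.
by case: l => i [] /=; rewrite /ltr /=; [apply: adj2_sym|]; exact: adjP.
Qed.

Lemma wev_adj w : adj2 (wev w) (wev (wadj w)).
Proof.
elim: w => [//|l w IH] x y; rewrite /wadj /= rev_cons -cats1 wev_cat -IH /=.
exact: ltr_adj.
Qed.

Lemma pev_adj p : adj2 (pev p) (pev (padj p)).
Proof.
apply: adj2_of_hdot => x y; rewrite /pev hdot_suml hdot_sumr big_map.
apply: eq_bigr => q _; rewrite hdotZl hdotZr conjcK.
by rewrite (adj2_hdot _ _ (wev_bop _).1 (wev_adj _)).
Qed.

(** A concrete model of the generated C*-algebra, in which claims reduce to polynomials; the two
    agree by [cstar_genE]. *)
Definition pclos (A : H -> H) : Prop :=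
  bop A /\ forall e : R, 0 < e -> exists p, apx A (pev p) e.

Lemma pclos_pev p : pclos (pev p).
Proof.
split=> [|e e0]; first exact: pev_bop.
by exists p; apply: apx_le (apx_refl _); exact: ltW.
Qed.

Lemma pclosD A B : pclos A -> pclos B -> pclos (A + B).
Proof.
move=> [bA hA] [bB hB]; split=> [|e e0]; first exact: bopD.
have e2 : 0 < e / 2 by rewrite divr_gt0.
have [p hp] := hA _ e2; have [q hq] := hB _ e2; exists (p ++ q).
by rewrite pev_cat (splitr e); exact: apxD.
Qed.

Lemma pclosZ a A : pclos A -> pclos (a *: A).
Proof.
move=> [bA hA]; split=> [|e e0]; first exact: bopZ.
have a1 : 0 < cabs a + 1 by rewrite ltr_wpDl ?cabs_ge0.
have [p hp] := hA _ (divr_gt0 e0 a1); exists (scl a p); rewrite pev_scl.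
apply: apx_le (apxZ a hp).
by rewrite mulrCA ger_pMr// ler_pdivrMr// mul1r lerDl.
Qed.

Lemma comp_eps (M N e : R) : 0 <= M -> 0 <= N -> 0 < e ->
  exists2 e', 0 < e' & M * e' + e' * (N + e') <= e.
Proof.
move=> M0 N0 e0; have K0 : 0 < M + N + 1 by rewrite ltr_wpDl ?addr_ge0.
have d0 : 0 < Num.min 1 (e / (M + N + 1)) by rewrite lt_min ltr01 divr_gt0.
exists (Num.min 1 (e / (M + N + 1))) => //; set t := Num.min _ _ in d0 *.
have t1 : t <= 1 by rewrite /t ge_min lexx.
have tK : t * (M + N + 1) <= e by rewrite -ler_pdivlMr// /t ge_min lexx orbT.
by move: t d0 t1 tK => t *; nra.
Qed.

Lemma pclos_comp A B : pclos A -> pclos B -> pclos (A \o B).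
Proof.
move=> [bA hA] [bB hB]; split=> [|e e0]; first exact: bop_comp.
have [M M0 hM] := bop_bound bA; have [N N0 hN] := bop_bound bB.
have [t t0 ht] := comp_eps (ltW M0) (ltW N0) e0.
have [p hp] := hA _ t0; have [q hq] := hB _ t0; exists (pmul p q).
rewrite pev_mul; apply: apx_le ht _.
by apply: apx_comp => //; [exact: bA.1|exact: ltW|exact: ltW].
Qed.

Lemma pclos_adj A B : pclos A -> adj2 A B -> pclos B.
Proof.
move=> [bA hA] AB; split=> [|e e0]; first exact: adj2_bop AB.
have [p hp] := hA _ e0; exists (padj p).
by apply: apx_adj hp => //; [exact: ltW|exact: pev_adj].
Qed.

Lemma pclos_lim A :
  bop A -> (forall e : R, 0 < e -> exists2 B, pclos B & apx A B e) -> pclos A.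
Proof.
move=> bA h; split=> // e e0; have e2 : 0 < e / 2 by rewrite divr_gt0.
have [B [_ hB] AB] := h _ e2; have [p hp] := hB _ e2.
by exists p; rewrite (splitr e); exact: apx_trans hp.
Qed.

Lemma pclos_id : pclos id.
Proof. by have := pclos_pev [:: (1, [::])]; rewrite pev1. Qed.

Lemma pclos_cstar : cstar_subalgebra pclos.
Proof.
split.
- by move=> A [bA _]; apply/bounded_opE.
- by split; [have := pclos_pev [::]; rewrite pev_nil|exact: pclosD].
- by split; [exact: pclosZ|exact: pclos_comp].
- move=> A B pA bB AB; apply: (pclos_adj pA).
  exact: (adj2_is_adjoint _ pA.1.1).2.
- move=> A /bounded_opE bA h; apply: pclos_lim => // e e0.
  have [B pB hB] := h _ e0; exists B => // x.
  apply: le_trans (opnorm_bound x (bopB bA pB.1)) _.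
  by rewrite ler_wpM2r ?nrm_ge0// ltW.
Qed.

Lemma pclos_letter i : pclos (u i).
Proof. by have := pclos_pev [:: (1, [:: (i, false)])]; rewrite pev1. Qed.

Lemma opnorm_apx (A B : H -> H) e : 0 <= e -> apx A B e -> opnorm (A - B) <= e.
Proof. by move=> e0 h; exact: opnorm_le. Qed.

Hypothesis uid : exists l, adj (u l) \o u l = id.

(** The empty word evaluates to [id], which a C*-subalgebra need not contain; [uid] exhibits it as a
    product of a generator and its adjoint. *)
Lemma cstar_genE : cstar_gen u = pclos.
Proof.
apply/seteqP; split=> [A hA|A [bA hA] S cS uS].
  by apply: hA; [exact: pclos_cstar|exact: pclos_letter].
have [S1 [S0 SD] [SZ SM] Sadj Scl] := cS.
have Sl l : S (ltr l).
  case: l => i []; rewrite /ltr /=; last exact: uS.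
  apply: Sadj (uS i) _ _; first by apply/bounded_opE; exact: bop_adj.
  by apply/adj2_is_adjoint; [exact: (bu i).1|exact: adjP].
have Sid : S id by have [i <-] := uid; apply: SM; [exact: (Sl (i, true))|exact: uS].
have Sw w : S (wev w) by elim: w => [//|l w IH]; exact: (SM _ _ (Sl l) IH).
have Sp p : S (pev p).
  elim: p => [|q p IH]; first by rewrite pev_nil.
  by rewrite pev_cons; apply: SD => //; exact: SZ.
apply: Scl => [|e e0]; first exact/bounded_opE.
have e2 : 0 < e / 2 by rewrite divr_gt0.
have [p hp] := hA _ e2; exists (pev p) => //.
apply: le_lt_trans (opnorm_apx (ltW e2) hp) _.
by rewrite gtr_pMr// invf_lt1// ltr1n.
Qed.

End Eval.
End Polynomials.

(** * Operator algebras and inverses by Neumann series *)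

Section StarHom.
Context {R : realType}.
Local Notation C := R[i].

Definition op_algebra {H : hilbertType R} (S : set (H -> H)) : Prop :=
  [/\ (forall A, S A -> bop A) /\ S id,
      (forall A B, S A -> S B -> S (A + B)) /\ (forall (a : C) A, S A -> S (a *: A)),
      forall A B, S A -> S B -> S (A \o B),
      forall A B, S A -> adj2 A B -> S B &
      forall A, bop A -> (forall e : R, 0 < e -> exists2 B, S B & apx A B e) -> S A].

(** Each [pi A] is bounded, but no continuity of [pi] itself is assumed; [sth_contr] derives it. *)
Definition star_hom {H K : hilbertType R} (S : set (H -> H)) (pi : (H -> H) -> K -> K) : Prop :=
  [/\ (forall A, S A -> bop (pi A)) /\ pi id = id,
      forall A B, S A -> S B -> pi (A + B) = pi A + pi B,
      forall (a : C) A, S A -> pi (a *: A) = a *: pi A,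
      forall A B, S A -> S B -> pi (A \o B) = pi A \o pi B &
      forall A B, S A -> S B -> adj2 A B -> adj2 (pi A) (pi B)].

Lemma expr_small (r e : R) : 0 <= r -> r < 1 -> 0 < e ->
  exists N, forall n, (N <= n)%N -> r ^+ n <= e.
Proof.
move=> r0 r1 e0.
have h : (r ^+ n) @[n --> \oo] --> (0 : R) by apply: cvg_expr; rewrite ger0_norm.
have [N _ hN] := (cvgrPdist_lt _ _).1 h _ e0.
exists N => n Nn; have := hN n Nn => /=.
by rewrite sub0r normrN ger0_norm ?exprn_ge0// => /ltW.
Qed.

(** For selfadjoint [T] the numerical radius bounds the norm: polarize [rdot (T x) y] with [y]
    parallel to [T x] and as long as [x]. *)
Lemma selfadj_le (H : hilbertType R) (T : H -> H) (r : R) :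
  linear T -> adj2 T T -> 0 <= r -> (forall x, `|rdot (T x) x| <= r * nrm x ^+ 2) ->
  forall x, nrm (T x) <= r * nrm x.
Proof.
move=> lT aT r0 hr x.
have [x0|x0] := eqVneq (nrm (T x)) 0; first by rewrite x0 mulr_ge0 ?nrm_ge0.
have n0 : 0 < nrm (T x) by rewrite lt_neqAle eq_sym x0 nrm_ge0.
have [->|xn] := eqVneq x 0; first by rewrite (linP0 lT) nrm0 mulr0.
have nx : 0 < nrm x by rewrite nrm_gt0.
pose y := (nrm x / nrm (T x))%:C *: T x.
have ny : nrm y = nrm x.
  by rewrite /y nrmZr ger0_norm ?divr_ge0 ?nrm_ge0// divfK.
have dy : rdot (T x) y = nrm x * nrm (T x).
  by rewrite /y rdotZr rdotxx expr2 mulrA divfK.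
have pol : 4 * rdot (T x) y = rdot (T (x + y)) (x + y) - rdot (T (x - y)) (x - y).
  rewrite (linPD lT) (linPB lT) !(rdotDl, rdotDr, rdotNl, rdotNr).
  by rewrite (aT y x) (rdotC y); ring.
have := hr (x + y); have := hr (x - y); rewrite nrm_sqB nrm_sqD ny.
rewrite !ler_norml => /andP[h1 _] /andP[_ h2].
have h3 : 4 * (nrm x * nrm (T x)) <= 4 * (r * nrm x ^+ 2) by rewrite -dy pol; lra.
rewrite -(ler_pM2l nx); lra.
Qed.

Section OpAlgebra.
Context {H : hilbertType R} (S : set (H -> H)).
Hypothesis hS : op_algebra S.

Lemma opa_bop A : S A -> bop A. Proof. by case: hS => -[+ _] _ _ _ _; exact. Qed.
Lemma opa_id : S id. Proof. by case: hS => -[]. Qed.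
Lemma opaD A B : S A -> S B -> S (A + B). Proof. by case: hS => _ [+ _] _ _ _; exact. Qed.
Lemma opaZ (a : C) A : S A -> S (a *: A). Proof. by case: hS => _ [_ +] _ _ _; exact. Qed.
Lemma opaM A B : S A -> S B -> S (A \o B). Proof. by case: hS => _ _ + _ _; exact. Qed.
Lemma opa_adj A B : S A -> adj2 A B -> S B. Proof. by case: hS => _ _ _ + _; exact. Qed.
Lemma opa_lim A : bop A -> (forall e : R, 0 < e -> exists2 B, S B & apx A B e) -> S A.
Proof. by case: hS => _ _ _ _; exact. Qed.
Lemma opaN A : S A -> S (- A).
Proof.
move=> SA; have -> : - A = (-1 : C) *: A by apply/funext => x; rewrite !fctE scaleN1r.
exact: opaZ.
Qed.
Lemma opaB A B : S A -> S B -> S (A - B).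
Proof. by move=> SA SB; apply/opaD/opaN. Qed.

(** [X n] is the sum of the first [n] powers of [T]; the limit stays in [S] by closedness. Both
    recursions are carried to the limit because a two-sided inverse of [id - T] is wanted. *)
Lemma neumann T (r : R) : S T -> 0 <= r -> r < 1 ->
  (forall x, nrm (T x) <= r * nrm x) ->
  exists2 X, S X & (forall x, X x = x + T (X x)) /\ (forall x, X x = x + X (T x)).
Proof.
move=> ST r0 r1 hT; have bT := opa_bop ST.
pose X := fix X n : H -> H := if n is n'.+1 then id + (T \o X n') else 0.
have SX n : S (X n).
  elim: n => [|n IH]; last by apply: opaD; [exact: opa_id|exact: opaM].
  by have -> : X 0 = id - id by [rewrite subrr]; apply: opaB; exact: opa_id.
have XS n x : X n.+1 x = x + T (X n x) by [].
have X0 x : X 0 x = 0 by [].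
have XC n x : X n.+1 x = x + X n (T x).
  elim: n x => [|n IH] x; first by rewrite XS !X0 (linP0 bT.1).
  by rewrite XS IH (linPD bT.1) XS.
have step n : apx (X n.+1) (X n) (r ^+ n).
  elim: n => [|n IH] x; first by rewrite XS !X0 (linP0 bT.1) subr0 addr0 mul1r.
  rewrite [X n.+2 x]XS [X n.+1 x in leLHS]XS opprD addrACA subrr add0r -(linPB bT.1).
  by rewrite exprS -mulrA; apply: le_trans (hT _) _; rewrite ler_wpM2l//; exact: IH.
have r1' : 0 < 1 - r by rewrite subr_gt0.
have far m n : apx (X (n + m)%N) (X n) ((r ^+ n - r ^+ (n + m)%N) / (1 - r)).
  elim: m => [|m IH]; first by rewrite addn0 subrr mul0r; exact: apx_refl.
  rewrite addnS; apply: apx_le (apx_trans (step _) IH).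
  rewrite -[X in X + _](mulfK (lt0r_neq0 r1')) -mulrDl ler_wpM2r ?invr_ge0 ?(ltW r1')//.
  by rewrite exprS; move: (r ^+ n) (r ^+ (n + m)%N) => a b; lra.
have [e0|Y bY hY] := op_limit (fun n => opa_bop (SX n)).
  move=> e1; have [N hN] := expr_small r0 r1 (mulr_gt0 e1 r1').
  have aux m n : (N <= n)%N -> (n <= m)%N -> apx (X m) (X n) e0.
    move=> Nn nm; rewrite -(subnKC nm); apply: apx_le (far _ _).
    rewrite ler_pdivrMr//; have := hN n Nn; have := exprn_ge0 (n + (m - n))%N r0.
    by move: (r ^+ n) (r ^+ (n + _)%N) => a b; lra.
  exists N => m n Nm Nn; have [mn|/ltnW mn] := leqP n m; first exact: aux.
  by apply: apx_sym; exact: aux.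
exists Y.
  apply: opa_lim => // e /hY[N hN]; exists (X N) => //; exact: hN.
have main (F : (H -> H) -> H -> H) :
    (forall n x, X n.+1 x = x + F (X n) x) ->
    (forall A B e, 0 <= e -> apx A B e -> apx (F A) (F B) (r * e)) ->
    Y = id + F Y.
  move=> hF aF; apply: apx_eq => e e0; have e2 : 0 < e / 2 by rewrite divr_gt0.
  have [N hN] := hY _ e2; rewrite (splitr e).
  apply: apx_trans (hN N.+1 (leqnSn _)) _.
  have -> : X N.+1 = id + F (X N) by apply/funext => x; rewrite hF.
  rewrite -[e / 2]add0r; apply: apxD; first exact: apx_refl.
  apply: (apx_le _ (aF _ _ _ (ltW e2) (apx_sym (hN N (leqnn _))))).
  by rewrite ger_pMl// ltW.
split=> x.
- suff h : Y = id + (T \o Y) by rewrite {1}h.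
  apply: (main (fun A => T \o A)) => // A B e e0 h z /=.
  rewrite -(linPB bT.1); apply: le_trans (hT _) _.
  by rewrite -mulrA ler_wpM2l//; exact: h.
- suff h : Y = id + (Y \o T) by rewrite {1}h.
  apply: (main (fun A => A \o T)) => // A B e e0 h z /=.
  by apply: le_trans (h _) _; rewrite -mulrA mulrCA ler_wpM2l.
Qed.

(** For [M] above both a bound of [b] and [delta], the form of [T = id - b / M] lies between 0 and
    [1 - delta / M], so [T] is a strict contraction and the Neumann series inverts [b / M] inside
    [S]. *)
Lemma coercive_inv b (delta : R) : S b -> adj2 b b -> 0 < delta ->
  (forall x, delta * nrm x ^+ 2 <= rdot (b x) x) ->
  exists g, [/\ S g, forall x, b (g x) = x & forall x, g (b x) = x].
Proof.
move=> Sb ab d0 hb; have bb := opa_bop Sb; have [M0 M00 hM] := bop_bound bb.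
pose M := M0 + delta; have Mp : 0 < M by rewrite /M addr_gt0.
pose T := id - M^-1%:C *: b.
have ST : S T by apply: opaB; [exact: opa_id|exact: opaZ].
have TE x : T x = x - M^-1%:C *: b x by [].
have bM x : rdot (b x) x <= M * nrm x ^+ 2.
  apply: le_trans (rdot_le _ _) _; rewrite expr2 mulrA ler_wpM2r ?nrm_ge0//.
  apply: le_trans (hM x) _; rewrite ler_wpM2r ?nrm_ge0//.
  by rewrite lerDl ltW.
have r0 : 0 <= 1 - delta / M by rewrite subr_ge0 ler_pdivrMr// mul1r lerDr ltW.
have r1 : 1 - delta / M < 1 by rewrite ltrBlDr ltrDl divr_gt0.
have aT : adj2 T T by move=> x y; rewrite !TE rdotBl rdotBr rdotZl rdotZr ab.
have Mi : 0 < M^-1 by rewrite invr_gt0.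
have nT : forall x, nrm (T x) <= (1 - delta / M) * nrm x.
  apply: selfadj_le => //; first exact: (opa_bop ST).1.
  move=> x; rewrite TE rdotBl rdotZl rdotxx.
  have h1 := ler_wpM2l (ltW Mi) (hb x); have h2 := ler_wpM2l (ltW Mi) (bM x).
  rewrite mulrA mulVf ?gt_eqF// mul1r in h2.
  have h3 : 0 <= delta / M * nrm x ^+ 2 by rewrite mulr_ge0 ?sqr_ge0// divr_ge0 ?ltW.
  by rewrite ler_norml; apply/andP; split; lra.
have [X SX [X1 X2]] := neumann ST r0 r1 nT.
have lb := bb.1; have lX := (opa_bop SX).1.
exists (M^-1%:C *: X); split; first exact: opaZ.
- move=> x; rewrite fctE (linPZ lb); apply: (addIr (T (X x))).
  by rewrite -X1 TE addrCA subrr addr0.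
- move=> x; rewrite fctE -(linPZ lX); apply: (addIr (X (T x))).
  by rewrite -X2 TE (linPB lX) addrCA subrr addr0.
Qed.

End OpAlgebra.
End StarHom.

(** * Positivity, contractivity and complete positivity of homomorphisms *)

Section CompletePositivity.
Context {R : realType}.
Local Notation C := R[i].

(** Cauchy-Schwarz for the positive form of [T], applied to the pair [x], [T x]. It shows that [T x]
    is small wherever the form of [T] is. *)
Lemma psd_op_sqr (H : hilbertType R) (T : H -> H) (N : R) :
  linear T -> adj2 T T -> (forall x, 0 <= rdot (T x) x) -> 0 <= N ->
  (forall x, nrm (T x) <= N * nrm x) -> forall x, nrm (T x) ^+ 2 <= N * rdot (T x) x.
Proof.
move=> lT aT pT N0 hN x.
have cs : rdot (T x) (T x) ^+ 2 <= rdot (T x) x * rdot (T (T x)) (T x).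
  apply: psd_cs => a b.
  have := pT (a%:C *: x + b%:C *: T x).
  rewrite (linPD lT) !(linPZ lT) !(rdotDl, rdotDr, rdotZl, rdotZr).
  by rewrite (aT (T x) x); lra.
rewrite rdotxx in cs.
have h1 : rdot (T (T x)) (T x) <= N * nrm (T x) ^+ 2.
  by apply: le_trans (rdot_le _ _) _; rewrite expr2 mulrA ler_wpM2r ?nrm_ge0.
have [->|n0] := eqVneq (nrm (T x) ^+ 2) 0; first by rewrite mulr_ge0.
have np : 0 < nrm (T x) ^+ 2 by rewrite lt_neqAle eq_sym n0 sqr_ge0.
rewrite -(ler_pM2r np) -expr2; apply: le_trans cs _.
by rewrite [N * _]mulrC -mulrA ler_wpM2l.
Qed.

(* Completing the square in the first variable. *)
Lemma schur_form (H : hilbertType R) n (b : 'I_n.+1 -> 'I_n.+1 -> H -> H) (g : H -> H)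
    (y0 : H) (y : 'I_n -> H) :
  (forall i j, adj2 (b i j) (b j i)) -> linear (b ord0 ord0) -> linear g ->
  (forall x, b ord0 ord0 (g x) = x) ->
  let z i := if unlift ord0 i is Some j then y j else y0 in
  let w := \sum_j b ord0 (lift ord0 j) (y j) in
  let b' i j := b (lift ord0 i) (lift ord0 j) -
                (b (lift ord0 i) ord0 \o g \o b ord0 (lift ord0 j)) in
  \sum_i \sum_j rdot (b i j (z j)) (z i) =
  rdot (b ord0 ord0 (y0 + g w)) (y0 + g w) + \sum_i \sum_j rdot (b' i j (y j)) (y i).
Proof.
move=> ab lb lg bg z w b'.
have z0 : z ord0 = y0 by rewrite /z unlift_none.
have zl j : z (lift ord0 j) = y j by rewrite /z liftK.
have w_sum v : rdot w v = \sum_j rdot (b ord0 (lift ord0 j) (y j)) v.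
  by rewrite rdot_suml.
have -> : \sum_i \sum_j rdot (b i j (z j)) (z i) = rdot (b ord0 ord0 y0) y0 +
    rdot w y0 + (rdot y0 w + \sum_i \sum_j
      rdot (b (lift ord0 i) (lift ord0 j) (y j)) (y i)).
  rewrite big_ord_recl big_ord_recl !z0; congr (_ + _ + _).
    by rewrite w_sum; apply: eq_bigr => j _; rewrite zl.
  rewrite rdotC w_sum -big_split; apply: eq_bigr => i _ /=.
  rewrite big_ord_recl z0 zl ab rdotC; congr (_ + _).
  by apply: eq_bigr => j _; rewrite zl.
have -> : \sum_i \sum_j rdot (b' i j (y j)) (y i) =
    \sum_i \sum_j rdot (b (lift ord0 i) (lift ord0 j) (y j)) (y i) - rdot (g w) w.
  have -> : rdot (g w) w = \sum_i \sum_j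
      rdot (b (lift ord0 i) ord0 (g (b ord0 (lift ord0 j) (y j)))) (y i).
    rewrite rdotC w_sum; apply: eq_bigr => i _.
    rewrite rdotC /w linP_sum// rdot_suml; apply: eq_bigr => j _.
    by rewrite ab.
  rewrite -sumrB; apply: eq_bigr => i _; rewrite -sumrB; apply: eq_bigr => j _.
  by rewrite /b' -rdotBl.
have e : rdot (b ord0 ord0 y0) (g w) = rdot y0 w by rewrite ab bg.
rewrite (linPD lb) bg; move: (\sum_i _) => Q.
by rewrite !(rdotDl, rdotDr) e [rdot (g w) w]rdotC; ring.
Qed.

Section Pi.
Context {H K : hilbertType R} (S : set (H -> H)) (pi : (H -> H) -> K -> K).
Hypothesis hS : op_algebra S.
Hypothesis hpi : star_hom S pi.

Lemma sth_bop A : S A -> bop (pi A). Proof. by case: hpi => -[+ _] _ _ _ _; exact. Qed.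
Lemma sth_id : pi id = id. Proof. by case: hpi => -[]. Qed.
Lemma sthD A B : S A -> S B -> pi (A + B) = pi A + pi B.
Proof. by case: hpi => _ + _ _ _; exact. Qed.
Lemma sthZ (a : C) A : S A -> pi (a *: A) = a *: pi A.
Proof. by case: hpi => _ _ + _ _; exact. Qed.
Lemma sthM A B : S A -> S B -> pi (A \o B) = pi A \o pi B.
Proof. by case: hpi => _ _ _ + _; exact. Qed.
Lemma sth_adj A B : S A -> S B -> adj2 A B -> adj2 (pi A) (pi B).
Proof. by case: hpi => _ _ _ _; exact. Qed.
Lemma sthB A B : S A -> S B -> pi (A - B) = pi A - pi B.
Proof.
move=> SA SB.
have e (L : hilbertType R) (X : L -> L) : - X = (-1 : C) *: X.
  by apply/funext => x; rewrite !fctE scaleN1r.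
by rewrite (e H B) (e K (pi B)) sthD ?sthZ//; exact: (opaZ hS).
Qed.

(** If the form of [pi b] had negative infimum [- t] on unit vectors, then [b + t] would be
    coercive, hence invertible inside [S], and [pi] would carry its inverse to one of
    [T = pi b + t]. But [T] is positive with infimum zero, so by [psd_op_sqr] it nearly annihilates
    some unit vectors, which a bounded left inverse forbids. *)
Lemma sth_pos b : S b -> adj2 b b -> (forall x, 0 <= rdot (b x) x) ->
  forall x, 0 <= rdot (pi b x) x.
Proof.
move=> Sb ab pb; have bB := sth_bop Sb; set B := pi b in bB *.
have aB : adj2 B B by exact: sth_adj.
have lB := bB.1; have [M M0 hM] := bop_bound bB.
have homog c : (forall x, nrm x = 1 -> c <= rdot (B x) x) ->
    forall x, c * nrm x ^+ 2 <= rdot (B x) x.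
  move=> h x; have [->|x0] := eqVneq x 0.
    by rewrite nrm0 expr0n mulr0 rdot0r.
  have nx : 0 < nrm x by rewrite nrm_gt0.
  have := h ((nrm x)^-1%:C *: x); rewrite nrmZr ger0_norm ?invr_ge0 ?nrm_ge0//.
  rewrite mulVf ?gt_eqF// (linPZ lB) rdotZl rdotZr mulrA -invfM -expr2 => /(_ erefl).
  by rewrite mulrC ler_pdivlMr ?exprn_gt0.
pose E := [set rdot (B x) x | x in [set x | nrm x = 1]].
have lbE : lbound E (- M).
  move=> _ [x /= x1 <-]; have := rdot_abs (B x) x; rewrite ler_norml => /andP[h _].
  apply: le_trans h; rewrite lerN2 x1 mulr1; have := hM x.
  by rewrite x1 mulr1.
(* If [K] has no unit vector it is zero and the claim is trivial; the infimum below needs a nonempty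
   set. *)
have [[x0 x01]|noE] := pselect (exists x : K, nrm x = 1); last first.
  move=> x; rewrite -[leLHS](mul0r (nrm x ^+ 2)); apply: homog => y y1.
  by exfalso; apply: noE; exists y.
have iE : has_inf E by split; [exists (rdot (B x0) x0), x0|exists (- M)].
have [m0|m0] := leP 0 (inf E).
  move=> x; rewrite -[leLHS](mul0r (nrm x ^+ 2)); apply: homog => y y1.
  by apply: le_trans m0 _; apply: ge_inf; [exact: iE.2|exists y].
exfalso; pose t := - inf E; have t0 : 0 < t by rewrite oppr_gt0.
pose T : K -> K := B + t%:C *: id.
have TE x : T x = B x + t%:C *: x by [].
have bT : bop T by apply: bopD => //; apply: bopZ; exact: bop_id.
have aT : adj2 T T by move=> x y; rewrite !TE rdotDl rdotDr rdotZl rdotZr aB.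
have pT x : 0 <= rdot (T x) x.
  rewrite TE rdotDl rdotZl rdotxx -lerBlDr sub0r -mulNr opprK.
  apply: homog => y y1; apply: ge_inf; [exact: iE.2|by exists y].
have Sbt : S (b + t%:C *: id) by apply: (opaD hS) => //; apply: (opaZ hS) => //; exact: (opa_id hS).
have abt : adj2 (b + t%:C *: id) (b + t%:C *: id).
  by move=> x y; rewrite !fctE rdotDl rdotDr rdotZl rdotZr ab.
have hbt x : t * nrm x ^+ 2 <= rdot ((b + t%:C *: id) x) x.
  by rewrite !fctE rdotDl rdotZl rdotxx lerDr.
have [g [Sg _ gb]] := coercive_inv hS Sbt abt t0 hbt.
have gT x : pi g (T x) = x.
  have <- : pi (b + t%:C *: id) = T.
    rewrite sthD ?sthZ ?sth_id//; [exact: (opa_id hS)|exact: (opaZ hS _ (opa_id hS))].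
  have := sthM Sg Sbt => /(congr1 (@^~ x)) /= <-.
  by rewrite (_ : g \o _ = id) ?sth_id//; apply/funext => y; exact: gb.
have [c c0 hc] := bop_bound (sth_bop Sg); have [N N0 hN] := bop_bound bT.
have sq := psd_op_sqr bT.1 aT pT (ltW N0) hN.
have cN : 0 < c ^+ 2 * N by rewrite mulr_gt0 ?exprn_gt0.
(* The least value that the left inverse allows for the form of [T] on unit vectors, from
   [1 <= c |T x|] and [|T x|^2 <= N rdot (T x) x]. *)
have d0 : 0 < (c ^+ 2 * N)^-1 by rewrite invr_gt0.
have [_ [x x1 <-] hx] := inf_adherent d0 iE.
have h1 : 1 <= c * nrm (T x) by have := hc (T x); rewrite gT x1.
have h2 : 1 <= c ^+ 2 * (N * rdot (T x) x).
  apply: le_trans (ler_wpM2l (sqr_ge0 c) (sq x)).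
  by rewrite -exprMn exprn_ege1.
rewrite mulrA -ler_pdivrMl// mulr1 in h2.
by move: h2; rewrite TE rdotDl rdotZl rdotxx x1 expr1n mulr1 /t; lra.
Qed.

(** Apply positivity to [M^2 - A^* A], which expresses the bound on [A] within the algebra. *)
Lemma sth_contr A (M : R) : S A -> 0 <= M -> (forall x, nrm (A x) <= M * nrm x) ->
  forall x, nrm (pi A x) <= M * nrm x.
Proof.
move=> SA M0 hM; have bA := opa_bop hS SA.
have SA' : S (adj A) by apply: (opa_adj hS SA); exact: adjP.
have SAA : S (adj A \o A) by exact: (opaM hS).
have SI : S ((M ^+ 2)%:C *: id) by apply: (opaZ hS) => //; exact: (opa_id hS).
pose b : H -> H := (M ^+ 2)%:C *: id - (adj A \o A).
have bE x : b x = (M ^+ 2)%:C *: x - adj A (A x) by [].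
have Sb : S b by exact: (opaB hS).
have aA x y : rdot (adj A (A x)) y = rdot (A x) (A y).
  by rewrite rdotC -(adjP bA) rdotC.
have ab : adj2 b b.
  move=> x y; rewrite !bE rdotBl rdotBr rdotZl rdotZr aA.
  by rewrite -(adjP bA).
have pb x : 0 <= rdot (b x) x.
  rewrite bE rdotBl rdotZl aA !rdotxx subr_ge0 -exprMn ler_pXn2r ?nnegrE ?nrm_ge0//.
  by rewrite mulr_ge0 ?nrm_ge0.
move=> x; have := sth_pos Sb ab pb x.
have -> : pi b = (M ^+ 2)%:C *: id - (pi (adj A) \o pi A).
  by rewrite (sthB SI SAA) (sthZ _ (opa_id hS)) sth_id (sthM SA' SA).
rewrite !fctE /= rdotBl rdotZl rdotxx rdotC -(sth_adj SA SA' (adjP bA)) rdotxx.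
by rewrite subr_ge0 -exprMn ler_pXn2r ?nnegrE ?nrm_ge0// mulr_ge0 ?nrm_ge0.
Qed.

(** Induction by Schur complements. The uniform [delta] makes the corner invertible in [S], and it
    passes to the complement [b']: choosing the first vector as [- g w] annihilates the completed
    square and only drops a nonnegative term on the left. *)
Lemma sth_cp n (b : 'I_n -> 'I_n -> H -> H) (delta : R) :
  (forall i j, S (b i j)) -> (forall i j, adj2 (b i j) (b j i)) -> 0 < delta ->
  (forall y : 'I_n -> H, delta * \sum_i nrm (y i) ^+ 2 <=
     \sum_i \sum_j rdot (b i j (y j)) (y i)) ->
  forall x : 'I_n -> K, 0 <= \sum_i \sum_j rdot (pi (b i j) (x j)) (x i).
Proof.
elim: n b => [|n IH] b Sb ab d0 hb x; first by rewrite big_ord0.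
have lb i j : linear (b i j) := (opa_bop hS (Sb i j)).1.
have b00 v : delta * nrm v ^+ 2 <= rdot (b ord0 ord0 v) v.
  have := hb (fun i => if i == ord0 then v else 0).
  rewrite !big_ord_recl eqxx !big1 ?addr0//.
  - by move=> i _; rewrite big1// => j _; rewrite rdot0r.
  - by move=> i _; rewrite (linP0 (lb _ _)) rdot0l.
  - by move=> i _; rewrite nrm0 expr0n.
have [g [Sg bg gb]] := coercive_inv hS (Sb ord0 ord0) (ab _ _) d0 b00.
have ag : adj2 g g by move=> v v'; rewrite -[v' in LHS]bg -ab bg.
have bS := opa_bop hS Sg; have lg := bS.1.
pose b' i j := b (lift ord0 i) (lift ord0 j) -
               (b (lift ord0 i) ord0 \o g \o b ord0 (lift ord0 j)).
have Sc i j : S (b (lift ord0 i) ord0 \o g \o b ord0 (lift ord0 j)).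
  by apply: (opaM hS) => //; apply: (opaM hS).
have Sb' i j : S (b' i j) by apply: (opaB hS).
have ab' i j : adj2 (b' i j) (b' j i).
  by move=> v v'; rewrite /b' !fctE /= rdotBl rdotBr !ab ag ab.
have hb' (y : 'I_n -> H) : delta * \sum_i nrm (y i) ^+ 2 <=
    \sum_i \sum_j rdot (b' i j (y j)) (y i).
  pose w := \sum_j b ord0 (lift ord0 j) (y j).
  have := schur_form (- g w) y ab (lb _ _) lg bg.
  rewrite /= -/w addNr rdot0r add0r => <-.
  apply: le_trans (hb _); rewrite ler_wpM2l ?(ltW d0)// big_ord_recl.
  rewrite ler_wpDl ?sqr_ge0//; apply: ler_sum => i _.
  by rewrite liftK.
have lB i j : linear (pi (b i j)) := (sth_bop (Sb i j)).1.
have aB i j : adj2 (pi (b i j)) (pi (b j i)) by exact: sth_adj.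
have BG v : pi (b ord0 ord0) (pi g v) = v.
  have := sthM (Sb ord0 ord0) Sg => /(congr1 (@^~ v)) /= <-.
  by rewrite (_ : _ \o g = id) ?sth_id//; apply/funext => y; exact: bg.
have e := schur_form (x ord0) (fun i => x (lift ord0 i)) aB (lB _ _) (sth_bop Sg).1 BG.
pose z i := if unlift ord0 i is Some j then x (lift ord0 j) else x ord0.
have zE i : z i = x i by rewrite /z; case: unliftP => [j|] ->.
have -> : \sum_i \sum_j rdot (pi (b i j) (x j)) (x i) =
    \sum_i \sum_j rdot (pi (b i j) (z j)) (z i).
  by apply: eq_bigr => i _; apply: eq_bigr => j _; rewrite !zE.
rewrite e.
apply: addr_ge0.
  apply: sth_pos => // v; apply: le_trans (b00 v).
  by rewrite mulr_ge0 ?sqr_ge0// ltW.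
have := IH b' Sb' ab' d0 hb' (fun i => x (lift ord0 i)).
congr (0 <= _); apply: eq_bigr => i _; apply: eq_bigr => j _.
rewrite /b' (sthB (Sb _ _) (Sc _ _)) (sthM (opaM hS (Sb _ _) Sg) (Sb _ _)).
by rewrite (sthM (Sb _ _) Sg).
Qed.

End Pi.
End CompletePositivity.

(** * Polynomial norms decide equivalence *)

Section NormCriterion.
Context {R : realType} {d : nat}.
Local Notation C := R[i].
Local Notation letter := ('I_d * bool)%type.
Local Notation word := (seq letter).
Local Notation poly := (seq (C * word)).

Lemma unitary_opE (H : hilbertType R) (A : H -> H) :
  unitary_op A <-> [/\ bop A, adj A \o A = id & A \o adj A = id].
Proof.
split=> [[/bounded_opE bA [B [/bounded_opE bB AB h1 h2]]]|[bA h1 h2]].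
  have -> : adj A = B by apply: adj_eq => //; apply/(adj2_is_adjoint _ bA.1).
  by [].
split; first exact/bounded_opE.
exists (adj A); split=> //; first by apply/bounded_opE; exact: bop_adj.
by apply/(adj2_is_adjoint _ bA.1); exact: adjP.
Qed.

Lemma unitary_bop (H : hilbertType R) (A : H -> H) : unitary_op A -> bop A.
Proof. by move=> /unitary_opE[]. Qed.

Lemma unitary_isom (H : hilbertType R) (A : H -> H) : unitary_op A -> isom A.
Proof.
move=> /unitary_opE[bA h _]; split; first exact: bA.1.
move=> x; apply/eqP; rewrite -(@eqrXn2 _ 2) ?nrm_ge0//; apply/eqP.
rewrite -!rdotxx (adjP bA).
by have := congr1 (@^~ x) h => /= ->.
Qed.

Lemma isom_unitary (H : hilbertType R) (A B : H -> H) :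
  isom A -> isom B -> A \o B = id -> B \o A = id -> unitary_op A.
Proof.
move=> iA iB AB BA; have bA := isom_bop iA; apply/unitary_opE.
suff -> : adj A = B by [].
apply: adj_eq => // x y; rewrite -(isom_rdot (A x) y iB).
by have := congr1 (@^~ x) BA => /= ->.
Qed.

Definition norm_dom {H K : hilbertType R} (u : 'I_d -> H -> H) (v : 'I_d -> K -> K) : Prop :=
  forall (p : poly) (M : R), 0 <= M ->
    (forall x, nrm (pev v p x) <= M * nrm x) -> forall x, nrm (pev u p x) <= M * nrm x.

Lemma norm_dom_refl (H : hilbertType R) (u : 'I_d -> H -> H) : norm_dom u u.
Proof. by move=> p M _. Qed.

Lemma norm_dom_trans (H K L : hilbertType R) (u : 'I_d -> H -> H) (v : 'I_d -> K -> K)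
    (w : 'I_d -> L -> L) : norm_dom u v -> norm_dom v w -> norm_dom u w.
Proof. by move=> uv vw p M M0 h; apply: uv => //; exact: vw. Qed.

Lemma norm_dom_apx (H K : hilbertType R) (u : 'I_d -> H -> H) (v : 'I_d -> K -> K) p q e :
  norm_dom u v -> 0 <= e -> apx (pev v p) (pev v q) e -> apx (pev u p) (pev u q) e.
Proof.
move=> uv e0 h x.
have E (L : hilbertType R) (w : 'I_d -> L -> L) y :
    pev w p y - pev w q y = pev w (p ++ scl (-1) q) y.
  by rewrite pev_cat pev_scl !fctE scaleN1r.
by rewrite E; apply: uv => // y; rewrite -E.
Qed.

Section Graph.
Context {H K : hilbertType R} (u : 'I_d -> H -> H) (v : 'I_d -> K -> K).
Hypotheses (uu : forall i, unitary_op (u i)) (uv : forall i, unitary_op (v i)).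

Let bu i : bop (u i) := unitary_bop (uu i).
Let bv i : bop (v i) := unitary_bop (uv i).

(** Closure of the graph of [p(u) |-> p(v)]. As a relation it is symmetric in the two tuples, so
    injectivity and surjectivity of the isomorphism follow from its existence and uniqueness
    statements read backwards. *)
Definition rgraph (A : H -> H) (B : K -> K) : Prop :=
  [/\ bop A, bop B & forall e : R, 0 < e ->
    exists p, apx A (pev u p) e /\ apx B (pev v p) e].

Lemma rgraph_pev p : rgraph (pev u p) (pev v p).
Proof.
split=> [||e e0]; [exact: pev_bop|exact: pev_bop|exists p].
by split; apply: apx_le (apx_refl _); exact: ltW.
Qed.

Lemma rgraphD A A' B B' : rgraph A B -> rgraph A' B' -> rgraph (A + A') (B + B').
Proof.
move=> [bA bB h] [bA' bB' h']; split=> [||e e0]; [exact: bopD|exact: bopD|].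
have e2 : 0 < e / 2 by rewrite divr_gt0.
have [p [p1 p2]] := h _ e2; have [q [q1 q2]] := h' _ e2; exists (p ++ q).
by rewrite !pev_cat (splitr e); split; exact: apxD.
Qed.

Lemma rgraphZ a A B : rgraph A B -> rgraph (a *: A) (a *: B).
Proof.
move=> [bA bB h]; split=> [||e e0]; [exact: bopZ|exact: bopZ|].
have a1 : 0 < cabs a + 1 by rewrite ltr_wpDl ?cabs_ge0.
have [p [p1 p2]] := h _ (divr_gt0 e0 a1); exists (scl a p); rewrite !pev_scl.
have ae : cabs a * (e / (cabs a + 1)) <= e.
  by rewrite mulrCA ger_pMr// ler_pdivrMr// mul1r lerDl.
by split; apply: apx_le ae _; exact: apxZ.
Qed.

Lemma rgraphM A A' B B' : rgraph A B -> rgraph A' B' -> rgraph (A \o A') (B \o B').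
Proof.
move=> [bA bB h] [bA' bB' h']; split=> [||e e0]; [exact: bop_comp|exact: bop_comp|].
have [M M0 hM] := bop_bound bA; have [N N0 hN] := bop_bound bA'.
have [M' M0' hM'] := bop_bound bB; have [N' N0' hN'] := bop_bound bB'.
have [t t0 ht] := comp_eps (ltW M0) (ltW N0) e0.
have [t' t0' ht'] := comp_eps (ltW M0') (ltW N0') e0.
have m0 : 0 < Num.min t t' by rewrite lt_min t0.
have m1 : Num.min t t' <= t by rewrite ge_min lexx.
have m2 : Num.min t t' <= t' by rewrite ge_min lexx orbT.
have [p [p1 p2]] := h _ m0; have [q [q1 q2]] := h' _ m0; exists (pmul p q).
rewrite !pev_mul//; split.
  apply: apx_le ht _; apply: apx_comp => //; [exact: bA.1|exact: ltW|exact: ltW|..];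
  exact: apx_le m1 _.
apply: apx_le ht' _; apply: apx_comp => //; [exact: bB.1|exact: ltW|exact: ltW|..];
exact: apx_le m2 _.
Qed.

Lemma rgraph_adj A A' B B' : adj2 A A' -> adj2 B B' -> rgraph A B -> rgraph A' B'.
Proof.
move=> aA aB [bA bB h]; split=> [||e e0]; [exact: adj2_bop aA|exact: adj2_bop aB|].
have [p [p1 p2]] := h _ e0; exists (padj p).
split; [apply: apx_adj p1|apply: apx_adj p2] => //; try exact: ltW.
  exact: pev_adj.
exact: pev_adj.
Qed.

Lemma rgraph_ex A : norm_dom v u -> pclos u A -> exists B, rgraph A B.
Proof.
move=> vu [bA hA].
have /choice[p hp] n : exists p, apx A (pev u p) (n.+1%:R^-1) by apply: hA; rewrite invr_gt0.
have [e e0|B bB hB] := op_limit (fun n => pev_bop bv (p n)).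
  have [N hN] := invS_small (divr_gt0 e0 (ltr0Sn _ 1)); exists N => m n Nm Nn.
  apply: (norm_dom_apx vu (ltW e0)).
  rewrite (splitr e); apply: (@apx_trans _ _ _ _ A).
    by apply: apx_sym; apply: apx_le (hp m); exact: hN.
  by apply: apx_le (hp n); exact: hN.
exists B; split=> // e e0; have [N hN] := hB _ e0; have [N' hN'] := invS_small e0.
exists (p (maxn N N')); split; last by apply: hN; exact: leq_maxl.
by apply: apx_le (hp _); apply: hN'; exact: leq_maxr.
Qed.

Lemma rgraph_uniq A B B' : norm_dom v u -> rgraph A B -> rgraph A B' -> B = B'.
Proof.
move=> vu [_ _ h] [_ _ h']; apply: apx_eq => e e0.
have e4 : 0 < e / 4 by rewrite divr_gt0.
have [p [p1 p2]] := h _ e4; have [q [q1 q2]] := h' _ e4.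
have pq : apx (pev v p) (pev v q) (e / 4 + e / 4).
  apply: (norm_dom_apx vu); first by rewrite addr_ge0// (ltW e4).
  by apply: apx_trans q1; exact: apx_sym.
have -> : e = e / 4 + (e / 4 + e / 4) + e / 4 by field.
apply: apx_trans (apx_sym q2); exact: apx_trans pq.
Qed.

Lemma rgraph_closl A B : rgraph A B -> pclos u A.
Proof. by move=> [bA _ h]; split=> // e /h[p [p1 _]]; exists p. Qed.

End Graph.

Lemma rgraph_sym (H K : hilbertType R) (u : 'I_d -> H -> H) (v : 'I_d -> K -> K) A B :
  rgraph u v A B -> rgraph v u B A.
Proof. by move=> [bA bB h]; split=> // e /h[p [p1 p2]]; exists p. Qed.

Hypothesis d0 : (0 < d)%N.

Section Equiv.
Context {H K : hilbertType R} (u : 'I_d -> H -> H) (v : 'I_d -> K -> K).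
Hypotheses (uu : forall i, unitary_op (u i)) (uv : forall i, unitary_op (v i)).

Let bu i : bop (u i) := unitary_bop (uu i).
Let bv i : bop (v i) := unitary_bop (uv i).

Lemma unitary_cstar_gen (L : hilbertType R) (w : 'I_d -> L -> L) :
  (forall i, unitary_op (w i)) -> cstar_gen w = pclos w.
Proof.
move=> uw; apply: cstar_genE; first by move=> i; exact: unitary_bop.
by exists (Ordinal d0); have /unitary_opE[] := uw (Ordinal d0).
Qed.

Lemma norm_eq_equiv : norm_dom u v -> norm_dom v u -> tuple_equiv u v.
Proof.
move=> duv dvu.
pose pi A := xget 0 [set B | rgraph u v A B].
have piP A : pclos u A -> rgraph u v A (pi A).
  move=> /(rgraph_ex uv dvu)[B hB]; rewrite /pi.
  by case: xgetP => [B' -> //|/(_ B)].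
have pi_eq A B : rgraph u v A B -> pi A = B.
  by move=> h; apply: (rgraph_uniq dvu _ h); apply: piP; exact: rgraph_closl h.
exists pi; split; last first.
  move=> i; apply: pi_eq; have := rgraph_pev uu uv [:: (1, [:: (i, false)])].
  by rewrite !pev1.
rewrite (unitary_cstar_gen uu) (unitary_cstar_gen uv); split; first split.
- by move=> A SA; apply: rgraph_closl (rgraph_sym (piP _ SA)).
- move=> A A' /[!inE] SA SA' e.
  apply: (rgraph_uniq duv (rgraph_sym (piP _ SA))).
  by rewrite e; exact: rgraph_sym (piP _ SA').
- move=> B SB; have [A hA] := rgraph_ex uu duv SB.
  have h := rgraph_sym hA; exists A; first exact: rgraph_closl h.
  exact: pi_eq.
- by move=> A B SA SB; apply: pi_eq; exact: rgraphD (piP _ SA) (piP _ SB).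
- by move=> a A SA; apply: pi_eq; exact: rgraphZ (piP _ SA).
- by move=> A B SA SB; apply: pi_eq; exact: (rgraphM uu uv (piP _ SA) (piP _ SB)).
- move=> A B SA SB AB; have [bA bpA _] := piP _ SA.
  have aAB : adj2 A B by apply/(adj2_is_adjoint _ bA.1).
  apply/(adj2_is_adjoint _ bpA.1).
  suff -> : pi B = adj (pi A) by exact: adjP.
  by apply: pi_eq; exact: (rgraph_adj uu uv aAB (adjP bpA) (piP _ SA)).
Qed.

End Equiv.

Section FromIso.
Context {H K : hilbertType R} (u : 'I_d -> H -> H) (v : 'I_d -> K -> K).
Hypotheses (uu : forall i, unitary_op (u i)) (uv : forall i, unitary_op (v i)).

Let bu i : bop (u i) := unitary_bop (uu i).
Let bv i : bop (v i) := unitary_bop (uv i).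

Lemma pclos_algebra : op_algebra (pclos u).
Proof.
split; first by split=> [A []//|]; exact: pclos_id.
- by split; [exact: pclosD|exact: pclosZ].
- exact: pclos_comp.
- exact: pclos_adj.
- exact: pclos_lim.
Qed.

(** A [star_isomorphism] says nothing about the unit; [pi id = id] holds because [id] is a product
    of a generator and its adjoint, and [pi] respects both. *)
Lemma star_isomorphism_hom pi :
  star_isomorphism (cstar_gen u) (cstar_gen v) pi -> (forall i, pi (u i) = v i) ->
  star_hom (pclos u) pi /\ forall p, pi (pev u p) = pev v p.
Proof.
rewrite (unitary_cstar_gen uu) (unitary_cstar_gen uv) => -[[pf_ _ _] pD pZ pM pA] piu.
have pb A : pclos u A -> bop (pi A) by move=> /pf_[].
have padj2 A B : pclos u A -> pclos u B -> adj2 A B -> adj2 (pi A) (pi B).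
  move=> SA SB AB; apply/(adj2_is_adjoint _ (pb _ SA).1); apply: pA => //.
  by apply/(adj2_is_adjoint _ SA.1.1).
have Su i : pclos u (u i) := pclos_letter bu i.
have Sa i : pclos u (adj (u i)) by apply: (pclos_adj bu (Su i)); exact: adjP.
have pia i : pi (adj (u i)) = adj (v i).
  apply/esym/adj_eq => //; rewrite -piu; apply: padj2 => //; exact: adjP.
pose i0 := Ordinal d0.
have piid : pi id = id.
  have /unitary_opE[_ <- _] := uu i0; rewrite pM// pia piu.
  by have /unitary_opE[_ -> _] := uv i0.
split; first by split=> //; split.
have pl l : pi (ltr u l) = ltr v l.
  by case: l => i []; rewrite /ltr /=; [exact: pia|exact: piu].
have Sw w : pclos u (wev u w) by rewrite -pev1; exact: pclos_pev.
have pw w : pi (wev u w) = wev v w.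
  elim: w => [|l w IH]; first exact: piid.
  have Sl : pclos u (ltr u l).
    by have := Sw [:: l]; congr (pclos u _).
  by have := pM _ _ Sl (Sw w); rewrite pl IH; congr (_ = _).
have p0 : pi 0 = 0.
  have S0 : pclos u 0 by rewrite -(pev_nil u); exact: pclos_pev.
  by have := pZ 0 _ S0; rewrite !scale0r.
elim=> [|q p IH]; first by rewrite !pev_nil.
rewrite !pev_cons pD ?pZ ?pw ?IH//; first by apply: pclosZ.
exact: pclos_pev.
Qed.

Lemma equiv_norm_dom : tuple_equiv u v -> norm_dom v u.
Proof.
move=> [pi [hpi piu]] p M M0 hM.
have [sth pE] := star_isomorphism_hom hpi piu.
rewrite -pE; apply: (sth_contr pclos_algebra sth) => //.
exact: pclos_pev.
Qed.

End FromIso.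

Lemma star_isomorphism_sym (H K : hilbertType R) (u : 'I_d -> H -> H) (v : 'I_d -> K -> K) :
  (forall i, unitary_op (u i)) -> (forall i, unitary_op (v i)) ->
  tuple_equiv u v -> tuple_equiv v u.
Proof.
move=> uu uv [pi [hpi piu]].
have [sth _] := star_isomorphism_hom uu uv hpi piu.
have algu := pclos_algebra uu; have algv := pclos_algebra uv.
move: hpi; rewrite /tuple_equiv (unitary_cstar_gen uu) (unitary_cstar_gen uv).
move=> [[pf_ pinj psurj] pD pZ pM _].
(* Outside the algebra [rho] takes the default value 0. *)
have /choice[rho rhoP] B : exists A, pclos v B -> pclos u A /\ pi A = B.
  have [/psurj[A SA <-]|nB] := pselect (pclos v B); first by exists A.
  by exists 0.
have rS B : pclos v B -> pclos u (rho B) by move=> /rhoP[].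
have rK B : pclos v B -> pi (rho B) = B by move=> /rhoP[].
have rE A B : pclos u A -> pclos v B -> pi A = B -> rho B = A.
  by move=> SA SB e; apply: pinj; rewrite ?inE//; [exact: rS|rewrite rK].
have Sv i : pclos v (v i) by apply: pclos_letter => j; exact: unitary_bop.
have Su i : pclos u (u i) by apply: pclos_letter => j; exact: unitary_bop.
exists rho; split; last by move=> i; exact: rE.
split; first split.
- exact: rS.
- by move=> A B /[!inE] SA SB e; rewrite -(rK _ SA) e rK.
- move=> A SA; exists (pi A); first exact: pf_.
  by apply: rE => //; exact: pf_.
- move=> A B SA SB; apply: rE; [exact/(opaD algu)/rS/SB/rS|exact: (opaD algv)|].
  by rewrite pD ?rK//; exact: rS.
- move=> a A SA; apply: rE; [exact/(opaZ algu)/rS|exact: (opaZ algv)|].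
  by rewrite pZ ?rK//; exact: rS.
- move=> A B SA SB; apply: rE; [exact/(opaM algu)/rS/SB/rS|exact: (opaM algv)|].
  by rewrite pM ?rK//; exact: rS.
- move=> A B SA SB AB; have brA := opa_bop algu (rS _ SA).
  apply/(adj2_is_adjoint _ brA.1); suff -> : rho B = adj (rho A) by exact: adjP.
  have Sar : pclos u (adj (rho A)) by apply: (opa_adj algu (rS _ SA)); exact: adjP.
  apply: rE => //; have := sth_adj sth (rS _ SA) Sar (adjP brA); rewrite rK//.
  move=> h; apply: (adj2_unique h).
  by apply/(adj2_is_adjoint _ (opa_bop algv SA).1).
Qed.

Lemma tuple_equivP (H K : hilbertType R) (u : 'I_d -> H -> H) (v : 'I_d -> K -> K) :
  (forall i, unitary_op (u i)) -> (forall i, unitary_op (v i)) ->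
  tuple_equiv u v <-> norm_dom u v /\ norm_dom v u.
Proof.
move=> uu uv; split=> [e|[]]; last exact: norm_eq_equiv.
split; last exact: equiv_norm_dom.
by apply: equiv_norm_dom => //; exact: star_isomorphism_sym.
Qed.

End NormCriterion.

(** * Dilations of equivalent tuples *)

Section Mean.
Context {R : realType} {Y : Type}.
Implicit Types f g : Y -> R.

Definition bdf f : Prop := exists M : R, forall y, `|f y| <= M.

Definition comb (a : R) f g : Y -> R := fun y => a * f y + g y.

Lemma bdf_comb a f g : bdf f -> bdf g -> bdf (comb a f g).
Proof.
move=> [M hM] [N hN]; exists (`|a| * M + N) => y.
apply: le_trans (ler_normD _ _) _; rewrite lerD// normrM ler_wpM2l//.
Qed.

(** Graph of a linear functional on part of the functions, dominated by the supremum. The domination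
    also makes it single-valued, as [Aun] in [mean_exists] shows. *)
Definition mean_graph (G : set ((Y -> R) * R)) : Prop :=
  [/\ forall a p q, G p -> G q -> G (comb a p.1 q.1, a * p.2 + q.2),
      forall p, G p -> bdf p.1 &
      forall p (M : R), G p -> (forall y, p.1 y <= M) -> p.2 <= M].

(** One step of Hahn-Banach: the value [al] at [f] must lie above every [p.2 - M] with [p - f <= M]
    and below every [M - p.2] with [p + f <= M]. [E] collects the former, and [up] shows that the
    latter bound it. *)
Lemma mean_graph_extend (y0 : Y) G f : mean_graph G -> G (fun=> 0, 0) -> bdf f ->
  exists G', [/\ mean_graph G', G `<=` G' & exists r, G' (f, r)].
Proof.
move=> [Gl Gb Gm] G0 bf; have [B hB] := bf.
pose E := [set r | exists p (M : R), [/\ G p, forall y, p.1 y - f y <= M & r = p.2 - M]].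
have up p (M : R) : G p -> (forall y, p.1 y + f y <= M) -> ubound E (M - p.2).
  move=> Gp hp _ [q [N [Gq hq ->]]].
  have := Gm _ (N + M) (Gl 1 _ _ Gq Gp); rewrite /comb /= mul1r => h.
  suff : q.2 + p.2 <= N + M by lra.
  by apply: h => y; rewrite mul1r; have := hp y; have := hq y; lra.
have fB y : f y <= B /\ - f y <= B.
  by have := hB y; rewrite ler_norml => /andP[]; lra.
have E0 : E !=set0.
  exists (0 - B), (fun=> 0, 0), B; split=> //= y.
  by rewrite sub0r; have [] := fB y.
have Eub : has_ubound E.
  by exists (B - 0); apply: (up (fun=> 0, 0)) => //= y; rewrite add0r; have [] := fB y.
pose al := sup E.
have al_up p (M : R) : G p -> (forall y, p.1 y + f y <= M) -> p.2 + al <= M.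
  by move=> Gp hp; rewrite addrC -lerBrDr; apply: ge_sup => //; exact: up.
have al_lo p (M : R) : G p -> (forall y, p.1 y - f y <= M) -> p.2 - al <= M.
  move=> Gp hp; rewrite lerBlDl -lerBlDr; apply: sup_ubound => //.
  by exists p, M.
pose G' : set ((Y -> R) * R) := [set q | exists p t, G p /\
  q = (comb t f p.1, t * al + p.2)].
exists G'; split.
- split.
  + move=> a _ _ [p [t [Gp ->]]] [q [s [Gq ->]]].
    exists (comb a p.1 q.1, a * p.2 + q.2), (a * t + s); split; first exact: Gl.
    by congr (_, _); [apply/funext => y; rewrite /comb /=; ring|rewrite /=; ring].
  + by move=> _ [p [t [Gp ->]]] /=; apply: bdf_comb => //; exact: Gb.
  + move=> _ M [p [t [Gp ->]]] /= hM.
    have Gs (s : R) : G (comb s p.1 (fun=> 0), s * p.2 + 0) := Gl s _ _ Gp G0.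
    (* Dividing by the absolute value of [t] reduces to coefficient 1 or -1 of [f], settled by
       [al_up] or [al_lo]. *)
    have [t0|t0|t0] := ltgtP t 0; last first.
    * by rewrite t0 mul0r add0r; apply: Gm => // y; have := hM y;
        rewrite /comb t0 mul0r add0r.
    * have ti : 0 < t^-1 by rewrite invr_gt0.
      have tV : t^-1 * t = 1 by rewrite mulVf ?gt_eqF.
      have h : t^-1 * p.2 + 0 + al <= t^-1 * M.
        apply: (al_up _ _ (Gs t^-1)) => y; rewrite /comb /= addr0.
        have := ler_wpM2l (ltW ti) (hM y); rewrite /comb mulrDr mulrA tV; lra.
      have := ler_wpM2l (ltW t0) h; rewrite !mulrDr !mulrA [t * t^-1]mulrC tV; lra.
    * have ti : 0 < - t^-1 by rewrite oppr_gt0 invr_lt0.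
      have tV : t^-1 * t = 1 by rewrite mulVf ?lt_eqF.
      have h : - t^-1 * p.2 + 0 - al <= - t^-1 * M.
        apply: (al_lo _ _ (Gs (- t^-1))) => y; rewrite /comb /= addr0.
        have := ler_wpM2l (ltW ti) (hM y); rewrite /comb mulrDr mulrA mulNr tV; lra.
      have nt : 0 <= - t by rewrite oppr_ge0 ltW.
      have := ler_wpM2l nt h; rewrite !mulrDr !mulrA mulrNN [t * t^-1]mulrC tV; lra.
- move=> [p r] Gp; exists (p, r), 0; split=> //=.
  by congr (_, _); [apply/funext => y; rewrite /comb mul0r add0r|rewrite mul0r add0r].
- exists al; exists (fun=> 0, 0), 1; split=> //=.
  by congr (_, _); [apply/funext => y; rewrite /comb mul1r addr0|rewrite mul1r addr0].
Qed.

(* Hahn-Banach for the sublinear functional [sup] on bounded functions. *)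
Lemma mean_exists (y0 : Y) G : mean_graph G -> G (fun=> 0, 0) ->
  exists m : (Y -> R) -> R,
    [/\ forall a f g, bdf f -> bdf g -> m (comb a f g) = a * m f + m g,
        forall f M, bdf f -> (forall y, f y <= M) -> m f <= M &
        forall f r, G (f, r) -> m f = r].
Proof.
move=> mG G0.
pose P (A : set ((Y -> R) * R)) := A = set0 \/ (mean_graph A /\ G `<=` A).
have [F FP Ftot|A [PA Amax]] := @Zorn_bigcup _ P.
  have [[A FA An0]|noA] := pselect (exists2 A, F A & A !=set0); last first.
    left; apply/seteqP; split=> // p [A FA Ap]; exfalso; apply: noA.
    by exists A => //; exists p.
  have mA B p : F B -> B p -> mean_graph B /\ G `<=` B.
    by move=> FB Bp; have [B0|//] := FP _ FB; rewrite B0 in Bp.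
  right; split; last first.
    move=> p Gp; exists A => //; have [q Aq] := An0; have [_] := mA _ _ FA Aq; exact.
  split.
  - move=> a p q [B FB Bp] [B' FB' Bq].
    have [BB|BB] := Ftot _ _ FB FB'.
      by exists B' => //; have [[h _ _] _] := mA _ _ FB' Bq; apply: h => //; exact: BB.
    by exists B => //; have [[h _ _] _] := mA _ _ FB Bp; apply: h => //; exact: BB.
  - by move=> p [B FB Bp]; have [[_ h _] _] := mA _ _ FB Bp; exact: h.
  - by move=> p M [B FB Bp]; have [[_ _ h] _] := mA _ _ FB Bp; exact: h.
have [gA GA] : mean_graph A /\ G `<=` A.
  case: PA => // A0; exfalso; apply: (Amax G); last by right; split.
  rewrite A0; split=> //; move=> h; exact: (h _ G0).
have [Al Ab Am] := gA; have A0 := GA _ G0.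
have Atot f : bdf f -> exists r, A (f, r).
  move=> bf; have [G' [mG' AG' [r G'r]]] := mean_graph_extend y0 gA A0 bf.
  exists r; apply: contrapT => nA; apply: (Amax G').
    by split=> //; move=> h; apply: nA; exact: h.
  by right; split=> // p /GA/AG'.
have Aun f r s : A (f, r) -> A (f, s) -> r <= s.
  move=> hr hs; have := Am _ 0 (Al (-1) _ _ hs hr).
  rewrite /comb /= mulN1r addrC subr_le0; apply => y.
  by rewrite mulN1r addNr.
have /choice[m mP] f : exists r, bdf f -> A (f, r).
  by have [/Atot[r hr]|nb] := pselect (bdf f); [exists r|exists 0].
have mE f r : A (f, r) -> m f = r.
  move=> h; have h' := mP _ (Ab _ h).
  by apply/eqP; rewrite eq_le (Aun _ _ _ h h') (Aun _ _ _ h' h).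
exists m; split.
- by move=> a f g bf bg; apply: mE; exact: (Al a _ _ (mP _ bf) (mP _ bg)).
- by move=> f M /mP/Am; exact.
- by move=> f r /GA/mE.
Qed.

End Mean.

(** * Separability and total sequences *)

Section Separability.
Context {R : realType}.
Local Notation C := R[i].

Lemma ball_nrm (H : hilbertType R) (x y : H) (e : R) : ball x e%:C y <-> nrm (x - y) < e.
Proof. by rewrite -ball_normE /= nrmE ltcR. Qed.

Lemma separable_seq (H : hilbertType R) : separable H ->
  exists s : nat -> H, forall z (e : R), 0 < e -> exists n, nrm (z - s n) <= e.
Proof.
move=> [A /countable_injP[f finj] dA].
pose s n := xget (0 : H) [set a | A a /\ f a = n].
exists s => z e e0.
have [|y [/ball_nrm zy Ay]] := dA (ball z e%:C) _ (ball_open _ _).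
  by exists z; apply/ball_nrm; rewrite subrr nrm0.
exists (f y); suff -> : s (f y) = y by exact: ltW.
rewrite /s; case: xgetP => [a _ [Aa fa]|/(_ y)]; last by case.
by apply: finj; rewrite ?inE.
Qed.

Lemma rat_approx (c : C) (e : R) : 0 < e ->
  exists p : rat * rat, cabs (c - (ratr p.1 +i* ratr p.2)) <= e.
Proof.
move=> e0; have e2 : 0 < e / 2 by rewrite divr_gt0.
have ra (r : R) : exists q : rat, `|r - ratr q| <= e / 2.
  have [|q] := @rat_in_itvoo R (r - e / 2) (r + e / 2); first by lra.
  rewrite in_itv /= => /andP[h1 h2]; exists q.
  by rewrite ler_norml; apply/andP; split; lra.
case: c => a b; have [p hp] := ra a; have [q hq] := ra b; exists (p, q) => /=.
have -> : (a +i* b) - (ratr p +i* ratr q) =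
    (a - ratr p)%:C + 'i * (b - ratr q)%:C :> C.
  by apply/eqP; rewrite eq_complex /=; apply/andP; split; apply/eqP; ring.
apply: le_trans (cabsD _ _) _; rewrite cabsM cabsi mul1r !cabs_real.
by rewrite (splitr e) lerD.
Qed.

(** Combinations with coefficients in Q(i) are countable in number and still dense. *)
Lemma separable_total (X : countType) (H : hilbertType R) (k : X -> H) :
  total_family k -> separable H.
Proof.
move=> tk.
pose rc (p : rat * rat) : C := ratr p.1 +i* ratr p.2.
pose F (s : seq ((rat * rat) * X)) := lcomb k [seq (rc q.1, q.2) | q <- s].
have approx s (e : R) : 0 < e -> exists t, nrm (lcomb k s - F t) <= e.
  elim: s e => [|[c x] s IH] e e0.
    by exists [::]; rewrite /F /= lcomb_nil subrr nrm0 ltW.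
  have e2 : 0 < e / 2 by rewrite divr_gt0.
  have n1 : 0 < nrm (k x) + 1 by rewrite ltr_wpDl ?nrm_ge0.
  have [t ht] := IH _ e2; have [p hp] := rat_approx c (divr_gt0 e2 n1).
  exists ((p, x) :: t); rewrite /F /= !lcomb_cons /= opprD addrACA -scalerBl.
  apply: le_trans (nrmD _ _) _; rewrite (splitr e) lerD// nrmZ.
  have := ler_wpM2r (nrm_ge0 (k x)) hp; move=> /le_trans; apply.
  by rewrite mulrAC ler_pdivrMr// ler_wpM2l ?lerDl// ltW.
exists (F @` setT).
  exact: sub_countable (card_image_le _ _) (countableP _).
move=> O [y Oy] oO.
have /nbhs_ballP[[e e'] /= e0 eO] : nbhs y O by rewrite nbhsE /=; exists O.
move: e0 eO; rewrite ltcE /= => /andP[/eqP -> e0] eO.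
have e3 : 0 < e / 3 by rewrite divr_gt0.
have [s hs] := tk y _ e3; have [t ht] := approx s _ e3.
exists (F t); split; last by exists t.
apply: eO; apply/ball_nrm; apply: le_lt_trans (nrm_dist _ (lcomb k s) _) _; lra.
Qed.

(** Scaling does not affect totality, and the factor [2^-(n+1) / (1 + |s n|)] keeps the n-th norm
    below [2^-(n+1)]. The result is a point of the unit ball of l^2(H), the form in which
    [mean_of_equiv] takes it. *)
Lemma separable_scaled_seq (H : hilbertType R) : separable H ->
  exists x : nat -> H, total_family x /\ forall n, \sum_(i < n) nrm (x i) ^+ 2 <= 1.
Proof.
move=> /separable_seq[s hs].
pose a n : R := 2^-1 ^+ n.+1 / (1 + nrm (s n)).
have np n : 0 < 1 + nrm (s n) by rewrite ltr_pwDl ?nrm_ge0.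
have hp n : 0 < (2^-1 : R) ^+ n.+1 by rewrite exprn_gt0// invr_gt0.
have ap n : 0 < a n by rewrite divr_gt0.
exists (fun n => (a n)%:C *: s n); split.
  move=> z e e0; have [n hn] := hs z e e0; exists [:: ((a n)^-1%:C, n)].
  rewrite lcomb_cons lcomb_nil addr0 /= scalerA -rmorphM mulVf ?scale1r//.
  by rewrite gt_eqF.
have nx n : nrm ((a n)%:C *: s n) <= 2^-1 ^+ n.+1.
  rewrite nrmZr gtr0_norm// /a mulrAC -[leRHS]mulr1 -mulrA ler_wpM2l ?(ltW (hp n))//.
  by rewrite ler_pdivrMr// mul1r lerDr.
suff h n : \sum_(i < n) nrm ((a i)%:C *: s i) ^+ 2 <= 1 - 2^-1 ^+ n.
  move=> n; apply: le_trans (h n) _; rewrite gerBl exprn_ge0//.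
elim: n => [|n IH]; first by rewrite big_ord0 expr0 subrr.
have h1 : (2^-1 : R) ^+ n.+1 <= 1 by rewrite exprn_ile1// invf_le1// ler1n.
have := ler_pM (nrm_ge0 _) (nrm_ge0 _) (nx n) (le_trans (nx n) h1).
rewrite mulr1 -expr2 big_ord_recr /= => h2.
apply: le_trans (lerD IH h2) _; rewrite exprS; move: (2^-1 ^+ n) => b; lra.
Qed.

End Separability.

(** * Quadratic forms with polynomial coefficients *)

Section Forms.
Context {R : realType} {d : nat}.
Local Notation C := R[i].
Local Notation poly := (seq (C * seq ('I_d * bool))).
Local Notation form := (seq (poly * (nat * nat))).

Definition fev {H : hilbertType R} (u : 'I_d -> H -> H) (y : nat -> H) (g : form) : R :=
  \sum_(t <- g) rdot (pev u t.1 (y t.2.1)) (y t.2.2).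

Lemma fev_cons (H : hilbertType R) (u : 'I_d -> H -> H) y t g :
  fev u y (t :: g) = rdot (pev u t.1 (y t.2.1)) (y t.2.2) + fev u y g.
Proof. exact: big_cons. Qed.

Definition halfC : C := (2^-1 : R)%:C.

(* [hmat g] is the matrix of the hermitian part of [g], so that
   [fev u y g] is the real quadratic form it defines at [y]. *)
Definition hpart (t : poly * (nat * nat)) (i j : nat) : poly :=
  (if (j == t.2.1) && (i == t.2.2) then scl halfC t.1 else [::]) ++
  (if (i == t.2.1) && (j == t.2.2) then scl halfC (padj t.1) else [::]).

Definition hmat (g : form) (i j : nat) : poly := flatten [seq hpart t i j | t <- g].

Section Eval.
Context {H : hilbertType R} (u : 'I_d -> H -> H).
Hypothesis bu : forall i, bop (u i).

Lemma pev_if (b : bool) (p : poly) x : pev u (if b then p else [::]) x = if b then pev u p x else 0.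
Proof. by case: b => //; rewrite pev_nil. Qed.

Lemma sum_delta n (a b : nat) (F : nat -> nat -> R) : (a < n)%N -> (b < n)%N ->
  \sum_(i < n) \sum_(j < n) (if (nat_of_ord j == a) && (nat_of_ord i == b) then F i j else 0)
  = F b a.
Proof.
move=> an bn; rewrite (bigD1 (Ordinal bn))//= [X in _ + X]big1 ?addr0; last first.
  by move=> i ib; rewrite big1// => j _; rewrite [_ == b](negbTE ib) andbF.
rewrite (bigD1 (Ordinal an))//= !eqxx big1 ?addr0// => j ja.
by rewrite [_ == a](negbTE ja).
Qed.

Lemma hmat_form n (y : nat -> H) g :
  (forall t, t \in [seq t.2 | t <- g] -> (t.1 < n)%N && (t.2 < n)%N) ->
  \sum_(i < n) \sum_(j < n) rdot (pev u (hmat g i j) (y j)) (y i) = fev u y g.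
Proof.
elim: g => [|[p [a b]] g IH] hg.
  rewrite /fev big_nil big1// => i _; rewrite big1// => j _.
  by rewrite pev_nil rdot0l.
rewrite fev_cons -IH; last by move=> t tg; apply: hg; rewrite inE tg orbT.
have /andP[an bn] : (a < n)%N && (b < n)%N by apply: (hg (a, b)); rewrite inE eqxx.
pose F1 i j := 2^-1 * rdot (pev u p (y j)) (y i).
pose F2 i j := 2^-1 * rdot (pev u (padj p) (y i)) (y j).
transitivity (\sum_(i < n) \sum_(j < n)
   ((if (nat_of_ord j == a) && (nat_of_ord i == b) then F1 i j else 0) +
    (if (nat_of_ord j == b) && (nat_of_ord i == a) then F2 j i else 0) +
    rdot (pev u (hmat g i j) (y j)) (y i))).
  apply: eq_bigr => i _; apply: eq_bigr => j _.
  rewrite /hmat /= /hpart /= !pev_cat !fctE !pev_if !rdotDl andbC [(nat_of_ord j == b) && _]andbC.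
  congr (_ + _ + _); rewrite 1?andbC; case: ifP => _; rewrite ?rdot0l// pev_scl fctE.
    by rewrite rdotZl.
  by rewrite rdotZl.
under eq_bigr do rewrite big_split big_split.
rewrite big_split big_split /=.
rewrite (sum_delta F1)//.
rewrite (sum_delta (fun i j => F2 j i))// /F1 /F2.
by rewrite [rdot (pev u (padj p) _) _]rdotC -(pev_adj bu); lra.
Qed.

Lemma hmat_adj g i j : adj2 (pev u (hmat g i j)) (pev u (hmat g j i)).
Proof.
elim: g => [|t g IH] x y; first by rewrite !pev_nil rdot0l rdot0r.
rewrite /hmat /= /hpart !pev_cat !fctE !pev_if !rdotDl !rdotDr -/(hmat g i j) IH.
congr (_ + _); rewrite addrC; congr (_ + _); case: ifP => _; rewrite ?rdot0l ?rdot0r//;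
  rewrite !pev_scl !fctE rdotZl rdotZr; last by rewrite (pev_adj bu).
by rewrite rdotC -(pev_adj bu) rdotC.
Qed.

End Eval.

Hypothesis d0 : (0 < d)%N.

(** Consider [(M + e) - g] as a matrix of polynomials. By homogeneity its form over [u] is at least
    [e] times the squared norm, so [sth_cp] gives nonnegativity over [v], and [e] tends to zero. The
    slack [e] provides the coercivity that [sth_cp] asks for. *)
Lemma fev_le (H K : hilbertType R) (u : 'I_d -> H -> H) (v : 'I_d -> K -> K)
    (g : form) (M : R) :
  (forall i, unitary_op (u i)) -> (forall i, unitary_op (v i)) -> tuple_equiv u v ->
  (forall y : nat -> H, (forall n, \sum_(i < n) nrm (y i) ^+ 2 <= 1) -> fev u y g <= M) ->
  forall x : nat -> K, (forall n, \sum_(i < n) nrm (x i) ^+ 2 <= 1) -> fev v x g <= M.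
Proof.
move=> uu uv [pi [hpi piu]] hM x hx.
have bu i := unitary_bop (uu i); have bv i := unitary_bop (uv i).
have [sth pE] := star_isomorphism_hom d0 uu uv hpi piu.
have [n hn] : exists n, forall t, t \in [seq t.2 | t <- g] -> (t.1 < n)%N && (t.2 < n)%N.
  elim: g {hM} => [|t g [n hn]]; first by exists 0.
  exists (maxn n (maxn t.2.1.+1 t.2.2.+1)) => s; rewrite inE => /predU1P[->|/hn/andP[h1 h2]].
    by rewrite !leq_max !leqnn !orbT.
  by rewrite !leq_max h1 h2.
have M0 : 0 <= M.
  have := hM (fun=> 0); rewrite /fev big1; first by apply=> m; rewrite big1// => i _;
    rewrite nrm0 expr0n.
  by move=> t _; rewrite rdot0r.
apply/ler_addgt0Pl => e e0.
pose B (i j : 'I_n) : poly :=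
  (if i == j then [:: ((M + e)%:C, [::])] else [::]) ++ scl (-1)%:C (hmat g i j).
have BE (L : hilbertType R) (w : 'I_d -> L -> L) i j z : pev w (B i j) z =
    (if i == j then (M + e)%:C *: z else 0) - pev w (hmat g i j) z.
  rewrite /B pev_cat pev_scl !fctE pev_if rmorphN1 scaleN1r; congr (_ + _).
  by case: ifP => // _; rewrite pev_cons pev_nil addr0.
have form_B (L : hilbertType R) (w : 'I_d -> L -> L) (z : nat -> L) : (forall i, bop (w i)) ->
    \sum_(i < n) \sum_(j < n) rdot (pev w (B i j) (z j)) (z i) =
    (M + e) * \sum_(i < n) nrm (z i) ^+ 2 - fev w z g.
  move=> bw; rewrite -(hmat_form bw _ hn) mulr_sumr -sumrB; apply: eq_bigr => i _.
  under eq_bigr => j _ do rewrite BE rdotBl.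
  rewrite sumrB; congr (_ - _); rewrite (bigD1 i)//= eqxx rdotZl rdotxx big1 ?addr0//.
  by move=> j ji; rewrite eq_sym (negbTE ji) rdot0l.
have pos := @sth_cp _ H K _ pi (pclos_algebra uu) sth n (fun i j => pev u (B i j)) e.
have {pos} pos : forall z : 'I_n -> K, 0 <= \sum_i \sum_j rdot (pi (pev u (B i j)) (z j)) (z i).
  apply: pos => //.
  - by move=> i j; exact: pclos_pev.
  - move=> i j z z'; rewrite !BE rdotBl rdotBr (hmat_adj bu) [j == i]eq_sym.
    by case: ifP => _; rewrite ?rdot0l ?rdot0r// rdotZl rdotZr.
  - move=> z.
    (* Extended by zero, [z] becomes a sequence all of whose partial sums are at most [s]; dividing
       by the root of [s] brings it into the unit ball. *)
    pose y (k : nat) : H := if insub k is Some i then z i else 0.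
    have yE (i : 'I_n) : y i = z i.
      by rewrite /y; case: insubP => [j _ ji|]; [congr z; exact: val_inj|rewrite ltn_ord].
    have -> : \sum_i nrm (z i) ^+ 2 = \sum_(i < n) nrm (y i) ^+ 2.
      by apply: eq_bigr => i _; rewrite yE.
    have -> : \sum_i \sum_j rdot (pev u (B i j) (z j)) (z i) =
        \sum_(i < n) \sum_(j < n) rdot (pev u (B i j) (y j)) (y i).
      by apply: eq_bigr => i _; apply: eq_bigr => j _; rewrite !yE.
    rewrite form_B// mulrDl addrAC lerDr subr_ge0.
    set s := \sum_(i < n) _.
    have s0 : 0 <= s by apply: sumr_ge0 => i _; exact: sqr_ge0.
    have y0 k : (n <= k)%N -> y k = 0.
      by move=> nk; rewrite /y; case: insubP => // i; rewrite ltnNge nk.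
    have ys m : \sum_(i < m) nrm (y i) ^+ 2 <= s.
      have [mn|nm] := leqP m n.
        rewrite /s -!(big_mkord xpredT (fun i => nrm (y i) ^+ 2)).
        rewrite [leRHS](big_cat_nat (n := m))//= lerDl; apply: sumr_ge0 => i _; exact: sqr_ge0.
      rewrite /s -!(big_mkord xpredT (fun i => nrm (y i) ^+ 2)).
      rewrite [leLHS](big_cat_nat (n := n))//= ?(ltnW nm)// [X in _ + X]big_nat.
      rewrite [X in _ + X]big1 ?addr0// => i /andP[ni _].
      by rewrite y0// nrm0 expr0n.
    have [s_eq0|sn0] := eqVneq s 0.
      have yz k : y k = 0.
        apply: nrm0_eq0; apply/eqP; rewrite -sqrf_eq0; apply/eqP/le_anti.
        rewrite sqr_ge0 andbT -s_eq0; apply: le_trans (ys k.+1).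
        by rewrite big_ord_recr /= lerDr; apply: sumr_ge0 => i _; exact: sqr_ge0.
      by rewrite s_eq0 mulr0 /fev big1// => t _; rewrite !yz rdot0r.
    have sp : 0 < s by rewrite lt_neqAle eq_sym sn0.
    pose r := (Num.sqrt s)^-1; have r0 : 0 < r by rewrite invr_gt0 sqrtr_gt0.
    have rr : r ^+ 2 = s^-1 by rewrite exprVn sqr_sqrtr.
    have := hM (fun k => r%:C *: y k).
    have -> : fev u (fun k => r%:C *: y k) g = s^-1 * fev u y g.
      rewrite /fev mulr_sumr; apply: eq_bigr => t _.
      by rewrite (linPZ (pev_bop bu _).1) rdotZl rdotZr mulrA -expr2 rr.
    rewrite ler_pdivrMl// mulrC; apply => m.
    under eq_bigr do rewrite nrmZr exprMn (ger0_norm (ltW r0)) rr.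
    by rewrite -mulr_sumr ler_pdivrMl// mulr1.
have := pos (fun i => x i); under eq_bigr do under eq_bigr do rewrite pE.
rewrite form_B// subr_ge0 addrC => /le_trans; apply.
by rewrite -[leRHS]mulr1 ler_wpM2l// addr_ge0// ltW.
Qed.

End Forms.

(** * Averaging scalar functions and fields of vectors *)

Section MeanIntegral.
Context {R : realType} {Y : Type} (m : (Y -> R) -> R).
Local Notation C := R[i].
Hypothesis m_comb : forall a f g, bdf f -> bdf g -> m (comb a f g) = a * m f + m g.
Hypothesis m_le : forall f M, bdf f -> (forall y, f y <= M) -> m f <= M.

Lemma bdf_cst (c : R) : bdf (fun _ : Y => c).
Proof. by exists `|c|. Qed.

Lemma mean0 : m (fun=> 0) = 0.
Proof.
have := m_comb (-1) (bdf_cst 0) (bdf_cst 0).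
rewrite (_ : comb _ _ _ = fun=> 0); first by rewrite mulN1r addNr.
by apply/funext => y; rewrite /comb mulr0 addr0.
Qed.

Lemma meanZ a f : bdf f -> m (fun y => a * f y) = a * m f.
Proof.
move=> bf; have := m_comb a bf (bdf_cst 0); rewrite mean0 addr0 => <-.
by congr m; apply/funext => y; rewrite /comb addr0.
Qed.

Lemma meanD f g : bdf f -> bdf g -> m (fun y => f y + g y) = m f + m g.
Proof.
move=> bf bg; have := m_comb 1 bf bg; rewrite mul1r => <-.
by congr m; apply/funext => y; rewrite /comb mul1r.
Qed.

Lemma bdfZ a (f : Y -> R) : bdf f -> bdf (fun y => a * f y).
Proof. by move=> [M hM]; exists (`|a| * M) => y; rewrite normrM ler_wpM2l. Qed.

Lemma bdfD (f g : Y -> R) : bdf f -> bdf g -> bdf (fun y => f y + g y).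
Proof.
move=> [M hM] [N hN]; exists (M + N) => y.
by apply: le_trans (ler_normD _ _) _; rewrite lerD.
Qed.

Lemma mean_ge0 f : bdf f -> (forall y, 0 <= f y) -> 0 <= m f.
Proof.
move=> bf f0; rewrite -oppr_le0 -mulN1r -meanZ//; apply: m_le; first exact: bdfZ.
by move=> y; rewrite mulN1r oppr_le0.
Qed.

Lemma mean_mono f g : bdf f -> bdf g -> (forall y, f y <= g y) -> m f <= m g.
Proof.
move=> bf bg fg; have := mean_ge0 (bdfD bg (bdfZ (-1) bf)).
rewrite meanD//; last exact: bdfZ.
rewrite meanZ// mulN1r subr_ge0; apply => y.
by rewrite mulN1r subr_ge0.
Qed.

Definition meanC (f : Y -> C) : C :=
  m (fun y => complex.Re (f y)) +i* m (fun y => complex.Im (f y)).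

Definition bdc (f : Y -> C) : Prop :=
  bdf (fun y => complex.Re (f y)) /\ bdf (fun y => complex.Im (f y)).

Lemma bdc0 : bdc (fun=> 0).
Proof. by split; exact: bdf_cst. Qed.

Lemma bdcZ (c : C) f : bdc f -> bdc (fun y => c * f y).
Proof.
case: c => a b [rf jf]; split.
- have -> : (fun y => complex.Re ((a +i* b) * f y)) =
    (fun y => a * complex.Re (f y) + - b * complex.Im (f y)).
    by apply/funext => y; case: (f y) => ? ? /=; ring.
  by apply: bdfD; exact: bdfZ.
- have -> : (fun y => complex.Im ((a +i* b) * f y)) =
    (fun y => a * complex.Im (f y) + b * complex.Re (f y)).
    by apply/funext => y; case: (f y) => ? ? /=; ring.
  by apply: bdfD; exact: bdfZ.
Qed.

Lemma bdcD f g : bdc f -> bdc g -> bdc (fun y => f y + g y).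
Proof.
move=> [rf jf] [rg jg]; split.
- have -> : (fun y => complex.Re (f y + g y)) =
    (fun y => complex.Re (f y) + complex.Re (g y)).
    by apply/funext => y; case: (f y) (g y) => ? ? [].
  exact: bdfD.
- have -> : (fun y => complex.Im (f y + g y)) =
    (fun y => complex.Im (f y) + complex.Im (g y)).
    by apply/funext => y; case: (f y) (g y) => ? ? [].
  exact: bdfD.
Qed.

Lemma meanCZ (c : C) f : bdc f -> meanC (fun y => c * f y) = c * meanC f.
Proof.
case: c => a b [rf jf]; rewrite /meanC.
have -> : (fun y => complex.Re ((a +i* b) * f y)) =
    (fun y => a * complex.Re (f y) + - b * complex.Im (f y)).
  by apply/funext => y; case: (f y) => ? ? /=; ring.
have -> : (fun y => complex.Im ((a +i* b) * f y)) =
    (fun y => a * complex.Im (f y) + b * complex.Re (f y)).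
  by apply/funext => y; case: (f y) => ? ? /=; ring.
rewrite !meanD ?meanZ//; try exact: bdfZ.
by apply/eqP; rewrite eq_complex /=; apply/andP; split; apply/eqP; ring.
Qed.

Lemma meanCD f g : bdc f -> bdc g -> meanC (fun y => f y + g y) = meanC f + meanC g.
Proof.
move=> [rf jf] [rg jg]; rewrite /meanC.
have -> : (fun y => complex.Re (f y + g y)) =
    (fun y => complex.Re (f y) + complex.Re (g y)).
  by apply/funext => y; case: (f y) (g y) => ? ? [].
have -> : (fun y => complex.Im (f y + g y)) =
    (fun y => complex.Im (f y) + complex.Im (g y)).
  by apply/funext => y; case: (f y) (g y) => ? ? [].
by rewrite !meanD.
Qed.

Lemma meanC_sum (I : Type) (s : seq I) (F : I -> Y -> C) : (forall i, bdc (F i)) ->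
  bdc (fun y => \sum_(i <- s) F i y) /\
  meanC (fun y => \sum_(i <- s) F i y) = \sum_(i <- s) meanC (F i).
Proof.
move=> bF; elim: s => [|i s [IH1 IH2]].
  rewrite big_nil; have -> : (fun y => \sum_(i <- [::]) F i y) = (fun=> 0).
    by apply/funext => y; rewrite big_nil.
  by split; [exact: bdc0|rewrite /meanC /= mean0].
have -> : (fun y => \sum_(i <- i :: s) F i y) = (fun y => F i y + \sum_(i <- s) F i y).
  by apply/funext => y; rewrite big_cons.
by rewrite big_cons -IH2; split; [exact: bdcD|exact: meanCD].
Qed.

Section Field.
Context {X : Type} {K : hilbertType R} (kv : X -> Y -> K).
Hypothesis bkv : forall a, exists M, forall y, nrm (kv a y) <= M.

Lemma bdc_hdot a b : bdc (fun y => hdot (kv a y) (kv b y)).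
Proof.
have [M hM] := bkv a; have [N hN] := bkv b.
have MN y x z : nrm x = nrm (kv a y) -> nrm z = nrm (kv b y) ->
    `|rdot (x : K) z| <= M * N.
  move=> ex ez; apply: le_trans (rdot_abs _ _) _.
  by rewrite ex ez; apply: ler_pM; rewrite ?nrm_ge0.
split; exists (M * N) => y; first exact: (MN y).
rewrite hdotE /=; apply: (MN y) => //.
by rewrite nrmZ cabsi mul1r.
Qed.

(** The kernel is a mean of Gram kernels, hence positive. The space plays the role of a direct
    integral of copies of [K] over the finitely additive measure [m], restricted to the span of the
    chosen fields. *)
Lemma mean_kolmogorov : exists (Z : hilbertType R) (k : X -> Z),
  [/\ total_family k,
      forall a b, hdot (k a) (k b) = meanC (fun y => hdot (kv a y) (kv b y)) &
      forall s, bdf (fun y => nrm (lcomb (kv^~ y) s) ^+ 2) /\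
                nrm (lcomb k s) ^+ 2 = m (fun y => nrm (lcomb (kv^~ y) s) ^+ 2)].
Proof.
pose Q (s : seq (C * X)) y := nrm (lcomb (kv^~ y) s) ^+ 2.
pose Kn a b := meanC (fun y => hdot (kv a y) (kv b y)).
have KQ s : bdf (Q s) /\
    \sum_(p <- s) \sum_(q <- s) p.1 * q.1^*%C * Kn p.2 q.2 = (m (Q s))%:C.
  pose F (p q : C * X) y := p.1 * q.1^*%C * hdot (kv p.2 y) (kv q.2 y).
  have bF p q : bdc (F p q) by apply: bdcZ; exact: bdc_hdot.
  have h1 p := meanC_sum s (bF p).
  have [b2 h2] := meanC_sum s (fun p => (h1 p).1).
  have QE : (fun y => \sum_(p <- s) \sum_(q <- s) F p q y) = (fun y => (Q s y)%:C).
    by apply/funext => y; rewrite /Q -hdotxx hdot_lcomb.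
  rewrite QE in b2 h2; split; first exact: b2.1.
  have -> : (m (Q s))%:C = meanC (fun y => (Q s y)%:C) by rewrite /meanC /= mean0.
  rewrite h2; apply: eq_bigr => p _; rewrite (h1 p).2.
  apply: eq_bigr => q _; rewrite /F /Kn meanCZ//; exact: bdc_hdot.
have psd (s : seq (C * X)) :
    0 <= \sum_(p <- s) \sum_(q <- s) p.1 * q.1^*%C * Kn p.2 q.2.
  have [bQ ->] := KQ s; rewrite ler0c; apply: mean_ge0 => // y; exact: sqr_ge0.
have [Z [k [kK tk]]] := kolmogorov psd.
exists Z, k; split=> // s; have [bQ e] := KQ s; split=> //.
apply: complexI; rewrite -e -hdotxx hdot_lcomb.
by apply: eq_bigr => p _; apply: eq_bigr => q _; rewrite kK.
Qed.

End Field.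
End MeanIntegral.

Lemma total_bound (R : realType) (X : Type) (H K : hilbertType R) (k : X -> H)
    (A : H -> K) (M : R) :
  total_family k -> bop A -> 0 <= M ->
  (forall s, nrm (A (lcomb k s)) <= M * nrm (lcomb k s)) ->
  forall x, nrm (A x) <= M * nrm x.
Proof.
move=> tk bA M0 h x; have [N N0 hN] := bop_bound bA.
apply/ler_addgt0Pl => e e0; have MN : 0 < M + N by rewrite ltr_wpDl.
have [s hs] := tk x _ (divr_gt0 e0 MN).
have h1 := nrm_ltB (A x) (A (lcomb k s)); rewrite -(linPB bA.1) in h1.
have h2 := hN (x - lcomb k s); have h3 := nrm_ltB (lcomb k s) x.
rewrite nrmB in h3; have h4 := ler_wpM2l M0 h3; have h5 := h s.
by rewrite ler_pdivlMr// in hs; lra.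
Qed.

(** * Transfer of a dilation to an equivalent tuple *)

Section Transfer.
Context {R : realType} {d : nat}.
Local Notation C := R[i].
Local Notation letter := ('I_d * bool)%type.
Local Notation word := (seq letter).
Local Notation poly := (seq (C * word)).
Local Notation form := (seq (poly * (nat * nat))).

Lemma ltr_isom (H : hilbertType R) (u : 'I_d -> H -> H) l :
  (forall i, unitary_op (u i)) -> isom (ltr u l).
Proof.
case: l => i [] uu; rewrite /ltr /=; last exact: unitary_isom.
have /unitary_opE[bA h1 h2] := uu i; have bA' := bop_adj bA.
split; first exact: bA'.1.
by move=> x; rewrite -(unitary_isom (uu i)).2; have := congr1 (@^~ x) h2 => /= ->.
Qed.

Lemma ltr_flip (H : hilbertType R) (u : 'I_d -> H -> H) l x :
  (forall i, unitary_op (u i)) -> ltr u l (ltr u (flip l) x) = x.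
Proof.
case: l => i [] uu; rewrite /ltr /=; have /unitary_opE[_ h1 h2] := uu i.
  by have := congr1 (@^~ x) h1.
by have := congr1 (@^~ x) h2.
Qed.

Lemma wev_isom (H : hilbertType R) (u : 'I_d -> H -> H) w :
  (forall i, unitary_op (u i)) -> isom (wev u w).
Proof.
move=> uu; elim: w => [|l w IH]; first by split.
exact: (isom_comp (ltr_isom l uu) IH).
Qed.

(** The unit ball of l^2(H): the points over which data of [u] are averaged. All forms are bounded
    on it, and [fev_le] compares suprema over it. *)
Definition yball (H : hilbertType R) : Type :=
  {y : nat -> H | forall n, \sum_(i < n) nrm (y i) ^+ 2 <= 1}.

Lemma yball_le (H : hilbertType R) (y : yball H) i : nrm (sval y i) <= 1.
Proof.
have := svalP y i.+1; rewrite big_ord_recr /= => h.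
rewrite nrm_sqrtP// expr1n; apply: le_trans h; rewrite lerDr.
by apply: sumr_ge0 => j _; exact: sqr_ge0.
Qed.

(** By [fev_le], evaluating forms at [w] and [x] is dominated by their supremum over the ball; this
    makes it a well-defined functional of the functions [phi g], which Hahn-Banach extends to all
    bounded functions. A single mean serves all polynomials and all index pairs, as the construction
    of one inner product requires. *)
Lemma mean_of_equiv (d0 : (0 < d)%N) (H L : hilbertType R) (u : 'I_d -> H -> H)
    (w : 'I_d -> L -> L) (x : nat -> L) :
  (forall i, unitary_op (u i)) -> (forall i, unitary_op (w i)) -> tuple_equiv u w ->
  (forall n, \sum_(i < n) nrm (x i) ^+ 2 <= 1) ->
  exists m : (yball H -> R) -> R,
    [/\ forall a f g, bdf f -> bdf g -> m (comb a f g) = a * m f + m g,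
        forall f M, bdf f -> (forall y, f y <= M) -> m f <= M &
        forall p i j, bdf (fun y : yball H => rdot (pev u p (sval y i)) (sval y j)) /\
          m (fun y => rdot (pev u p (sval y i)) (sval y j)) = rdot (pev w p (x i)) (x j)].
Proof.
move=> uu uw e hx; have bu i := unitary_bop (uu i).
have y0 : yball H.
  by exists (fun=> 0) => n; rewrite big1// => i _; rewrite nrm0 expr0n.
pose phi (g : form) (y : yball H) := fev u (sval y) g.
have bphi g : bdf (phi g).
  elim: g => [|[p [i j]] g [M hM]].
    by exists 0 => y; rewrite /phi /fev big_nil normr0.
  have [N N0 hN] := bop_bound (pev_bop bu p).
  exists (N + M) => y; rewrite /phi fev_cons; apply: le_trans (ler_normD _ _) _.
  apply: lerD; last exact: hM.
  apply: le_trans (rdot_abs _ _) _ => /=.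
  rewrite -[N]mulr1; apply: ler_pM; rewrite ?nrm_ge0 ?yball_le//.
  apply: le_trans (hN _) _; rewrite -[leRHS]mulr1 ler_wpM2l ?(ltW N0)//.
  exact: yball_le.
pose G : set ((yball H -> R) * R) := [set q | exists g, q = (phi g, fev w x g)].
have fev_scl (V : hilbertType R) (v : 'I_d -> V -> V) (a : R) z (g : form) :
    fev v z [seq (scl a%:C t.1, t.2) | t <- g] = a * fev v z g.
  rewrite /fev big_map mulr_sumr; apply: eq_bigr => t _ /=.
  by rewrite pev_scl rdotZl.
have fev_cat (V : hilbertType R) (v : 'I_d -> V -> V) z (g h : form) :
    fev v z (g ++ h) = fev v z g + fev v z h by exact: big_cat.
have mG : mean_graph G.
  split.
  - move=> a _ _ [g ->] [h ->]; exists ([seq (scl a%:C t.1, t.2) | t <- g] ++ h).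
    rewrite fev_cat fev_scl; congr (_, _); apply/funext => y.
    by rewrite /phi /comb fev_cat fev_scl.
  - by move=> _ [g ->]; exact: bphi.
  - move=> _ M [g ->] /= hM; apply: (fev_le d0 uu uw e) => // y hy.
    exact: (hM (exist _ y hy)).
have G0 : G (fun=> 0, 0).
  exists [::]; rewrite /fev big_nil; congr (_, _).
  by apply/funext => y; rewrite /phi /fev big_nil.
have [m [m1 m2 m3]] := mean_exists y0 mG G0; exists m; split=> // p i j.
have E (V : hilbertType R) (v : 'I_d -> V -> V) z :
    rdot (pev v p (z i)) (z j) = fev v z [:: (p, (i, j))].
  by rewrite fev_cons /fev big_nil addr0.
have -> : (fun y : yball H => rdot (pev u p (sval y i)) (sval y j)) =
  phi [:: (p, (i, j))] by apply/funext => y; rewrite E.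
split; first exact: bphi.
by rewrite E; apply: m3; exists [:: (p, (i, j))].
Qed.

Definition dil_rel {H K : hilbertType R} (u : 'I_d -> H -> H) (c : R)
    (v : 'I_d -> K -> K) (J : H -> K) : Prop :=
  isom J /\ forall i x x', hdot (u i x) x' = c%:C * hdot (v i (J x)) (J x').

Lemma dil_rel_total (X : Type) (H K : hilbertType R) (u : 'I_d -> H -> H) (c : R)
    (v : 'I_d -> K -> K) (J : H -> K) (x : X -> H) :
  (forall i, unitary_op (u i)) -> (forall i, unitary_op (v i)) -> isom J ->
  total_family x ->
  (forall l i j, hdot (u l (x i)) (x j) = c%:C * hdot (v l (J (x i))) (J (x j))) ->
  dil_rel u c v J.
Proof.
move=> uu uv iJ tx h; split=> // l; have bJ := isom_bop iJ; have bJ' := bop_adj bJ.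
have bu := unitary_bop (uu l); have bv := unitary_bop (uv l).
have aJ y z : hdot y (J z) = hdot (adj J y) z.
  by rewrite hdotC (adj2_hdot _ _ bJ.1 (adjP bJ)) -hdotC.
have -> : u l = c%:C *: (adj J \o v l \o J).
  apply: (bop_ext tx) => // [|i]; first by apply: bopZ; do 2! apply: bop_comp => //.
  apply: (hdot_ext tx) => j; rewrite hdotC [in RHS]hdotC; congr (_^*%C).
  by rewrite h fctE /= hdotZl aJ.
by move=> y z; rewrite fctE /= hdotZl aJ.
Qed.

(** The space [Z] is spanned by symbols [(word, n)] standing for the fields
    [y |-> wev v word (J (y n))] on the ball, with averaged Gram matrix. Prepending a letter is
    isometric because it is so at each [y]; averaging squared norms gives [norm_dom v' v]; and
    symbols with the empty word are an isometric image of the sequence [x], since the mean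
    reproduces the pairings of [w]. *)
Lemma transfer (d0 : (0 < d)%N) (H K L : hilbertType R) (u : 'I_d -> H -> H)
    (v : 'I_d -> K -> K) (w : 'I_d -> L -> L) (J : H -> K) (c : R) :
  (forall i, unitary_op (u i)) -> (forall i, unitary_op (v i)) ->
  (forall i, unitary_op (w i)) -> separable L ->
  dil_rel u c v J -> tuple_equiv u w ->
  exists (Z : hilbertType R) (v' : 'I_d -> Z -> Z) (J' : L -> Z),
    [/\ separable Z, forall i, unitary_op (v' i), norm_dom v' v & dil_rel w c v' J'].
Proof.
move=> uu uv uw sL [iJ hJ] e.
have bv i := unitary_bop (uv i).
have [x [tx hx]] := separable_scaled_seq sL.
have [m [m1 m2 mE]] := mean_of_equiv d0 uu uw e hx.
pose X := (word * nat)%type.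
pose kv (a : X) (y : yball H) : K := wev v a.1 (J (sval y a.2)).
have bkv a : exists M, forall y, nrm (kv a y) <= M.
  by exists 1 => y; rewrite /kv (wev_isom _ uv).2 iJ.2 yball_le.
have [Z [k [tk kK kn]]] := mean_kolmogorov m1 m2 bkv.
have k_ext a b : (forall y, kv a y = kv b y) -> k a = k b.
  move=> ab; apply: (hdot_ext tk) => z; rewrite !kK; congr meanC.
  by apply/funext => y; rewrite ab.
have /choice[T hT] l : exists T : Z -> Z, isom T /\
    forall a, T (k a) = k (l :: a.1, a.2).
  apply: isom_extension => // a b; rewrite !kK; congr meanC; apply/funext => y.
  by rewrite /kv /= isom_hdot//; exact: ltr_isom.
have iT l : isom (T l) by have [] := hT l.
have Tk l a : T l (k a) = k (l :: a.1, a.2) by have [_ ->] := hT l.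
have TT l : T l \o T (flip l) = id.
  apply: (bop_ext tk); [by apply: bop_comp; exact: isom_bop|exact: bop_id|].
  move=> a; rewrite /= !Tk /=; apply: k_ext => y.
  by rewrite /kv /= ltr_flip.
pose v' i := T (i, false).
have uv' i : unitary_op (v' i).
  by apply: (isom_unitary (iT _) (iT (i, true))); [exact: TT|exact: (TT (i, true))].
have ltrE l : ltr v' l = T l.
  case: l => i []; rewrite /ltr //=; apply: adj_eq; first exact: (isom_bop (iT _)).
  move=> y z; rewrite -(isom_rdot _ _ (iT (i, true))).
  by have := congr1 (@^~ y) (TT (i, true)) => /= ->.
have wevE q a : wev v' q (k a) = k (q ++ a.1, a.2).
  by elim: q => [|l q IH]; [case: a|rewrite /= IH ltrE Tk].
have bv' i := unitary_bop (uv' i).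
have dom : norm_dom v' v.
  move=> p M M0 hM; apply: (total_bound tk) => // [|s]; first exact: pev_bop.
  pose s' := [seq (q.1 * a.1, (q.2 ++ a.2.1, a.2.2)) | q <- p, a <- s].
  have lc (V : hilbertType R) (f : 'I_d -> V -> V) (h : X -> V) : (forall i, bop (f i)) ->
      (forall q a, wev f q (h a) = h (q ++ a.1, a.2)) ->
      pev f p (lcomb h s) = lcomb h s'.
    move=> bf hf; rewrite /pev /s' /lcomb big_allpairs_dep /=; apply: eq_bigr => q _.
    rewrite (linP_sum (wev_bop bf q.2).1) scaler_sumr; apply: eq_bigr => a _.
    by rewrite (linPZ (wev_bop bf q.2).1) scalerA hf.
  rewrite (lc _ _ k)//; have [b1 n1] := kn s'; have [b2 n2] := kn s.
  rewrite nrm_sqrtP ?mulr_ge0 ?nrm_ge0// exprMn n1 n2 -(meanZ m1)//.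
  apply: (mean_mono m1 m2) => // [|y]; first exact: bdfZ.
  rewrite -(lc _ v (kv^~ y))//; last by move=> q a; rewrite /kv wev_cat.
  by rewrite -exprMn ler_pXn2r ?nnegrE ?mulr_ge0 ?nrm_ge0.
(* The mean is known on real parts; the imaginary part for [p] is the real part for [- 'i] times
   [p]. *)
have pair p i j : meanC m (fun y : yball H => hdot (pev u p (sval y i)) (sval y j)) =
    hdot (pev w p (x i)) (x j).
  have [_ h1] := mE p i j; have [_ h2] := mE (scl (- 'i) p) i j.
  have imE (V : hilbertType R) (f : 'I_d -> V -> V) (a b : V) :
      rdot (pev f p a) ('i *: b) = rdot (pev f (scl (- 'i) p) a) b.
    by rewrite pev_scl fctE scaleNr rdotNl rdot_il opprK.
  rewrite [RHS]hdotE imE -h1 -h2 /meanC; congr (_ +i* m _).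
  by apply/funext => y; rewrite hdotE /= imE.
have [i j|J' [iJ' J'k]] := isom_extension (f := fun i => k ([::], i)) tx.
  rewrite kK -[x i in RHS](congr1 (@^~ (x i)) (pev1 w [::])) -pair.
  congr meanC; apply/funext => y; rewrite /kv /= isom_hdot// pev1.
  by [].
exists Z, v', J'; split=> //.
  exact: separable_total tk.
apply: (dil_rel_total uw uv' iJ' tx) => l i j.
rewrite !J'k -[v' l]/(T _) Tk kK -meanCZ//; last exact: bdc_hdot bkv _ _.
have -> : w l = pev w [:: (1, [:: (l, false)])] by rewrite pev1.
rewrite -pair; congr meanC; apply/funext => y.
by rewrite /kv /= -hJ pev1.
Qed.

End Transfer.

(** * Direct sums of tuples and mutual dilations *)

Section SumTuples.
Context {R : realType} {d : nat}.
Local Notation C := R[i].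

Lemma total_reindex (X X' : Type) (H : hilbertType R) (k : X -> H) (h : X' -> H) :
  total_family k -> (forall x, exists x', h x' = k x) -> total_family h.
Proof.
move=> tk /choice[f hf] y e e0; have [s hs] := tk y e e0.
exists [seq (q.1, f q.2) | q <- s]; rewrite lcomb_map.
by have -> : h \o f = k by apply/funext => x; exact: hf.
Qed.

Lemma total_trans (X X' : Type) (H : hilbertType R) (k : X -> H) (h : X' -> H) :
  total_family k -> (forall x (e : R), 0 < e -> exists s, nrm (k x - lcomb h s) <= e) ->
  total_family h.
Proof.
move=> tk kh y e e0; have e2 : 0 < e / 2 by rewrite divr_gt0.
have [s hs] := tk y _ e2.
have [t ht] : exists t, nrm (lcomb k s - lcomb h t) <= e / 2.
  elim: s {hs} (e / 2) e2 => [|[c x] s IH] r r0.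
    by exists [::]; rewrite !lcomb_nil subrr nrm0 ltW.
  have r2 : 0 < r / 2 by rewrite divr_gt0.
  have c1 : 0 < cabs c + 1 by rewrite ltr_wpDl ?cabs_ge0.
  have [t ht] := IH _ r2; have [t' ht'] := kh x _ (divr_gt0 r2 c1).
  exists (scl c t' ++ t); rewrite lcomb_cons lcomb_cat lcomb_scl /= opprD addrACA -scalerBr.
  apply: le_trans (nrmD _ _) _; rewrite (splitr r) lerD// nrmZ.
  have := ler_wpM2l (cabs_ge0 c) ht' => /le_trans; apply.
  by rewrite mulrA ler_pdivrMr// mulrC ler_wpM2l ?lerDl// ltW.
exists t; apply: le_trans (nrm_dist _ (lcomb k s) _) _.
by rewrite (splitr e) lerD.
Qed.

Lemma dsum_separable (I : countType) (H : I -> hilbertType R) (Y : hilbertType R)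
    (iota : forall i, H i -> Y) :
  is_dsum iota -> (forall i, separable (H i)) -> separable Y.
Proof.
move=> dY sH.
have /choice[s hs] i : exists s : nat -> Y, forall z (e : R), 0 < e ->
    exists n, nrm (iota i z - s n) <= e.
  have [s hs] := separable_seq (sH i); exists (fun n => iota i (s n)) => z e e0.
  have [n hn] := hs z e e0; exists n.
  by rewrite -(linPB (dsum_lin dY i)) (dsum_nrm dY).
apply: (@separable_total _ _ _ (fun p : I * nat => s p.1 p.2)).
apply: (total_trans (dsum_total dY)) => -[i x] e e0 /=.
have [n hn] := hs i x e e0; exists [:: (1, (i, n))].
by rewrite lcomb1.
Qed.

Section Sum.
Context {I : eqType} (H : I -> hilbertType R) (Y : hilbertType R).
Context (iota : forall i, H i -> Y) (u : forall i, 'I_d -> H i -> H i).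
Arguments iota : clear implicits.
Arguments u : clear implicits.
Hypothesis dY : is_dsum iota.
Hypothesis uu : forall i l, unitary_op (u i l).

Lemma dsum_tuple : exists U : 'I_d -> Y -> Y,
  [/\ forall l, unitary_op (U l), forall l i x, U l (iota i x) = iota i (u i l x) &
      forall p i x, pev U p (iota i x) = iota i (pev (u i) p x)].
Proof.
have /choice[T hT] (lt : 'I_d * bool) : exists T : Y -> Y, isom T /\
    forall i x, T (iota i x) = iota i (ltr (u i) lt x).
  apply: dsum_isom_map => // i; exact: ltr_isom.
have iT lt : isom (T lt) by have [] := hT lt.
have TE lt i x : T lt (iota i x) = iota i (ltr (u i) lt x) by have [_ ->] := hT lt.
have TT lt : T lt \o T (flip lt) = id.
  apply: (bop_ext (dsum_total dY)); [by apply: bop_comp; exact: isom_bop|exact: bop_id|].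
  by move=> [i x] /=; rewrite !TE ltr_flip.
pose U l := T (l, false).
have uU l : unitary_op (U l).
  by apply: (isom_unitary (iT _) (iT (l, true))); [exact: TT|exact: (TT (l, true))].
have ltrE lt : ltr U lt = T lt.
  case: lt => l []; rewrite /ltr //=; apply: adj_eq; first exact: (isom_bop (iT _)).
  move=> y z; rewrite -(isom_rdot _ _ (iT (l, true))).
  by have := congr1 (@^~ y) (TT (l, true)) => /= ->.
have wE w i x : wev U w (iota i x) = iota i (wev (u i) w x).
  by elim: w => [//|lt w IH] /=; rewrite IH ltrE TE.
exists U; split=> //; first by move=> l i x; rewrite /U TE.
move=> p i x; rewrite /pev (linP_sum (dsum_lin dY i)); apply: eq_bigr => q _.
by rewrite wE (linPZ (dsum_lin dY i)).
Qed.

Lemma dsum_norm_dom (U : 'I_d -> Y -> Y) (K : hilbertType R) (v : 'I_d -> K -> K) :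
  (forall l, unitary_op (U l)) ->
  (forall p i x, pev U p (iota i x) = iota i (pev (u i) p x)) ->
  (forall i, norm_dom (u i) v) -> norm_dom U v.
Proof.
move=> uU UE uv p M M0 hM.
have bu i l := unitary_bop (uu i l).
have [T [lT nT TE]] := dsum_map dY dY M0
  (fun i => (pev_bop (bu i) p).1) (fun i => uv i p M M0 hM).
suff -> : pev U p = T by [].
apply: (bop_ext (dsum_total dY)); first by apply: pev_bop => l; exact: unitary_bop.
  by split=> //; exists M.
by move=> [i x] /=; rewrite UE TE.
Qed.

Lemma dsum_norm_dom_comp (U : 'I_d -> Y -> Y) i :
  (forall p i x, pev U p (iota i x) = iota i (pev (u i) p x)) -> norm_dom (u i) U.
Proof.
by move=> UE p M M0 hM x; rewrite -(dsum_nrm dY) -UE -(dsum_nrm dY x); exact: hM.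
Qed.

End Sum.

(** Pairing [J (U i x)] with [J x'] removes the projection, because its error is orthogonal to the
    range of [J]. *)
Lemma dil_rel_of_dilates (u v : utuple R d) c : dilates u c v ->
  exists (U V : utuple R d) (J : uspace U -> uspace V),
    [/\ tuple_equiv U u, tuple_equiv V v & dil_rel U c V J].
Proof.
move=> [U [V [J [P [[eU eV] lJ hJ oP PE]]]]]; exists U, V, J; split=> //; split.
  split=> // x; apply/eqP; rewrite -(@eqrXn2 _ 2) ?nrm_ge0//; apply/eqP/complexI.
  by rewrite -!hdotxx hJ.
move=> i x x'; rewrite -hJ PE -hdotZl.
have [_ /(_ (J x'))] := oP (c%:C *: V i (J x)).
by rewrite linearBl => /(_ (ex_intro2 _ _ x' I erefl))/eqP; rewrite subr_eq0 => /eqP.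
Qed.

Lemma utuple_unitary (u : utuple R d) i : unitary_op (u i).
Proof. by have [_ _] := uopP u. Qed.

Lemma utuple_separable (u : utuple R d) : separable (uspace u).
Proof. by have [] := uopP u. Qed.

Lemma utuple_neq0 (u : utuple R d) : exists x : uspace u, x != 0.
Proof. by have [] := uopP u. Qed.

Hypothesis d0 : (0 < d)%N.

Lemma utuple_equivP (u v : utuple R d) :
  tuple_equiv u v <-> norm_dom u v /\ norm_dom v u.
Proof. apply: tuple_equivP => //; exact: utuple_unitary. Qed.

(** [transfer] bounds the norms of the new tuple only from above by those of [V1]. Adding [V1] as a
    second summand gives the reverse bound, and also a nonzero space. *)
Lemma dilation_step (u v : utuple R d) c : dilates u c v ->
  forall U : utuple R d, tuple_equiv U u -> exists V : utuple R d,
    tuple_equiv V v /\ exists J : uspace U -> uspace V, dil_rel U c V J.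
Proof.
move=> /dil_rel_of_dilates[U1 [V1 [J1 [/utuple_equivP[e1 e1'] /utuple_equivP[e2 e2'] hJ]]]].
move=> U /utuple_equivP[e3 e3'].
have eU : tuple_equiv U1 U.
  by apply/utuple_equivP; split; [apply: norm_dom_trans e1 e3'|apply: norm_dom_trans e3 e1'].
have [Z [v' [J [sZ uv' dv' hJ']]]] := transfer d0 (utuple_unitary U1) (utuple_unitary V1)
  (utuple_unitary U) (utuple_separable U) hJ eU.
pose F (b : bool) : hilbertType R := if b then Z else uspace V1.
pose w (b : bool) : 'I_d -> F b -> F b :=
  match b as b0 return 'I_d -> F b0 -> F b0 with true => v' | false => @uop R d V1 end.
have uw b l : unitary_op (w b l) by case: b; [exact: uv'|exact: utuple_unitary].
have [Y [iota dY]] := dsum_exists F.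
have [W [uW WE WpE]] := dsum_tuple dY uw.
have sY : separable Y by apply: (dsum_separable dY) => -[//|]; exact: utuple_separable.
have [x x0] := utuple_neq0 V1.
have nY : exists y : Y, y != 0.
  by exists (iota false x); rewrite -nrm_gt0 (dsum_nrm dY) nrm_gt0.
have tW : unitary_tuple W by split.
exists (UTuple tW); split.
  apply/utuple_equivP; split=> /=.
    apply: (dsum_norm_dom dY uw uW WpE) => -[]; last exact: e2.
    exact: norm_dom_trans dv' e2.
  by apply: norm_dom_trans e2' _; exact: (dsum_norm_dom_comp dY (i := false) WpE).
have iJ : isom (iota true \o J) by apply: isom_comp; [exact: (dsum_isom dY true)|exact: hJ'.1].
exists (iota true \o J); split=> // i y y' /=.
by rewrite hJ'.2 WE (dsum_hdot dY).
Qed.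

(** Iterating [dilation_step] gives a chain U_0, V_0, U_1, V_1, ... in which each term dilates to
    the next; the sums of all U_n and of all V_n then dilate to each other. *)
Lemma mutual_dilation (u v : utuple R d) c c' : dilates u c v -> dilates v c' u ->
  exists (U V : utuple R d) (J : uspace U -> uspace V) (J' : uspace V -> uspace U),
    [/\ tuple_equiv U u, tuple_equiv V v, dil_rel U c V J & dil_rel V c' U J'].
Proof.
move=> duv dvu.
(* The equivalence is put under the existential so that [f] is defined on all tuples and can be
   iterated. *)
have /choice[f hf] (U : utuple R d) : exists V : utuple R d, tuple_equiv U u ->
    tuple_equiv V v /\ exists J : uspace U -> uspace V, dil_rel U c V J.
  have [/(dilation_step duv)[V hV]|nU] := pselect (tuple_equiv U u); first by exists V.
  by exists U.
have /choice[g hg] (V : utuple R d) : exists U : utuple R d, tuple_equiv V v ->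
    tuple_equiv U u /\ exists J : uspace V -> uspace U, dil_rel V c' U J.
  have [/(dilation_step dvu)[U hU]|nV] := pselect (tuple_equiv V v); first by exists U.
  by exists V.
pose Us n := iter n (g \o f) u.
pose Vs n := f (Us n).
have eUs n : tuple_equiv (Us n) u.
  elim: n => [|n IH]; first by apply/utuple_equivP; split; exact: norm_dom_refl.
  by have [/hg[]] := hf _ IH.
have eVs n : tuple_equiv (Vs n) v by have [] := hf _ (eUs n).
pose J n : uspace (Us n) -> uspace (Vs n) := sval (cid (hf _ (eUs n)).2).
have hJ n : dil_rel (Us n) c (Vs n) (J n) := svalP (cid (hf _ (eUs n)).2).
pose J' n : uspace (Vs n) -> uspace (Us n.+1) := sval (cid (hg _ (eVs n)).2).
have hJ' n : dil_rel (Vs n) c' (Us n.+1) (J' n) := svalP (cid (hg _ (eVs n)).2).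
have sum (Ws : nat -> utuple R d) (w : utuple R d) : (forall n, tuple_equiv (Ws n) w) ->
    exists (W : utuple R d) (iota : forall n, uspace (Ws n) -> uspace W),
      [/\ is_dsum iota, tuple_equiv W w &
          forall l n x, W l (iota n x) = iota n (Ws n l x)].
  move=> eWs; have uWs n l := utuple_unitary (Ws n) l.
  have [Y [iota dY]] := dsum_exists (fun n => uspace (Ws n)).
  have [W [uW WE WpE]] := dsum_tuple dY uWs.
  have sY : separable Y by apply: (dsum_separable dY) => n; exact: utuple_separable.
  have [x x0] := utuple_neq0 (Ws 0).
  have nY : exists y : Y, y != 0.
    by exists (iota 0 x); rewrite -nrm_gt0 (dsum_nrm dY) nrm_gt0.
  have tW : unitary_tuple W by split.
  exists (UTuple tW), iota; split=> //; apply/utuple_equivP; split=> /=.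
    by apply: (dsum_norm_dom dY uWs uW WpE) => n; have /utuple_equivP[] := eWs n.
  have /utuple_equivP[_ h] := eWs 0.
  by apply: norm_dom_trans h _; exact: (dsum_norm_dom_comp dY (i := 0) WpE).
have [U [iota [dU eU UE]]] := sum _ _ eUs.
have [V [kappa [dV eV VE]]] := sum _ _ eVs.
have [JJ [iJJ JJE]] := dsum_isom_map dU dV (fun n => (hJ n).1).
(* The copy n of V goes to the copy n + 1 of U; the shift leaves the copy 0 outside the range and
   preserves orthogonality. *)
have [[n x] [k y]|JJ' [iJJ' JJ'E]] := isom_extension
    (f := fun p : {n & uspace (Vs n)} => iota (tag p).+1 (J' (tag p) (tagged p)))
    (dsum_total dV).
  have [nk|nk] := eqVneq n k; last by rewrite (dsum_ortho dU) ?(dsum_ortho dV).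
  move: y; rewrite -nk => y /=; rewrite (dsum_hdot dU) (dsum_hdot dV).
  exact: isom_hdot (hJ' n).1.
exists U, V, JJ, JJ'; split=> //.
- apply: (dil_rel_total (utuple_unitary U) (utuple_unitary V) iJJ (dsum_total dU)).
  move=> l [n x] [k y] /=; rewrite !JJE UE VE.
  have [nk|nk] := eqVneq n k.
    move: y; rewrite -nk => y; rewrite (dsum_hdot dU) (dsum_hdot dV).
    exact: (hJ n).2.
  by rewrite (dsum_ortho dU) ?(dsum_ortho dV) ?mulr0.
- apply: (dil_rel_total (utuple_unitary V) (utuple_unitary U) iJJ' (dsum_total dV)).
  move=> l [n x] [k y] /=.
  have JE m z : JJ' (kappa m z) = iota m.+1 (J' m z).
    exact: (JJ'E (Tagged (fun n => uspace (Vs n)) z)).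
  rewrite !JE UE VE; have [nk|nk] := eqVneq n k.
    move: y; rewrite -nk => y; rewrite (dsum_hdot dU) (dsum_hdot dV).
    exact: (hJ' n).2.
  by rewrite (dsum_ortho dU) ?(dsum_ortho dV) ?mulr0.
Qed.

End SumTuples.

(** * From mutual dilations to nearby representatives *)

Section Rotation.
Context {R : realType}.
Local Notation C := R[i].

(* In the span of the ranges of [J] and of the normalization of
   [D = v^* J u - J / c], the operator [rot 1] below is the plane rotation taking
   [J x] to [v^* J u x]; it is the identity on the orthogonal complement. *)
Lemma rotation (H K : hilbertType R) (u : H -> H) (v : K -> K) (J : H -> K) (c : R) :
  1 <= c -> unitary_op u -> unitary_op v -> isom J ->
  (forall x x', hdot (u x) x' = c%:C * hdot (v (J x)) (J x')) ->
  exists z, [/\ unitary_op z, forall x, z (J x) = J (u x) &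
                apx v z (2 * Num.sqrt (1 - c ^- 2))].
Proof.
move=> c1 uu uv iJ rel; have c0 : 0 < c by apply: lt_le_trans c1.
pose s := c^-1; have s0 : 0 < s by rewrite invr_gt0.
have s1 : s <= 1 by rewrite invf_le1.
have cs : c * s = 1 by rewrite mulfV ?gt_eqF.
have /unitary_opE[bv vv' v'v] := uv; set vs := adj v in vv' v'v.
have iu := unitary_isom uu; have iv := unitary_isom uv; have [bJ lJ] := (isom_bop iJ, iJ.1).
have vvs x : v (vs x) = x by have := congr1 (@^~ x) v'v.
have vsv x : vs (v x) = x by have := congr1 (@^~ x) vv'.
have ivs : isom vs.
  split; first exact: (bop_adj bv).1.
  by move=> x; rewrite -iv.2 vvs.
have rr x x' : rdot (v (J x)) (J x') = s * rdot (u x) x'.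
  apply: (mulfI (lt0r_neq0 c0)); rewrite mulrA cs mul1r /rdot rel.
  by case: (hdot (v _) _) => a b /=; ring.
pose D x := vs (J (u x)) - s%:C *: J x.
have bD : bop D.
  apply: (bopB (A := vs \o J \o u)); last exact: bopZ.
  exact: (bop_comp (bop_comp (isom_bop ivs) bJ) (isom_bop iu)).
have lD := bD.1.
have cross x y : rdot (vs (J (u x))) (J y) = s * rdot x y.
  by rewrite -(isom_rdot _ _ iv) vvs rdotC rr (isom_rdot _ _ iu) rdotC.
have DJ x y : rdot (D x) (J y) = 0.
  by rewrite rdotBl rdotZl cross (isom_rdot _ _ iJ) subrr.
have DD x y : rdot (D x) (D y) = (1 - s ^+ 2) * rdot x y.
  rewrite {1}/D rdotBl rdotZl [rdot (J x) _]rdotC DJ mulr0 subr0 rdotBr rdotZr cross.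
  by rewrite !isom_rdot//; ring.
have [aJ aD] := (adjP bJ, adjP bD); set Ja := adj J in aJ; set Da := adj D in aD.
have [lJa lDa] := ((bop_adj bJ).1, (bop_adj bD).1); rewrite -/Ja in lJa; rewrite -/Da in lDa.
have JaJ x : Ja (J x) = x by have := congr1 (@^~ x) (isom_adjK iJ).
have DaJ x : Da (J x) = 0.
  by apply: rdot_eq0 => y; rewrite rdotC -aD DJ.
(* The diagonal entry [s - 1] of rotation minus identity acts on normalized [D], and
   [D^* D = 1 - s^2]; the quotient [(s - 1) / (1 - s^2)] is [- k], which stays meaningful at
   [s = 1]. *)
pose k := (1 + s)^-1; have k0 : 0 < k by rewrite invr_gt0 addr_gt0.
have ks : k * (1 + s) = 1 by rewrite mulVf// gt_eqF// addr_gt0.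
have h1 : (1 - s ^+ 2) * k = 1 - s.
  by transitivity ((1 - s) * (k * (1 + s))); [ring|rewrite ks mulr1].
have h2 : (1 - s) * k = 2 * k - 1.
  by transitivity (2 * k - k * (1 + s)); [ring|rewrite ks].
(* The sign [e = 1] or [-1] is the direction of rotation; [rot (- e)] is the adjoint and inverse of
   [rot e]. *)
pose al (e : R) y : H := (s - 1)%:C *: Ja y - e%:C *: Da y.
pose be (e : R) y : H := e%:C *: Ja y - k%:C *: Da y.
pose rot e y := y + (J (al e y) + D (be e y)).
(* Writing [w] for the increment [rot e y - y], the formulas give [2 rdot y w + |w|^2 = 0], so
   [rot e] is isometric; the second also measures the distance to the identity. *)
have wE e y : e ^+ 2 = 1 ->
    [/\ rdot y (J (al e y) + D (be e y)) =
          (s - 1) * nrm (Ja y) ^+ 2 - k * nrm (Da y) ^+ 2 &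
        nrm (J (al e y) + D (be e y)) ^+ 2 =
          2 * (1 - s) * nrm (Ja y) ^+ 2 + 2 * k * nrm (Da y) ^+ 2].
  move=> e1; set a := Ja y; set b := Da y; split.
    rewrite rdotDr [rdot y (J _)]rdotC aJ [rdot y (D _)]rdotC aD -/a -/b.
    by rewrite /al /be -/a -/b !(rdotBl, rdotZl) !rdotxx (rdotC b a); ring.
  rewrite nrm_sqD [rdot (J _) _]rdotC DJ mulr0 addr0 iJ.2 -[nrm (D _) ^+ 2]rdotxx DD rdotxx.
  rewrite !nrm_sqB !nrmZr !exprMn !real_normK ?num_real// !(rdotZl, rdotZr) e1.
  rewrite -/a -/b; set A := nrm a ^+ 2; set B := rdot a b; set E := nrm b ^+ 2.
  have -> : (s - 1) ^+ 2 * A - 2 * (e * ((s - 1) * B)) + 1 * E +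
      (1 - s ^+ 2) * (1 * A - 2 * (e * (k * B)) + k ^+ 2 * E) =
    ((s - 1) ^+ 2 + 1 - s ^+ 2) * A - 2 * e * B * ((s - 1) + (1 - s ^+ 2) * k) +
    (1 + (1 - s ^+ 2) * k * k) * E by ring.
  by rewrite h1 h2; ring.
have lcmb (p q : C) : linear (fun y => p *: Ja y - q *: Da y).
  move=> a x y; rewrite lJa lDa !scalerDr !scalerA scalerN !scalerA ![_ * a]mulrC opprD.
  by rewrite addrACA.
have lrot e : linear (rot e).
  move=> a x y; rewrite /rot (lcmb _ _ a x y : al e _ = a *: al e x + al e y).
  rewrite (lcmb _ _ a x y : be e _ = a *: be e x + be e y) lJ lD.
  move: (J _) (J _) (D _) (D _) => p1 p2 p3 p4.
  by rewrite 2!scalerDr (addrACA (a *: p2)) (addrACA (a *: x)).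
have irot e : e ^+ 2 = 1 -> isom (rot e).
  move=> e1; split; first exact: lrot.
  move=> y; apply/eqP; rewrite -(@eqrXn2 _ 2) ?nrm_ge0//; apply/eqP.
  by have [w1 w2] := wE e y e1; rewrite nrm_sqD w1 w2; ring.
have JD y a b : rdot (J a + D b) y = rdot a (Ja y) + rdot b (Da y).
  by rewrite rdotDl aJ aD.
have arot e : adj2 (rot e) (rot (- e)).
  move=> x y; rewrite /rot rdotDl rdotDr JD (rdotC x (_ + _)) JD /al /be.
  rewrite !(rdotBl, rdotZl) (rdotC (Ja y)) (rdotC (Da y)) (rdotC (Ja y)) (rdotC (Da y)).
  by ring.
have rotK e : e ^+ 2 = 1 -> rot (- e) \o rot e = id.
  by move=> e1; rewrite -(isom_adjK (irot e e1)) (adj_eq (isom_bop (irot e e1)) (arot e)).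
have e1 : (1 : R) ^+ 2 = 1 by rewrite expr1n.
have e2 : (-1 : R) ^+ 2 = 1 by rewrite sqrrN expr1n.
exists (v \o rot 1); split.
- apply: (isom_unitary (B := rot (-1) \o vs)).
  + by apply: isom_comp => //; exact: irot.
  + by apply: isom_comp => //; exact: irot.
  + apply/funext => x /=.
    have := congr1 (@^~ (vs x)) (rotK (-1) e2); rewrite opprK /= => ->.
    by rewrite vvs.
  + apply/funext => x /=; rewrite vsv.
    by have := congr1 (@^~ x) (rotK 1 e1).
- move=> x /=; rewrite /rot /al /be DaJ JaJ !scaler0 !subr0 scale1r (linPZ lJ).
  by rewrite /D rmorphB scalerBl scale1r addrA (addrC (J x)) subrK addrC subrK vvs.
- move=> y /=; rewrite -(linPB iv.1) iv.2 nrmB /rot addrC addKr.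
  have q0 : 0 <= 1 - c ^- 2.
    by rewrite subr_ge0 -exprVn -/s -[leRHS](expr1n _ 2) ler_pXn2r ?nnegrE// ltW.
  rewrite nrm_sqrtP ?mulr_ge0 ?sqrtr_ge0 ?nrm_ge0//.
  have [_ ->] := wE 1 y e1; rewrite !exprMn sqr_sqrtr// -exprVn -/s.
  (* With [k (1 - s^2) = 1 - s], both terms are at most [2 (1 - s) |y|^2], and
     [4 (1 - s) <= 4 (1 - s^2)]. *)
  have ha : nrm (Ja y) ^+ 2 <= nrm y ^+ 2.
    rewrite ler_pXn2r ?nnegrE ?nrm_ge0// -[leRHS]mul1r.
    by apply: (adj2_le ler01 _ aJ) => x; rewrite iJ.2 mul1r.
  have hd : nrm (Da y) ^+ 2 <= (1 - s ^+ 2) * nrm y ^+ 2.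
    have q1 : 0 <= 1 - s ^+ 2 by move: q0; rewrite -exprVn.
    have := adj2_le (sqrtr_ge0 (1 - s ^+ 2)) _ aD => /(_ _ y) h.
    rewrite -[X in X * _](sqr_sqrtr q1) -exprMn ler_pXn2r ?nnegrE ?nrm_ge0//; last first.
      by rewrite mulr_ge0 ?sqrtr_ge0 ?nrm_ge0.
    apply: h => x; rewrite nrm_sqrtP ?mulr_ge0 ?sqrtr_ge0 ?nrm_ge0//.
    by rewrite exprMn sqr_sqrtr// -!rdotxx DD.
  have h3 := ler_wpM2l (ltW k0) hd; rewrite [leRHS]mulrA (mulrC k (1 - _)) h1 in h3.
  have s10 : 0 <= 1 - s by lra.
  have h4 := ler_wpM2l s10 ha.
  have h5 : (1 - s) * nrm y ^+ 2 <= (1 - s ^+ 2) * nrm y ^+ 2.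
    by apply: ler_wpM2r; [exact: sqr_ge0|nra].
  move: h3 h4 h5; rewrite -!mulrA; move: (k * _) (_ * nrm (Ja y) ^+ 2) => p1 p2.
  by move: (_ * nrm y ^+ 2) (_ * nrm y ^+ 2) => p3 p4; lra.
Qed.

End Rotation.

(** * The Hilbert hotel and perturbed representatives *)

Section Swindle.
Context {R : realType} {d : nat}.
Local Notation C := R[i].

Lemma dsum_apx (I : eqType) (H : I -> hilbertType R) (Y : hilbertType R)
    (iota : forall i, H i -> Y) (a b : forall i, H i -> H i) (A B : Y -> Y) (e : R) :
  is_dsum iota -> 0 <= e -> bop A -> bop B ->
  (forall i, linear (a i)) -> (forall i, linear (b i)) ->
  (forall i x, A (iota i x) = iota i (a i x)) ->
  (forall i x, B (iota i x) = iota i (b i x)) ->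
  (forall i, apx (a i) (b i) e) -> apx A B e.
Proof.
move=> dY e0 bA bB la lb AE BE ab.
have lab i : linear (fun x => a i x - b i x).
  by move=> c x y; rewrite la lb opprD addrACA scalerBr.
have [T [lT nT TE]] := dsum_map dY dY e0 lab ab.
suff E : A - B = T by move=> x; rewrite -[_ - _]/((A - B) x) E.
apply: (bop_ext (dsum_total dY)); [exact: bopB|by split=> //; exists e|].
move=> [i x]; change (A (iota i x) - B (iota i x) = T (iota i x)).
by rewrite AE BE TE (linPB (dsum_lin dY i)).
Qed.

Lemma pev_intertwine (Y Z : hilbertType R) (w : 'I_d -> Y -> Y) (v : 'I_d -> Z -> Z)
    (T : Y -> Z) :
  (forall l, unitary_op (w l)) -> (forall l, unitary_op (v l)) -> linear T ->
  (forall l x, T (w l x) = v l (T x)) -> forall p x, T (pev w p x) = pev v p (T x).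
Proof.
move=> uw uv lT Twv p x.
have Tltr l y : T (ltr w l y) = ltr v l (T y).
  case: l => l [|]; rewrite /ltr //=.
  have /unitary_opE[_ hv _] := uv l; have /unitary_opE[_ _ hw] := uw l.
  have := congr1 (@^~ (T (adj (w l) y))) hv => /= <-; rewrite -Twv.
  by have := congr1 (@^~ y) hw => /= ->.
rewrite /pev (linP_sum lT); apply: eq_bigr => q _; rewrite (linPZ lT); congr (_ *: _).
by elim: q.2 => [//|l s IH] /=; rewrite Tltr IH.
Qed.

Definition alternating (H K : hilbertType R) (p : nat * bool) : hilbertType R :=
  if p.2 then K else H.

(* Hilbert hotel: the copy [n] of [K] splits into the range of [J], sent to copy
   [2 n + 1], and its complement, which stays; the copy [n] of [H] fills the
   range of [J] in copy [2 n]. *)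
Lemma hotel (H K : hilbertType R) (J : H -> K) (Y Z : hilbertType R)
    (iota : forall p, alternating H K p -> Y) (kappa : nat -> K -> Z) :
  isom J -> is_dsum iota -> is_dsum kappa ->
  exists S : Y -> Z, [/\ isom S, S \o adj S = id,
    forall n x, S (iota (n, false) x) = kappa n.*2 (J x) &
    forall n y, S (iota (n, true) y) =
      kappa n (y - J (adj J y)) + kappa n.*2.+1 (J (adj J y))].
Proof.
move=> iJ dY dZ; have bJ := isom_bop iJ; have bJa := bop_adj bJ.
have aJ := adjP bJ.
have JaJ x : adj J (J x) = x by have := congr1 (@^~ x) (isom_adjK iJ).
have lk n := dsum_lin dZ n.
pose Q y := y - J (adj J y).
have QK y : Q y + J (adj J y) = y by exact: subrK.
have JaQ y : adj J (Q y) = 0 by rewrite /Q (linPB bJa.1) JaJ subrr.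
have kE a b x y : hdot (kappa a x) (kappa b y) = if a == b then hdot x y else 0.
  by have [<-|ab] := eqVneq a b; [exact: (dsum_hdot dZ)|exact: (dsum_ortho dZ)].
have hQJ y x : hdot (Q y) (J x) = 0.
  by rewrite hdotC (adj2_hdot _ _ bJ.1 aJ) JaQ -hdotC linear0l.
have hJQ y x : hdot (J x) (Q y) = 0 by rewrite (adj2_hdot _ _ bJ.1 aJ) JaQ linear0r.
pose f (q : {p & alternating H K p}) : Z :=
  match q with
  | existT (n, true) y => kappa n (Q y) + kappa n.*2.+1 (J (adj J y))
  | existT (n, false) x => kappa n.*2 (J x)
  end.
have dbl m n : (m.*2 == n.*2.+1) = false.
  by apply/negbTE; apply: contraTneq isT => /(congr1 odd) /=; rewrite !odd_double.
have kQJ a b y x : hdot (kappa a (Q y)) (kappa b (J x)) = 0 by rewrite kE hQJ if_same.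
have kJQ a b y x : hdot (kappa a (J y)) (kappa b (Q x)) = 0 by rewrite kE hJQ if_same.
have [|S [iS SE]] := isom_extension (f := f) (dsum_total dY).
  move=> [[m [|]] x] [[n [|]] y] /=.
  - rewrite hdotDl !hdotDr kQJ kJQ !kE addr0 add0r eqSS (inj_eq double_inj).
    have [<-|mn] := eqVneq m n; last first.
      by rewrite (dsum_ortho dY) ?addr0// xpair_eqE (negPf mn).
    rewrite (dsum_hdot dY) -[in RHS](QK x) -[in RHS](QK y).
    by rewrite (hdotDl (Q x)) 2!(hdotDr (Q y)) hQJ hJQ addr0 add0r.
  - rewrite hdotDl kQJ kE eq_sym dbl (dsum_ortho dY) ?add0r//.
    by rewrite xpair_eqE andbF.
  - rewrite hdotDr kJQ kE dbl (dsum_ortho dY) ?add0r//.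
    by rewrite xpair_eqE andbF.
  - rewrite kE (inj_eq double_inj).
    have [<-|mn] := eqVneq m n; last first.
      by rewrite (dsum_ortho dY)// xpair_eqE (negPf mn).
    by rewrite (dsum_hdot dY) isom_hdot.
have SF n x : S (iota (n, false) x) = kappa n.*2 (J x).
  exact: (SE (existT (alternating H K) (n, false) x)).
have ST n y : S (iota (n, true) y) = kappa n (Q y) + kappa n.*2.+1 (J (adj J y)).
  exact: (SE (existT (alternating H K) (n, true) y)).
exists S; split=> //; have bS := isom_bop iS.
have SaS x : adj S (S x) = x by have := congr1 (@^~ x) (isom_adjK iS).
apply: (bop_ext (dsum_total dZ)); [exact/bop_comp/bop_adj|exact: bop_id|].
move=> [n y] /=.
suff [w <-] : exists w, S w = kappa n y by rewrite SaS.
(* The range of [J] in an odd copy is reached from a copy of [K], in an even one from a copy of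
   [H]. *)
have [w hw] : exists w, S w = kappa n (J (adj J y)).
  rewrite -[n]odd_double_half; case: (odd n); rewrite ?add1n ?add0n.
    exists (iota (n./2, true) (J (adj J y))).
    by rewrite ST /Q JaJ subrr (linP0 (lk _)) add0r.
  by exists (iota (n./2, false) (adj J y)).
exists (iota (n, true) (Q y) + w).
by rewrite (linPD iS.1) ST hw {1}/Q JaQ (linP0 bJ.1) subr0 (linP0 (lk _)) addr0 -(linPD (lk n)) QK.
Qed.

End Swindle.

Section Perturb.
Context {R : realType} {d : nat}.
Local Notation C := R[i].

(** [v'] is the infinite sum of copies of [v], carried to [Y] by the unitary [S]. Replacing [v] by
    its rotation [z] costs [e]; [S] turns the rotated sum into copies of [z] and [u], and going back
    from [z] to [v] there costs another [e], whence the factor 4. *)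
Lemma swindle (H K : hilbertType R) (u : 'I_d -> H -> H) (v : 'I_d -> K -> K) (c : R)
    (J : H -> K) (Y : hilbertType R) (iota : forall p, alternating H K p -> Y)
    (W : 'I_d -> Y -> Y) :
  1 <= c -> (forall l, unitary_op (u l)) -> (forall l, unitary_op (v l)) ->
  dil_rel u c v J -> is_dsum iota -> (forall l, unitary_op (W l)) ->
  (forall l n x, W l (iota (n, false) x) = iota (n, false) (u l x)) ->
  (forall l n y, W l (iota (n, true) y) = iota (n, true) (v l y)) ->
  exists v' : 'I_d -> Y -> Y, [/\ forall l, unitary_op (v' l), norm_dom v' v, norm_dom v v' &
    forall l, apx (v' l) (W l) (4 * Num.sqrt (1 - c ^- 2))].
Proof.
move=> c1 uu uv [iJ rel] dY uW WF WT; set e := 2 * Num.sqrt (1 - c ^- 2).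
have e0 : 0 <= e by rewrite mulr_ge0 ?sqrtr_ge0.
have /choice[z hz] l := rotation c1 (uu l) (uv l) iJ (rel l).
have uz l : unitary_op (z l) by case: (hz l).
have zJ l x : z l (J x) = J (u l x) by case: (hz l).
have vz l : apx (v l) (z l) e by case: (hz l).
have lz l := (unitary_bop (uz l)).1; have lv l := (unitary_bop (uv l)).1.
(* From [z J = J u] with [u] onto, [z] maps the range of [J] onto itself; being unitary it preserves
   the complement as well. *)
have zJa l y : z l (J (adj J y)) = J (adj J (z l y)).
  rewrite zJ; congr (J _); apply: rdot_inj => x.
  have bJ := isom_bop iJ; have iu := unitary_isom (uu l); have iz := unitary_isom (uz l).
  have /unitary_opE[_ _ /(congr1 (@^~ x)) /= <-] := uu l; set x' := adj (u l) x.
  rewrite [RHS]rdotC -(adjP bJ) -zJ (isom_rdot _ _ iz) (adjP bJ) rdotC.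
  by rewrite (isom_rdot _ _ iu) rdotC.
have [Z [kappa dZ]] := dsum_exists (fun _ : nat => K).
have [V [uV VE VpE]] := dsum_tuple dZ (fun _ => uv).
have [X [uX XE _]] := dsum_tuple dZ (fun _ => uz).
have [S [iS SS SF ST]] := hotel iJ dY dZ.
have bS := isom_bop iS; have laS := (bop_adj bS).1.
have SaS y : S (adj S y) = y by have := congr1 (@^~ y) SS.
have aSS y : adj S (S y) = y by have := congr1 (@^~ y) (isom_adjK iS).
have iaS : isom (adj S) by split=> // y; rewrite -iS.2 SaS.
pose f (p : nat * bool) : 'I_d -> alternating H K p -> alternating H K p :=
  match p as p0 return 'I_d -> alternating H K p0 -> alternating H K p0 with
  | (_, true) => z | (_, false) => u end.
pose g (p : nat * bool) : 'I_d -> alternating H K p -> alternating H K p :=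
  match p as p0 return 'I_d -> alternating H K p0 -> alternating H K p0 with
  | (_, true) => v | (_, false) => u end.
have uf p l : unitary_op (f p l) by case: p => n [].
have ug p l : unitary_op (g p l) by case: p => n [].
have [W' [uW' W'E _]] := dsum_tuple dY uf.
have W'S l y : X l (S y) = S (W' l y).
  apply: (congr1 (@^~ y) (_ : X l \o S = S \o W' l)).
  apply: (bop_ext (dsum_total dY)); try by apply: bop_comp => //; exact: unitary_bop.
  move=> [[n []] x] /=.
    rewrite W'E !ST (linPD (unitary_bop (uX l)).1) !XE (linPB (lz l)) /=.
    by rewrite zJa.
  by rewrite W'E !SF XE zJ.
have W'W l : apx (W' l) (W l) e.
  apply: (dsum_apx (a := fun p => f p l) (b := fun p => g p l) dY e0).
  - exact: unitary_bop.
  - exact: unitary_bop.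
  - by move=> p; exact: (unitary_bop (uf p l)).1.
  - by move=> p; exact: (unitary_bop (ug p l)).1.
  - by [].
  - by move=> [n []] x /=.
  - move=> [n []] /=; first exact: apx_sym.
    exact: (apx_le e0 (apx_refl _)).
have VX l : apx (V l) (X l) e.
  apply: (dsum_apx (a := fun=> v l) (b := fun=> z l) dZ e0) => //; exact: unitary_bop.
pose v' l := adj S \o V l \o S.
have iV l := unitary_isom (uV l).
have uv' l : unitary_op (v' l).
  have /unitary_opE[bV V1 V2] := uV l.
  have iVa : isom (adj (V l)).
    split; first exact: (bop_adj bV).1.
    by move=> y; rewrite -(iV l).2; have := congr1 (@^~ y) V2 => /= ->.
  apply: (isom_unitary (B := adj S \o adj (V l) \o S)).
  - by apply: isom_comp => //; exact: isom_comp.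
  - by apply: isom_comp => //; exact: isom_comp.
  - apply/funext => y; rewrite /v' /= SaS.
    by have := congr1 (@^~ (S y)) V2 => /= ->.
  - apply/funext => y; rewrite /v' /= SaS.
    by have := congr1 (@^~ (S y)) V1 => /= ->.
have Sv' := pev_intertwine uv' uV iS.1 (fun l x => SaS _).
exists v'; split=> //.
- apply: (@norm_dom_trans _ _ _ _ _ _ V); last first.
    by apply: (dsum_norm_dom dZ (fun _ => uv) uV VpE) => i; exact: norm_dom_refl.
  move=> p M M0 hM y; rewrite -iS.2 Sv' -(iS.2 y); exact: hM.
- apply: (norm_dom_trans (dsum_norm_dom_comp dZ (i := 0) VpE)).
  move=> p M M0 hM y; rewrite -[y]SaS -Sv' !iS.2; exact: hM.
- move=> l.
  rewrite (_ : 4 * _ = e + e); last by rewrite /e -mulrDl; congr (_ * _); rewrite -natrD.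
  apply: apx_trans (W'W l) => y.
  by rewrite -iS.2 (linPB iS.1) /v' /= SaS -W'S -(iS.2 y); exact: VX.
Qed.

End Perturb.

(** * Bounds on the distances *)

Section Distance.
Context {R : realType} {d : nat}.
Local Notation C := R[i].

(** Exchanges the roles of the two tuples on the same space [Y], so that both perturbations can be
    compared with the same [W]. *)
Lemma alternating_swap (H K Y : hilbertType R) (iota : forall p, alternating H K p -> Y) :
  is_dsum iota -> exists iota' : forall p, alternating K H p -> Y,
    [/\ is_dsum iota', forall n x, iota' (n, true) x = iota (n, false) x &
        forall n y, iota' (n, false) y = iota (n, true) y].
Proof.
move=> dY.
exists (fun p => match p as p0 return alternating K H p0 -> Y with
  | (n, true) => @iota (n, false) | (n, false) => @iota (n, true) end).
split=> //; split.
- by move=> [n []]; [exact: (dsum_isom dY (n, false))|exact: (dsum_isom dY (n, true))].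
- move=> [m [|]] [n [|]] x y mn; rewrite (dsum_ortho dY)//; move: mn; rewrite !xpair_eqE ?andbF//.
- apply: (total_reindex (dsum_total dY)) => -[[n [|]] x] /=.
    by exists (existT (alternating K H) (n, false) x).
  by exists (existT (alternating K H) (n, true) x).
Qed.

Hypothesis d0 : (0 < d)%N.

(** For [x != 0], [|x|^2 = |u x|^2 = c <v J x, J u x> <= c |x|^2]. This makes [1 / c] the cosine of
    an angle. *)
Lemma dil_rel_ge1 (H K : hilbertType R) (u : 'I_d -> H -> H) (v : 'I_d -> K -> K) (c : R) J :
  (forall i, unitary_op (u i)) -> (forall i, unitary_op (v i)) -> (exists x : H, x != 0) ->
  0 < c -> dil_rel u c v J -> 1 <= c.
Proof.
move=> uu uv [x]; rewrite -nrm_gt0 => x0 c0 [iJ rel]; pose i := Ordinal d0.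
have n2 : 0 < nrm x ^+ 2 by rewrite exprn_gt0.
rewrite -(ler_pM2r n2) mul1r -[leLHS](congr1 (fun t => t ^+ 2) ((unitary_isom (uu i)).2 x)).
rewrite -rdotxx /rdot rel -hdotZl -/(rdot _ _) rdotZl ler_pM2l//.
apply: le_trans (rdot_le _ _) _.
by rewrite (unitary_isom (uv i)).2 !iJ.2 (unitary_isom (uu i)).2 expr2.
Qed.

Lemma dilates_ge1 (u v : utuple R d) c : 0 < c -> dilates u c v -> 1 <= c.
Proof.
move=> c0 /dil_rel_of_dilates[U [V [J [_ _ h]]]].
apply: (dil_rel_ge1 _ _ _ c0 h); [exact: utuple_unitary|exact: utuple_unitary|].
exact: utuple_neq0.
Qed.

(** [v'] and [u'] are each close to the sum [W] of infinitely many copies of both tuples. The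
    constants [c] and [c'] are kept apart because the two infima in [dD] are approximated
    separately. *)
Lemma dHR_le (u v : utuple R d) (c c' : R) : 0 < c -> 0 < c' ->
  dilates u c v -> dilates v c' u ->
  (dHR u v <= (4 * Num.sqrt (1 - c' ^- 2) + 4 * Num.sqrt (1 - c ^- 2))%:E)%E.
Proof.
move=> c0 c0' duv dvu; have c1 := dilates_ge1 c0 duv; have c1' := dilates_ge1 c0' dvu.
have [U [V [J [J' [/(utuple_equivP d0)[Uu uU] /(utuple_equivP d0)[Vv vV] hJ hJ']]]]] :=
  mutual_dilation d0 duv dvu.
have [UU VV] := (utuple_unitary U, utuple_unitary V).
have [Y [iota dY]] := dsum_exists (alternating (uspace U) (uspace V)).
pose w p : 'I_d -> alternating (uspace U) (uspace V) p -> alternating (uspace U) (uspace V) p :=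
  match p as p0 return
    'I_d -> alternating (uspace U) (uspace V) p0 -> alternating (uspace U) (uspace V) p0 with
  | (_, true) => @uop R d V | (_, false) => @uop R d U end.
have uw p l : unitary_op (w p l) by case: p => n []; [exact: VV|exact: UU].
have [W [uW WE _]] := dsum_tuple dY uw.
have [iota' [dY' iota'T iota'F]] := alternating_swap dY.
have [v' [uv' v'V Vv' v'W]] := swindle c1 UU VV hJ dY uW
  (fun l n x => WE l (n, false) x) (fun l n y => WE l (n, true) y).
have [||u' [uu' u'U Uu' u'W]] := swindle c1' VV UU hJ' dY' uW.
- by move=> l n y; rewrite !iota'F; exact: (WE l (n, true)).
- by move=> l n x; rewrite !iota'T; exact: (WE l (n, false)).
have sY : separable Y.
  by apply: (dsum_separable dY) => -[n []]; exact: utuple_separable.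
have nY : exists y : Y, y != 0.
  have [x x0] := utuple_neq0 V.
  by exists (iota (0, true) x); rewrite -nrm_gt0 (dsum_nrm dY) nrm_gt0.
have tu' : unitary_tuple u' by split.
have tv' : unitary_tuple v' by split.
apply: (@le_trans _ _ (tuple_norm (u' - v'))%:E).
  apply: ereal_inf_lbound; exists Y, u', v'; split=> //.
    by apply/tuple_equivP => //; [exact: utuple_unitary|
      split; [exact: norm_dom_trans Uu|exact: norm_dom_trans Uu']].
  by apply/tuple_equivP => //; [exact: utuple_unitary|
    split; [exact: norm_dom_trans Vv|exact: norm_dom_trans Vv']].
rewrite lee_fin; have e0 : 0 <= 4 * Num.sqrt (1 - c' ^- 2) + 4 * Num.sqrt (1 - c ^- 2).
  by rewrite addr_ge0// mulr_ge0// sqrtr_ge0.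
apply: bigmax_le => // l _; apply: opnorm_le => //.
exact: (apx_trans (u'W l) (apx_sym (v'W l))).
Qed.

End Distance.

Lemma ln_le_subr1 (R : realType) (x : R) : 0 < x -> ln x <= x - 1.
Proof. by move=> x0; rewrite -[in leLHS](subrK 1 x) addrC le_ln1Dx//; lra. Qed.

(** The slack [e ^+ 2 / 2] fits the root: [1 - c^-2 <= 2 ln c <= 2 ln r + e^2], which is at most the
    square of the right-hand side. *)
Lemma sqrt_gap_le (R : realType) (r c e : R) : 1 <= r -> 1 <= c -> 0 < e ->
  c <= r + e ^+ 2 / 2 -> Num.sqrt (1 - c ^- 2) <= Num.sqrt (2 * ln r) + e.
Proof.
move=> r1 c1 e0 cr; have [r0 c0] : 0 < r /\ 0 < c by split; apply: lt_le_trans ltr01 _.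
have lr : 0 <= ln r by rewrite ln_ge0.
have h1 : 1 - c ^- 2 <= 2 * ln c.
  have c2 : 0 < c ^- 2 by rewrite invr_gt0 exprn_gt0.
  have := ln_le_subr1 c2; rewrite lnV ?posrE ?exprn_gt0// lnXn// -mulr_natl; lra.
have h2 : ln c <= ln r + e ^+ 2 / 2.
  have -> : c = r * (c / r) by rewrite mulrC divfK ?gt_eqF.
  rewrite lnM ?posrE ?divr_gt0// lerD2l.
  apply: le_trans (ln_le_subr1 (divr_gt0 c0 r0)) _.
  rewrite lerBlDr ler_pdivrMr//; apply: le_trans cr _.
  by have := sqr_ge0 e; nra.
have s0 := sqrtr_ge0 (2 * ln r).
rewrite -[leRHS]ger0_norm ?addr_ge0 ?(ltW e0)// -sqrtr_sqr ler_wsqrtr//.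
rewrite sqrrD sqr_sqrtr ?mulr_ge0//.
by have := mulr_ge0 s0 (ltW e0); rewrite -mulr_natl; nra.
Qed.

Theorem theorem2p6 (R : realType) (d : nat) (hd : (0 < d)%N) :
  (forall (u v : utuple R d) (c : R), 0 < c ->
     dilates u c v -> dilates v c u ->
     (dHR u v <= (28 * Num.sqrt (1 - c ^- 2))%:E)%E) /\
  (forall u v : utuple R d,
     (dHR u v <= 56%:E * (dD u v) `^ (2^-1))%E).
Proof.
split=> [u v c c0 uv vu|u v].
  (* The two equal terms give the constant 8, which is at most 28. *)
  apply: le_trans (dHR_le hd c0 c0 uv vu) _; rewrite lee_fin -mulrDl.
  by rewrite ler_wpM2r ?sqrtr_ge0// -natrD ler_nat.
(* This lower bound excludes [m = -oo] and makes [ln r] nonnegative. *)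
have ge1 (x y : utuple R d) : (1 <= dil_const x y)%E.
  apply: le_ereal_inf_tmp => _ [c [c0 xy] <-]; rewrite lee_fin.
  exact: (dilates_ge1 hd c0 xy).
rewrite /dD; set m := maxe _ _.
have um : (dil_const u v <= m)%E by rewrite le_max lexx.
have vm : (dil_const v u <= m)%E by rewrite le_max lexx orbT.
have m1 : (1 <= m)%E := le_trans (ge1 u v) um.
move: m um vm m1 => [r| |] um vm r1; last by [].
  rewrite lee_fin in r1; have r0 : 0 < r := lt_le_trans ltr01 r1.
  rewrite lne_EFin// poweR_EFin -EFinM powR12_sqrt ?ln_ge0//.
  apply/lee_addgt0Pr => e e0.
  (* The two distances have total factor 8, so the error adds up to [e]; the main term is
     [8 sqrt 2 sqrt (ln r)]. *)
  have e8 : 0 < e / 8 by rewrite divr_gt0.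
  have feasible (x y : utuple R d) : (dil_const x y <= r%:E)%E ->
      exists c : R, [/\ 0 < c, dilates x c y &
        Num.sqrt (1 - c ^- 2) <= Num.sqrt (2 * ln r) + e / 8].
    move=> xr; have : (dil_const x y < (r + (e / 8) ^+ 2 / 2)%:E)%E.
      apply: le_lt_trans xr _.
      by rewrite lte_fin ltrDl divr_gt0// exprn_gt0.
    move=> /ereal_inf_lt[_ [c [c0 xy] <-]]; rewrite lte_fin => /ltW cr.
    by exists c; split=> //; apply: sqrt_gap_le => //; exact: (dilates_ge1 hd c0 xy).
  have [c [c0 uv hc]] := feasible _ _ um; have [c' [c0' vu hc']] := feasible _ _ vm.
  apply: le_trans (dHR_le hd c0 c0' uv vu) _; rewrite -EFinD lee_fin.
  have s2 : Num.sqrt (2 : R) <= 2.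
    by rewrite -[leRHS]ger0_norm// -sqrtr_sqr ler_wsqrtr//; lra.
  have := sqrtr_ge0 (ln r); move: hc hc'; rewrite sqrtrM//.
  by move: (Num.sqrt 2) s2 (Num.sqrt (ln r)) => s s2 t; nra.
(* If a dilation constant is infinite, so is the right-hand side. *)
have -> : (lne +oo `^ 2^-1 = +oo :> \bar R)%E.
  by rewrite -[lne +oo%E]/(+oo%E : \bar R) poweRyr// invr_eq0.
by rewrite mulry gtr0_sg// mul1e leey.
Qed.
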